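(* The pair $(\mathcal C_n,\mathrm{Par}^1_{l,n})$ is a graded cellular basis of the generalized blob algebra $B_n$ with respect to the dominance order $\lhd$ on $\mathrm{Par}^1_{l,n}$; here, for $\lambda\in \mathrm{Par}^1_{l,n}$, the index set is $T(\lambda)=\mathrm{Std}(\lambda)$, the basis elements are $c^\lambda_{\mathfrak s\mathfrak t}=m_{\mathfrak s\mathfrak t}$ ($\mathfrak s,\mathfrak t\in\mathrm{Std}(\lambda)$), and the anti-automorphism is $*$.
   Context: **Combinatorics.** A one-column $l$-multipartition of $n$ is a tuple $\lambda=((1^{a_1}),\dots,(1^{a_l}))$ with integers $a_m\ge 0$, $\sum_m a_m=n$; its diagram is $[\lambda]=\{(r,1,m):1\le m\le l,\ 1\le r\le a_m\}$, whose elements are called nodes. $\mathrm{Par}^1_{l,n}$ is the set of all of them. Nodes of $\mathbb N\times\{1\}\times\{1,\dots,l\}$ are totally ordered by: $(r,1,m)\lhd(r',1,m')$ iff $r>r'$, or $r=r'$ and $m>m'$. For finite sets $A,B$ of nodes, $A\unlhd B$ iff $|\{\gamma\in A:\gamma\rhd\gamma_0\}|\le|\{\gamma\in B:\gamma\rhd\gamma_0\}|$ for all nodes $\gamma_0$. For one-column multipartitions, $\lambda\unlhd\mu$ iff $[\lambda]\unlhd[\mu]$; $\lhd$ is the strict version. A $\lambda$-tableau is a bijection $\mathfrak t:\{1,\dots,n\}\to[\lambda]$ ($i$ is the entry of the node $\mathfrak t(i)$); it is standard if the entries increase from top to bottom in every component (i.e. along increasing $r$ with $m$ fixed). $\mathrm{Tab}(\lambda)$,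 $\mathrm{Std}(\lambda)$ are the sets of all, resp. standard, $\lambda$-tableaux. $\mathfrak t^\lambda$ is the $\lambda$-tableau with $\mathfrak t^\lambda(1)\rhd\mathfrak t^\lambda(2)\rhd\cdots\rhd\mathfrak t^\lambda(n)$ (numbers filled in along rows). The symmetric group $S_n$ acts on the right on $\mathrm{Tab}(\lambda)$ by $\mathfrak t w=\mathfrak t\circ w$ (so $\mathfrak t s_k$ interchanges entries $k,k+1$, $s_k=(k,k+1)$), and $d(\mathfrak t)\in S_n$ is defined by $\mathfrak t^\lambda d(\mathfrak t)=\mathfrak t$. **Algebra.** Fix integers $e,l,n>1$, a field $F$ and a primitive $e$-th root of unity $q\in F\setminus\{1\}$. Put $I_e=\mathbb Z/e\mathbb Z$. $S_n$ acts on $I_e^n$ on the left by permuting coordinates. Fix $\hat\kappa=(\hat\kappa_1,\dots,\hat\kappa_l)\in\mathbb Z^l$; $\kappa_m\in I_e$ is the image of $\hat\kappa_m$, also identified with its representative in $\{0,\dots,e-1\}$. $\hat\kappa$ is assumed strongly adjacency-free: (i) $\hat\kappa_{m+1}-\hat\kappa_m\ge n$; (ii) $\kappa_i-\kappa_j\not\equiv 0,\pm1 \bmod e$ for $i\ne j$; (iii) $\kappa_1\not\equiv\kappa_l+2\bmod e$; (iv) $\kappa_1<\kappa_2<\dots<\kappa_l$. The generalized blob algebra $B_n$ is the unital associative $F$-algebra with generators $\psi_1,\dots,\psi_{n-1},y_1,\dots,y_n,e(\boldsymbol i)$ ($\boldsymbol i\in I_e^n$) and relations: $e(\boldsymbol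 i)e(\boldsymbol j)=\delta_{\boldsymbol i\boldsymbol j}e(\boldsymbol i)$; $\sum_{\boldsymbol i}e(\boldsymbol i)=1$; $e(\boldsymbol i)=0$ if $i_1\notin\{\kappa_1,\dots,\kappa_l\}$; $e(\boldsymbol i)=0$ if $i_1\in\{\kappa_1,\dots,\kappa_l\}$ and $i_2=i_1+1$; $y_1e(\boldsymbol i)=0$ if $i_1\in\{\kappa_1,\dots,\kappa_l\}$; $y_re(\boldsymbol i)=e(\boldsymbol i)y_r$; $\psi_re(\boldsymbol i)=e(s_r\cdot\boldsymbol i)\psi_r$; $y_ry_s=y_sy_r$; $\psi_ry_s=y_s\psi_r$ if $s\ne r,r+1$; $\psi_r\psi_s=\psi_s\psi_r$ if $|r-s|>1$; $\psi_ry_{r+1}e(\boldsymbol i)=(y_r\psi_r-\delta_{i_r,i_{r+1}})e(\boldsymbol i)$; $y_{r+1}\psi_re(\boldsymbol i)=(\psi_ry_r-\delta_{i_r,i_{r+1}})e(\boldsymbol i)$; $\psi_r^2e(\boldsymbol i)$ equals $0$ if $i_r=i_{r+1}$, $e(\boldsymbol i)$ if $i_r\ne i_{r+1},i_{r+1}\pm1$, $(y_{r+1}-y_r)e(\boldsymbol i)$ if $i_{r+1}=i_r+1$, $(y_r-y_{r+1})e(\boldsymbol i)$ if $i_{r+1}=i_r-1$; $\psi_r\psi_{r+1}\psi_re(\boldsymbol i)=(\psi_{r+1}\psi_r\psi_{r+1}+\alpha)e(\boldsymbol i)$ with $\alpha=-1$ if $i_{r+2}=i_r=i_{r+1}-1$,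 $\alpha=1$ if $i_{r+2}=i_r=i_{r+1}+1$, $\alpha=0$ otherwise. $*$ is the anti-involution of $B_n$ fixing all generators. $B_n$ is $\mathbb Z$-graded by $\deg e(\boldsymbol i)=0$, $\deg y_r=2$, $\deg\psi_re(\boldsymbol i)=-2$ if $i_r=i_{r+1}$, $1$ if $i_r=i_{r+1}\pm1$, $0$ otherwise. **The set $\mathcal C_n$.** The residue of $(r,1,m)$ is $\kappa_m+1-r\in I_e$; the residue sequence of a tableau $\mathfrak t$ is $\boldsymbol i^{\mathfrak t}=(\mathrm{res}(\mathfrak t(1)),\dots,\mathrm{res}(\mathfrak t(n)))$, and $\boldsymbol i^\lambda:=\boldsymbol i^{\mathfrak t^\lambda}$. For each $w\in S_n$ a reduced expression $w=s_{i_1}\cdots s_{i_N}$ is chosen once and for all and $\psi_w:=\psi_{i_1}\cdots\psi_{i_N}$. For $\mathfrak s,\mathfrak t\in\mathrm{Tab}(\lambda)$, $m_{\mathfrak s\mathfrak t}:=\psi_{d(\mathfrak s)}^*\,e(\boldsymbol i^\lambda)\,\psi_{d(\mathfrak t)}$, and $\mathcal C_n:=\{m_{\mathfrak s\mathfrak t}:\lambda\in\mathrm{Par}^1_{l,n},\ \mathfrak s,\mathfrak t\in\mathrm{Std}(\lambda)\}$. **Graded cellular basis.** Let $A$ be a $k$-algebra, $(\Lambda,\le)$ a poset, and for each $\lambda\in\Lambda$ let $T(\lambda)$ be a finite set with elements $c^\lambda_{st}\in A$ ($s,t\in T(\lambda)$) such that all the $c^\lambda_{st}$ form a $k$-basis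 of $A$. This is a cellular basis if (i) the $k$-linear map $c^\lambda_{st}\mapsto c^\lambda_{ts}$ is an algebra anti-automorphism of $A$, and (ii) for $s,t\in T(\lambda)$, $a\in A$ there are scalars $r_{usa}\in k$, not depending on $t$, with $ac^\lambda_{st}\equiv\sum_{u\in T(\lambda)}r_{usa}c^\lambda_{ut}\bmod A^\lambda$, where $A^\lambda$ is the span of all $c^\mu_{ab}$ with $\mu>\lambda$, $a,b\in T(\mu)$. If $A$ is $\mathbb Z$-graded, it is a graded cellular basis if moreover every $c^\lambda_{st}$ is homogeneous and there is a function $\deg:\coprod_\lambda T(\lambda)\to\mathbb Z$ with $\deg c^\lambda_{st}=\deg s+\deg t$. *)

(* Defs.v *)
From HB Require Import structures.
From mathcomp Require Import all_boot all_order all_algebra all_fingroup.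
From mathcomp Require Import boolp generic_quotient.
From mathcomp Require Import zify.

Set Implicit Arguments.
Unset Strict Implicit.
Unset Printing Implicit Defensive.

Import Order.TTheory GRing.Theory Num.Theory.

Local Open Scope quotient_scope.
Local Open Scope ring_scope.

(* Unital associative F-algebras.  The library's [algType] requires [1 != 0],
   which is not known a priori for an algebra given by generators and relations;
   it also precludes a weaker structure inheriting from [pzRingType]. *)
HB.mixin Record Lmodule_isAssocAlgebra (F : fieldType) A
    of GRing.Lmodule F A := {
  amul : A -> A -> A;
  aone : A;
  amulA : associative amul;
  amul1l : left_id aone amul;
  amul1r : right_id aone amul;
  amulPl : forall (a : F) x y z, amul (a *: x + y) z = a *: amul x z + amul y z;
  amulPr : forall (a : F) x y z, amul x (a *: y + z) = a *: amul x y + amul x z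
}.
#[short(type="assocAlgType")]
HB.structure Definition AssocAlgebra (F : fieldType) :=
  {A of GRing.Lmodule F A & Lmodule_isAssocAlgebra F A}.

Section PresentedAlgebra.
Variables (F : fieldType) (X : Type).

Inductive expr : Type :=
| Var of X
| Zero
| One
| Opp of expr
| Add of expr & expr
| Mul of expr & expr
| Scale of F & expr.

HB.instance Definition _ := gen_eqMixin expr.
HB.instance Definition _ := gen_choiceMixin expr.

Variable rel : expr -> expr -> Prop.

(* The smallest congruence containing [rel] and the axioms of unital
   associative F-algebras. *)
Inductive alg_eq : expr -> expr -> Prop :=
| AE_rel x y : rel x y -> alg_eq x y
| AE_refl x : alg_eq x x
| AE_sym x y : alg_eq x y -> alg_eq y x
| AE_trans x y z : alg_eq x y -> alg_eq y z -> alg_eq x z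
| AE_opp x x' : alg_eq x x' -> alg_eq (Opp x) (Opp x')
| AE_add x x' y y' :
    alg_eq x x' -> alg_eq y y' -> alg_eq (Add x y) (Add x' y')
| AE_mul x x' y y' :
    alg_eq x x' -> alg_eq y y' -> alg_eq (Mul x y) (Mul x' y')
| AE_scale a x x' : alg_eq x x' -> alg_eq (Scale a x) (Scale a x')
| AE_addA x y z : alg_eq (Add x (Add y z)) (Add (Add x y) z)
| AE_addC x y : alg_eq (Add x y) (Add y x)
| AE_add0 x : alg_eq (Add Zero x) x
| AE_addN x : alg_eq (Add (Opp x) x) Zero
| AE_mulA x y z : alg_eq (Mul x (Mul y z)) (Mul (Mul x y) z)
| AE_mul1l x : alg_eq (Mul One x) x
| AE_mul1r x : alg_eq (Mul x One) x
| AE_mulDl x y z : alg_eq (Mul (Add x y) z) (Add (Mul x z) (Mul y z))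
| AE_mulDr x y z : alg_eq (Mul x (Add y z)) (Add (Mul x y) (Mul x z))
| AE_scaleA a b x : alg_eq (Scale a (Scale b x)) (Scale (a * b) x)
| AE_scale1 x : alg_eq (Scale 1 x) x
| AE_scaleDr a x y : alg_eq (Scale a (Add x y)) (Add (Scale a x) (Scale a y))
| AE_scaleDl a b x : alg_eq (Scale (a + b) x) (Add (Scale a x) (Scale b x))
| AE_scaleAl a x y : alg_eq (Scale a (Mul x y)) (Mul (Scale a x) y)
| AE_scaleAr a x y : alg_eq (Scale a (Mul x y)) (Mul x (Scale a y)).

Definition alg_eqb (x y : expr) : bool := `[< alg_eq x y >].

Lemma alg_eqb_refl : reflexive alg_eqb.
Proof. by move=> x; apply/asboolP/AE_refl. Qed.
Lemma alg_eqb_sym : symmetric alg_eqb.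
Proof. by move=> x y; apply/asboolP/asboolP => /AE_sym. Qed.
Lemma alg_eqb_trans : transitive alg_eqb.
Proof.
by move=> y x z /asboolP xy /asboolP yz; apply/asboolP/(AE_trans xy yz).
Qed.
Canonical alg_equiv := EquivRel alg_eqb alg_eqb_refl alg_eqb_sym alg_eqb_trans.

Definition pres_alg : Type := {eq_quot alg_equiv}.
HB.instance Definition _ := Choice.on pres_alg.
HB.instance Definition _ := EqQuotient.on pres_alg.

Definition cls (x : expr) : pres_alg := \pi_pres_alg x.

Lemma clsP x y : alg_eq x y <-> cls x = cls y.
Proof.
split=> [xy|]; first by apply/eqmodP/asboolP.
by move/eqmodP/asboolP.
Qed.
Lemma clsK x : alg_eq (repr (cls x)) x.
Proof. by apply/clsP; rewrite /cls reprK. Qed.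
Lemma repr_cls (x : pres_alg) : cls (repr x) = x.
Proof. by rewrite /cls reprK. Qed.

Definition pres_zero := cls Zero.
Definition pres_one := cls One.
Definition pres_opp (x : pres_alg) := cls (Opp (repr x)).
Definition pres_add (x y : pres_alg) := cls (Add (repr x) (repr y)).
Definition pres_mul (x y : pres_alg) := cls (Mul (repr x) (repr y)).
Definition pres_scale (a : F) (x : pres_alg) := cls (Scale a (repr x)).

Lemma pres_oppE x : pres_opp (cls x) = cls (Opp x).
Proof. by apply/clsP/AE_opp/clsK. Qed.
Lemma pres_addE x y : pres_add (cls x) (cls y) = cls (Add x y).
Proof. by apply/clsP/AE_add; apply: clsK. Qed.
Lemma pres_mulE x y : pres_mul (cls x) (cls y) = cls (Mul x y).
Proof. by apply/clsP/AE_mul; apply: clsK. Qed.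
Lemma pres_scaleE a x : pres_scale a (cls x) = cls (Scale a x).
Proof. by apply/clsP/AE_scale/clsK. Qed.

Lemma pres_ind (P : pres_alg -> Prop) : (forall x, P (cls x)) -> forall x, P x.
Proof. by move=> h x; rewrite -(repr_cls x). Qed.

Let presE := (pres_oppE, pres_addE, pres_mulE, pres_scaleE).

Lemma pres_addA : associative pres_add.
Proof.
elim/pres_ind=> x; elim/pres_ind=> y; elim/pres_ind=> z.
by rewrite !presE; apply/clsP; constructor.
Qed.
Lemma pres_addC : commutative pres_add.
Proof.
by elim/pres_ind=> x; elim/pres_ind=> y; rewrite !presE; apply/clsP; constructor.
Qed.
Lemma pres_add0 : left_id pres_zero pres_add.
Proof. by elim/pres_ind=> x; rewrite !presE; apply/clsP; constructor. Qed.
Lemma pres_addN : left_inverse pres_zero pres_opp pres_add.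
Proof. by elim/pres_ind=> x; rewrite !presE; apply/clsP; constructor. Qed.

HB.instance Definition _ := GRing.isZmodule.Build pres_alg
  pres_addA pres_addC pres_add0 pres_addN.

Lemma pres_mulA : associative pres_mul.
Proof.
elim/pres_ind=> x; elim/pres_ind=> y; elim/pres_ind=> z.
by rewrite !presE; apply/clsP; constructor.
Qed.
Lemma pres_mul1l : left_id pres_one pres_mul.
Proof. by elim/pres_ind=> x; rewrite !presE; apply/clsP; constructor. Qed.
Lemma pres_mul1r : right_id pres_one pres_mul.
Proof. by elim/pres_ind=> x; rewrite !presE; apply/clsP; constructor. Qed.
Lemma pres_mulDl : left_distributive pres_mul (@GRing.add pres_alg).
Proof.
elim/pres_ind=> x; elim/pres_ind=> y; elim/pres_ind=> z.
by rewrite /GRing.add /= !presE; apply/clsP; constructor.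
Qed.
Lemma pres_mulDr : right_distributive pres_mul (@GRing.add pres_alg).
Proof.
elim/pres_ind=> x; elim/pres_ind=> y; elim/pres_ind=> z.
by rewrite /GRing.add /= !presE; apply/clsP; constructor.
Qed.

HB.instance Definition _ := GRing.Zmodule_isPzRing.Build pres_alg
  pres_mulA pres_mul1l pres_mul1r pres_mulDl pres_mulDr.

Lemma pres_scaleA a b x :
  pres_scale a (pres_scale b x) = pres_scale (a * b) x.
Proof.
by elim/pres_ind: x => x; rewrite !presE; apply/clsP; constructor.
Qed.
Lemma pres_scale1 : left_id 1 pres_scale.
Proof. by elim/pres_ind=> x; rewrite !presE; apply/clsP; constructor. Qed.
Lemma pres_scaleDr : right_distributive pres_scale (@GRing.add pres_alg).
Proof.
move=> a; elim/pres_ind=> x; elim/pres_ind=> y.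
by rewrite /GRing.add /= !presE; apply/clsP; constructor.
Qed.
Lemma pres_scaleDl x : {morph pres_scale^~ x : a b / a + b}.
Proof.
move=> a b; elim/pres_ind: x => x.
by rewrite [RHS]/GRing.add /= !presE; apply/clsP; constructor.
Qed.

HB.instance Definition _ := GRing.Zmodule_isLmodule.Build F pres_alg
  pres_scaleA pres_scale1 pres_scaleDr pres_scaleDl.

Lemma pres_scaleAl (a : F) (x y : pres_alg) : a *: (x * y) = (a *: x) * y.
Proof.
elim/pres_ind: x => x; elim/pres_ind: y => y.
by rewrite /GRing.scale /GRing.mul /= !presE; apply/clsP; constructor.
Qed.
Lemma pres_scaleAr (a : F) (x y : pres_alg) : a *: (x * y) = x * (a *: y).
Proof.
elim/pres_ind: x => x; elim/pres_ind: y => y.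
by rewrite /GRing.scale /GRing.mul /= !presE; apply/clsP; constructor.
Qed.

Lemma pres_mulPl (a : F) (x y z : pres_alg) :
  (a *: x + y) * z = a *: (x * z) + y * z.
Proof. by rewrite mulrDl pres_scaleAl. Qed.
Lemma pres_mulPr (a : F) (x y z : pres_alg) :
  x * (a *: y + z) = a *: (x * y) + x * z.
Proof. by rewrite mulrDr pres_scaleAr. Qed.

HB.instance Definition _ := Lmodule_isAssocAlgebra.Build F pres_alg
  (@mulrA pres_alg) (@mul1r pres_alg) (@mulr1 pres_alg) pres_mulPl pres_mulPr.

Lemma cls0 : cls Zero = 0. Proof. by []. Qed.
Lemma cls1 : cls One = 1. Proof. by []. Qed.
Lemma clsN x : cls (Opp x) = - cls x. Proof. by rewrite -pres_oppE. Qed.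
Lemma clsD x y : cls (Add x y) = cls x + cls y.
Proof. by rewrite -pres_addE. Qed.
Lemma clsM x y : cls (Mul x y) = cls x * cls y.
Proof. by rewrite -pres_mulE. Qed.
Lemma clsZ a x : cls (Scale a x) = a *: cls x.
Proof. by rewrite -pres_scaleE. Qed.
Lemma cls_sum (I : finType) (f : I -> expr) :
  cls (\big[Add/Zero]_i f i) = \sum_i cls (f i).
Proof. by rewrite (big_morph cls clsD cls0). Qed.

Definition clsE := (cls0, cls1, clsN, clsD, clsM, clsZ, cls_sum).

Fixpoint rev_expr (x : expr) : expr :=
  match x with
  | Var v => Var v
  | Zero => Zero
  | One => One
  | Opp y => Opp (rev_expr y)
  | Add y z => Add (rev_expr y) (rev_expr z)
  | Mul y z => Mul (rev_expr z) (rev_expr y)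
  | Scale a y => Scale a (rev_expr y)
  end.

Definition pres_star (x : pres_alg) : pres_alg := cls (rev_expr (repr x)).

Section Star.
Hypothesis rel_rev :
  forall x y, rel x y -> cls (rev_expr x) = cls (rev_expr y).

Lemma alg_eq_rev x y : alg_eq x y -> cls (rev_expr x) = cls (rev_expr y).
Proof.
elim=> {x y} //=; try by move=> *; rewrite ?clsE; congruence.
- by move=> *; rewrite !clsE addrA.
- by move=> *; rewrite !clsE addrC.
- by move=> *; rewrite !clsE add0r.
- by move=> *; rewrite !clsE addNr.
- by move=> *; rewrite !clsE mulrA.
- by move=> *; rewrite !clsE mulr1.
- by move=> *; rewrite !clsE mul1r.
- by move=> *; rewrite !clsE mulrDr.
- by move=> *; rewrite !clsE mulrDl.
- by move=> *; rewrite !clsE scalerA.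
- by move=> *; rewrite !clsE scale1r.
- by move=> *; rewrite !clsE scalerDr.
- by move=> *; rewrite !clsE scalerDl.
- by move=> *; rewrite !clsE pres_scaleAr.
- by move=> *; rewrite !clsE pres_scaleAl.
Qed.

Lemma pres_starE x : pres_star (cls x) = cls (rev_expr x).
Proof. exact/alg_eq_rev/clsK. Qed.

End Star.
End PresentedAlgebra.

Arguments Zero {F X}.
Arguments One {F X}.
Arguments Var {F X}.

Section CellularBasis.
Variables (F : fieldType) (A : assocAlgType F).

(* [g d] is the homogeneous component of degree [d]. *)
Record zgrading := ZGrading {
  zcomp :> int -> A -> Prop;
  zcomp0 : forall d, zcomp d 0;
  zcompP : forall d (a : F) x y, zcomp d x -> zcomp d y -> zcomp d (a *: x + y);
  zcomp1 : zcomp 0 aone;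
  zcompM : forall d d' x y, zcomp d x -> zcomp d' y -> zcomp (d + d') (amul x y);
  zcomp_span : forall x, exists (s : seq int) (f : int -> A),
    (forall d, zcomp d (f d)) /\ x = \sum_(d <- s) f d;
  zcomp_direct : forall (s : seq int) (f : int -> A), uniq s ->
    (forall d, zcomp d (f d)) -> \sum_(d <- s) f d = 0 ->
    forall d, d \in s -> f d = 0
}.

Definition algebra_anti_automorphism (f : A -> A) : Prop :=
  [/\ forall (a : F) x y, f (a *: x + y) = a *: f x + f y,
      forall x y, f (amul x y) = amul (f y) (f x),
      f aone = aone & bijective f].

Variables (disp : Order.disp_t) (L : finPOrderType disp) (T : L -> finType).
Variable c : forall lam : L, T lam -> T lam -> A.

Definition is_basis : Prop :=
  (forall x : A, exists r : forall lam, T lam -> T lam -> F,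
     x = \sum_lam \sum_s \sum_t r lam s t *: c s t) /\
  (forall r : forall lam, T lam -> T lam -> F,
     \sum_lam \sum_s \sum_t r lam s t *: c s t = 0 ->
     forall lam s t, r lam s t = 0).

Definition higher_span (lam : L) (x : A) : Prop :=
  exists r : forall mu, T mu -> T mu -> F,
    x = \sum_(mu | (lam < mu)%O) \sum_a \sum_b r mu a b *: c a b.

(* By [is_basis], [anti] is the linear map sending each c_st to c_ts. *)
Definition cellular_basis (anti : A -> A) : Prop :=
  [/\ is_basis,
      algebra_anti_automorphism anti,
      forall lam (s t : T lam), anti (c s t) = c t s &
      forall lam (s : T lam) (a : A), exists r : T lam -> F,
        forall t : T lam,
          higher_span lam (amul a (c s t) - \sum_u r u *: c u t)].

Definition graded_cellular_basis (g : zgrading) (anti : A -> A) : Prop :=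
  cellular_basis anti /\
  exists deg : forall lam, T lam -> int,
    forall lam (s t : T lam), g (deg lam s + deg lam t) (c s t).

End CellularBasis.

Section Combinatorics.
Variables (l n : nat).

(* The tuple (a_1, ..., a_l); the bound a_m <= n is implied by the sum. *)
Definition par1 : Type :=
  {a : {ffun 'I_l -> 'I_n.+1} | (\sum_(m < l) a m == n)%N}.
HB.instance Definition _ := Finite.on par1.

(* The node (r,1,m) is (r, m), with rows counted from 1 and components
   from 0. *)
Definition node : Type := (nat * 'I_l)%type.

Definition node_lt (x y : node) : bool :=
  (y.1 < x.1)%N || ((x.1 == y.1) && (y.2 < x.2)%N).

(* A finite type containing all the nodes of all the diagrams; its row 0 is
   never used. *)
Definition box : Type := ('I_n.+1 * 'I_l)%type.
HB.instance Definition _ := Finite.on box.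

Definition box_node (g : box) : node := (g.1 : nat, g.2).

Definition diagram (lam : par1) : {set box} :=
  [set g : box | (1 <= g.1 <= sval lam g.2)%N].

Definition nodes_dom (A B : {set box}) : Prop :=
  forall g0 : node, (#|[set g in A | node_lt g0 (box_node g)]| <=
                     #|[set g in B | node_lt g0 (box_node g)]|)%N.

Definition par1_le (lam mu : par1) : bool :=
  `[< nodes_dom (diagram lam) (diagram mu) >].

Definition is_tableau (lam : par1) (t : {ffun 'I_n -> box}) : bool :=
  injectiveb t && (t @: [set: 'I_n] == diagram lam).

Definition tab (lam : par1) : Type := {t : {ffun 'I_n -> box} | is_tableau lam t}.
HB.instance Definition _ lam := Finite.on (tab lam).

Definition tab_fun lam (t : tab lam) : 'I_n -> box := sval t.
Coercion tab_fun : tab >-> Funclass.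

Definition is_standard lam (t : tab lam) : bool :=
  [forall i, forall j,
     ((t i).2 == (t j).2) && ((t i).1 < (t j).1)%N ==> (i < j)%N].

Definition std (lam : par1) : Type := {t : tab lam | is_standard t}.
HB.instance Definition _ lam := Finite.on (std lam).

Lemma node_lt_irr x : node_lt x x = false.
Proof. rewrite /node_lt; lia. Qed.
Lemma node_lt_trans : transitive node_lt.
Proof. move=> y x z; rewrite /node_lt; lia. Qed.
Lemma node_lt_total x y : x != y -> node_lt x y || node_lt y x.
Proof.
case: x y => r m [r' m']; rewrite /node_lt xpair_eqE -val_eqE /=; lia.
Qed.

(* Nodes of the diagram in decreasing order. *)
Definition node_ge : rel box := fun x y => ~~ node_lt (box_node x) (box_node y).
Definition diagram_seq (lam : par1) : seq box := sort node_ge (enum (diagram lam)).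

Lemma node_ge_total : total node_ge.
Proof. move=> x y; rewrite /node_ge /node_lt; lia. Qed.
Lemma node_ge_trans : transitive node_ge.
Proof. move=> y x z; rewrite /node_ge /node_lt /=; lia. Qed.

Lemma card_diagram lam : #|diagram lam| = n.
Proof.
have /eqP sum_a := valP lam; rewrite -[RHS]sum_a cardsE -sum1_card.
rewrite (eq_bigl (fun g : 'I_n.+1 * 'I_l => true && (1 <= g.1 <= sval lam g.2)%N));
  last by move=> g; rewrite unfold_in.
rewrite -(pair_big_dep xpredT (fun (i : 'I_n.+1) m => (1 <= i <= sval lam m)%N)
            (fun _ _ => 1%N)) /=.
rewrite (exchange_big_dep xpredT) //=; apply: eq_bigr => m _.
rewrite sum1_card.
have := ltn_ord (sval lam m); move: (nat_of_ord (sval lam m)) => k lt_k.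
rewrite cardE -[RHS](size_iota 1) -(size_map val).
apply: perm_size; apply: uniq_perm.
- by rewrite map_inj_uniq ?enum_uniq //; apply: val_inj.
- exact: iota_uniq.
move=> x; rewrite mem_iota; apply/mapP/idP.
- by case=> i; rewrite mem_enum unfold_in => h ->; rewrite add1n ltnS.
- move=> h; have lt_x : (x < n.+1)%N by lia.
  by exists (Ordinal lt_x) => //; rewrite mem_enum unfold_in /= -ltnS -add1n.
Qed.

Lemma size_diagram_seq lam : size (diagram_seq lam) == n.
Proof. by rewrite size_sort -cardE card_diagram. Qed.

Definition tlam_fun (lam : par1) : {ffun 'I_n -> box} :=
  [ffun k => tnth (Tuple (size_diagram_seq lam)) k].

Lemma tlam_subproof lam : is_tableau lam (tlam_fun lam).
Proof.
have inj : injective (tlam_fun lam).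
  have us : uniq (Tuple (size_diagram_seq lam)) by rewrite sort_uniq enum_uniq.
  move=> i j; rewrite /tlam_fun !ffunE => h.
  exact: (elimT (tuple_uniqP _) us i j h).
apply/andP; split; first exact/injectiveP.
apply/eqP/setP => g; apply/imsetP/idP.
- case=> k _ ->; rewrite ffunE.
  have := mem_tnth k (Tuple (size_diagram_seq lam)).
  by rewrite memtE /= mem_sort mem_enum.
- move=> gl; have : g \in Tuple (size_diagram_seq lam).
    by rewrite memtE /= mem_sort mem_enum.
  by case/tnthP => k gk; exists k; rewrite ?inE // ffunE.
Qed.

Definition tlam (lam : par1) : tab lam :=
  exist (fun t => is_tableau lam t) (tlam_fun lam) (tlam_subproof lam).

Lemma tlam_decreasing lam (i j : 'I_n) :
  (i < j)%N -> node_lt (box_node (tlam lam j)) (box_node (tlam lam i)).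
Proof.
move=> ij; set s := diagram_seq lam.
have szs : size s = n by apply/eqP/size_diagram_seq.
have tE (k : 'I_n) : tlam lam k = nth (tlam lam i) s k.
  by rewrite {1}/tlam /tab_fun /= ffunE (tnth_nth (tlam lam i)).
have ss : sorted node_ge s by apply: sort_sorted; apply: node_ge_total.
have us : uniq s by rewrite sort_uniq enum_uniq.
have gij : node_ge (tlam lam i) (tlam lam j).
  rewrite tE [X in node_ge _ X]tE.
  by apply: (sorted_ltn_nth node_ge_trans) => //; rewrite inE szs ltn_ord.
have nij : tlam lam i != tlam lam j.
  by rewrite tE [X in _ != X]tE nth_uniq ?szs ?ltn_ord // neq_ltn ij.
have nij' : box_node (tlam lam i) != box_node (tlam lam j).
  apply: contraNneq nij => -[/ord_inj e1 e2].
  by apply/eqP; move: e1 e2; case: (tlam lam i) (tlam lam j) => [? ?] [? ?] /= -> ->.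
by have := node_lt_total nij'; rewrite (negPf gij).
Qed.

Lemma nodes_dom_anti (lam mu : par1) :
  nodes_dom (diagram lam) (diagram mu) ->
  nodes_dom (diagram mu) (diagram lam) -> lam = mu.
Proof.
move=> h1 h2.
have cE g0 : #|[set g in diagram lam | node_lt g0 (box_node g)]| =
             #|[set g in diagram mu | node_lt g0 (box_node g)]|.
  by apply/eqP; rewrite eqn_leq h1 h2.
have memE (x : box) : (x \in diagram lam) = (x \in diagram mu).
  have [s hs] : exists s : node, forall g : box,
      node_lt s (box_node g) = (g == x) || node_lt (box_node x) (box_node g).
    case: x => r m; case: (ltnP m.+1 l) => [lt_m|le_m].
      exists (r : nat, Ordinal lt_m) => -[r' m'].
      by rewrite xpair_eqE -!val_eqE /node_lt /=; lia.
    have l0 : (0 < l)%N by apply: leq_trans (ltn_ord m).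
    exists (r.+1, Ordinal l0) => -[r' m'].
    rewrite xpair_eqE -!val_eqE /node_lt /=.
    have := ltn_ord m; have := ltn_ord m'; lia.
  have split_card (B : {set box}) : #|[set g in B | node_lt s (box_node g)]| =
      ((x \in B) + #|[set g in B | node_lt (box_node x) (box_node g)]|)%N.
    rewrite (cardsD1 x); congr (_ + _)%N.
      by rewrite !inE hs eqxx /= andbT.
    apply: eq_card => g; rewrite !inE hs.
    by case: (g =P x) => [->|] //=; rewrite node_lt_irr andbF.
  have := cE s; rewrite !split_card cE => /addIn.
  by case: (x \in _) (x \in _) => [] [].
apply: val_inj; apply/ffunP => m; apply/val_inj => /=.
have aux (a b : par1) : (forall x : box, x \in diagram a -> x \in diagram b) ->
    (sval a m <= sval b m)%N.
  move=> ab; case: (posnP (sval a m)) => [-> //|pos].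
  have := ab (sval a m, m); rewrite !inE /= pos leqnn => /(_ isT) /=.
  by [].
by apply/eqP; rewrite eqn_leq !aux // => x; rewrite memE.
Qed.

Fact par1_display : Order.disp_t. Proof. exact: Order.Disp tt tt. Qed.

Lemma par1_le_refl : reflexive par1_le.
Proof. by move=> lam; apply/asboolP. Qed.
Lemma par1_le_anti : antisymmetric par1_le.
Proof.
by move=> lam mu /andP[/asboolP h1 /asboolP h2]; apply: nodes_dom_anti.
Qed.
Lemma par1_le_trans : transitive par1_le.
Proof.
move=> b a c /asboolP h1 /asboolP h2; apply/asboolP => g0.
exact: leq_trans (h1 g0) (h2 g0).
Qed.

HB.instance Definition _ := Order.Le_isPOrder.Build par1_display par1
  par1_le_refl par1_le_anti par1_le_trans.

End Combinatorics.

Section SymmetricGroup.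
Variable n : nat.

(* For [r : 'I_n.-1] standing for k = r+1 in {1, ..., n-1}, [lo r] and [hi r]
   are the positions k and k+1. *)
Definition lo (r : 'I_n.-1) : 'I_n := widen_ord (leq_pred n) r.
Lemma hi_subproof (r : 'I_n.-1) : (r.+1 < n)%N.
Proof. by case: r => r /=; lia. Qed.
Definition hi (r : 'I_n.-1) : 'I_n := Ordinal (hi_subproof r).

Definition strans (r : 'I_n.-1) : 'S_n := tperm (lo r) (hi r).

(* S_n is composed from right to left, [(w * w') x = w (w' x)], which is the
   opposite of the library's product: [:: i_1; ...; i_N] is mapped to
   the composite s_{i_1} o ... o s_{i_N}. *)
Definition word_perm (s : seq 'I_n.-1) : 'S_n :=
  foldr (fun r w => (w * strans r)%g) 1%g s.

Definition reduced_expression (w : 'S_n) (s : seq 'I_n.-1) : Prop :=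
  word_perm s = w /\
  forall s', word_perm s' = w -> (size s <= size s')%N.

Variable l : nat.

(* The permutation d(t) with t^lam o d(t) = t. *)
Definition dperm (lam : par1 l n) (t : tab lam) : 'S_n :=
  odflt 1%g [pick w : 'S_n | [forall k, tlam lam (w k) == t k]].

Lemma dpermP (lam : par1 l n) (t : tab lam) k : tlam lam (dperm t k) = t k.
Proof.
rewrite /dperm; case: pickP => [w /forallP /(_ k) /eqP //|no].
have mem (u : tab lam) i : u i \in diagram lam.
  case/andP: (valP u) => _ /eqP <-; exact: imset_f.
have inj (u : tab lam) : injective u.
  by case/andP: (valP u) => /injectiveP.
have ex i : exists j, tlam lam j == t i.
  have := mem t i; case/andP: (valP (tlam lam)) => _ /eqP {1}<-.
  by case/imsetP => j _ ->; exists j.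
pose f i := xchoose (ex i).
have fE i : tlam lam (f i) = t i by apply/eqP/(xchooseP (ex i)).
have finj : injective f.
  by move=> i j /(congr1 (tlam lam)); rewrite !fE => /inj.
have := no (perm finj); move/negbT/negP; case.
by apply/forallP => i; rewrite permE fE.
Qed.

End SymmetricGroup.

Section Blob.
Variables (F : fieldType) (e n l : nat) (kappa : 'I_l -> 'Z_e).

Definition iseq : Type := {ffun 'I_n -> 'Z_e}.
HB.instance Definition _ := Finite.on iseq.
Implicit Types (i j : iseq) (r s : 'I_n.-1) (k : 'I_n).

(* s_r . i; the position 1 of a residue sequence is the ordinal 0. *)
Definition sact (r : 'I_n.-1) (i : iseq) : iseq := [ffun k => i (strans r k)].

Inductive blob_gen : Type :=
| GPsi of 'I_n.-1
| GY of 'I_n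
| GE of iseq.

Local Notation bexpr := (expr F blob_gen).
Local Notation psi r := (Var (GPsi r) : bexpr).
Local Notation y k := (Var (GY k) : bexpr).
Local Notation E i := (Var (GE i) : bexpr).
Local Notation "a * b" := (Mul a b) : expr_scope.
Local Notation "a + b" := (Add a b) : expr_scope.
Local Notation "a - b" := (Add a (Opp b)) : expr_scope.
Local Notation "- a" := (Opp a) : expr_scope.
Local Notation "0" := Zero : expr_scope.
Local Notation "1" := One : expr_scope.
Delimit Scope expr_scope with X.

Definition delta_expr (a b : 'Z_e) : bexpr := if a == b then One else Zero.

(* [alpha_expr a b c] is alpha for (i_r, i_{r+1}, i_{r+2}) = (a, b, c). *)
Definition alpha_expr (a b c : 'Z_e) : bexpr :=
  if (c == a) && (a == b - 1) then Opp One
  else if (c == a) && (a == b + 1) then One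
  else Zero.

Inductive blob_rel : bexpr -> bexpr -> Prop :=
| B_idem i j : blob_rel (E i * E j)%X (if i == j then E i else 0%X)
| B_sum : blob_rel (\big[@Add F blob_gen / Zero]_(i : iseq) E i) 1%X
| B_first i (k : 'I_n) :
    k = 0%N :> nat -> (forall m, i k <> kappa m) -> blob_rel (E i) 0%X
| B_second i (k k' : 'I_n) : k = 0%N :> nat -> k' = 1%N :> nat ->
    (exists m, i k = kappa m) -> i k' = i k + 1 -> blob_rel (E i) 0%X
| B_y1 i (k : 'I_n) : k = 0%N :> nat ->
    (exists m, i k = kappa m) -> blob_rel (y k * E i)%X 0%X
| B_yE k i : blob_rel (y k * E i)%X (E i * y k)%X
| B_psiE r i : blob_rel (psi r * E i)%X (E (sact r i) * psi r)%X
| B_yy k k' : blob_rel (y k * y k')%X (y k' * y k)%X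
| B_psiy r k : k <> lo r -> k <> hi r -> blob_rel (psi r * y k)%X (y k * psi r)%X
| B_psipsi (r s : 'I_n.-1) : (r.+1 < s)%N || (s.+1 < r)%N ->
    blob_rel (psi r * psi s)%X (psi s * psi r)%X
| B_psiyhi r i :
    blob_rel (psi r * y (hi r) * E i)%X
             ((y (lo r) * psi r - delta_expr (i (lo r)) (i (hi r))) * E i)%X
| B_yhipsi r i :
    blob_rel (y (hi r) * psi r * E i)%X
             ((psi r * y (lo r) - delta_expr (i (lo r)) (i (hi r))) * E i)%X
| B_sq_eq r i : i (lo r) = i (hi r) -> blob_rel (psi r * psi r * E i)%X 0%X
| B_sq_far r i : i (lo r) <> i (hi r) -> i (lo r) <> i (hi r) + 1 ->
    i (lo r) <> i (hi r) - 1 -> blob_rel (psi r * psi r * E i)%X (E i)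
| B_sq_up r i : i (hi r) = i (lo r) + 1 ->
    blob_rel (psi r * psi r * E i)%X ((y (hi r) - y (lo r)) * E i)%X
| B_sq_down r i : i (hi r) = i (lo r) - 1 ->
    blob_rel (psi r * psi r * E i)%X ((y (lo r) - y (hi r)) * E i)%X
| B_braid (r r' : 'I_n.-1) i : r' = r.+1 :> nat ->
    blob_rel (psi r * psi r' * psi r * E i)%X
             ((psi r' * psi r * psi r'
               + alpha_expr (i (lo r)) (i (hi r)) (i (hi r'))) * E i)%X.

Definition blob : Type := pres_alg blob_rel.
HB.instance Definition _ := GRing.PzRing.on blob.
HB.instance Definition _ := AssocAlgebra.on blob.

Definition bgen (x : blob_gen) : blob := cls blob_rel (Var x).
Definition bpsi (r : 'I_n.-1) : blob := bgen (GPsi r).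
Definition by_ (k : 'I_n) : blob := bgen (GY k).
Definition be (i : iseq) : blob := bgen (GE i).

Definition blob_star : blob -> blob := @pres_star F blob_gen blob_rel.

Definition psi_deg (r : 'I_n.-1) (i : iseq) : int :=
  if i (lo r) == i (hi r) then -2
  else if (i (lo r) == i (hi r) + 1) || (i (lo r) == i (hi r) - 1) then 1
  else 0.

Inductive blob_homog : int -> blob -> Prop :=
| H_e i : blob_homog 0 (be i)
| H_y k : blob_homog 2 (by_ k)
| H_psi r i : blob_homog (psi_deg r i) (bpsi r * be i)
| H_zero d : blob_homog d 0
| H_lin d (a : F) x y : blob_homog d x -> blob_homog d y ->
    blob_homog d (a *: x + y)
| H_mul d d' x y : blob_homog d x -> blob_homog d' y ->
    blob_homog (d + d') (x * y).

Local Notation bcls := (cls blob_rel).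

Lemma relP x y : blob_rel x y -> bcls x = bcls y :> blob.
Proof. by move=> h; apply/clsP/AE_rel. Qed.

Lemma sactK r : involutive (sact r).
Proof. by move=> i; apply/ffunP => k; rewrite !ffunE tpermK. Qed.
Lemma sact_lo r i : sact r i (lo r) = i (hi r).
Proof. by rewrite ffunE tpermL. Qed.
Lemma sact_hi r i : sact r i (hi r) = i (lo r).
Proof. by rewrite ffunE tpermR. Qed.
Lemma sact_out r i k : k <> lo r -> k <> hi r -> sact r i k = i k.
Proof. by move=> /eqP h1 /eqP h2; rewrite ffunE tpermD // eq_sym. Qed.
Lemma sact_eq r i : i (lo r) = i (hi r) -> sact r i = i.
Proof.
move=> h; apply/ffunP => k.
case: (k =P lo r) => [->|nl]; first by rewrite sact_lo.
case: (k =P hi r) => [->|nh]; first by rewrite sact_hi.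
exact: sact_out.
Qed.

Lemma be_idem i j : be i * be j = if i == j then be i else 0.
Proof. by have := relP (B_idem i j); rewrite clsM; case: ifP. Qed.
Lemma be_sum : \sum_i be i = 1.
Proof. by have := relP B_sum; rewrite cls_sum. Qed.
Lemma bpsi_e r i : bpsi r * be i = be (sact r i) * bpsi r.
Proof. by have := relP (B_psiE r i); rewrite !clsM. Qed.
Lemma be_psi r i : be i * bpsi r = bpsi r * be (sact r i).
Proof. by rewrite bpsi_e sactK. Qed.
Lemma by_e k i : by_ k * be i = be i * by_ k.
Proof. by have := relP (B_yE k i); rewrite !clsM. Qed.

Definition bdelta (a b : 'Z_e) : blob := if a == b then 1 else 0.
Definition balpha (a b c : 'Z_e) : blob :=
  if (c == a) && (a == b - 1) then -1
  else if (c == a) && (a == b + 1) then 1 else 0.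
Lemma bdeltaE a b : bcls (delta_expr a b) = bdelta a b.
Proof. by rewrite /delta_expr /bdelta; case: ifP. Qed.
Lemma balphaE a b c : bcls (alpha_expr a b c) = balpha a b c.
Proof.
by rewrite /alpha_expr /balpha; do 2?[case: ifP => _ //]; rewrite clsN.
Qed.
Lemma rev_delta a b : rev_expr (delta_expr a b) = delta_expr a b.
Proof. by rewrite /delta_expr; case: ifP. Qed.
Lemma rev_alpha a b c : rev_expr (alpha_expr a b c) = alpha_expr a b c.
Proof. by rewrite /alpha_expr; do 2?case: ifP. Qed.
Lemma balpha_swap a b c : balpha c b a = balpha a b c.
Proof. by rewrite /balpha eq_sym; case: (c =P a) => [->|]. Qed.
Lemma bdelta_swap a b : bdelta a b = bdelta b a.
Proof. by rewrite /bdelta eq_sym. Qed.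

Lemma bpsi_yhi r i : bpsi r * by_ (hi r) * be i =
  (by_ (lo r) * bpsi r - bdelta (i (lo r)) (i (hi r))) * be i.
Proof. by have := relP (B_psiyhi r i); rewrite !(clsD,clsN,clsM) bdeltaE. Qed.
Lemma byhi_psi r i : by_ (hi r) * bpsi r * be i =
  (bpsi r * by_ (lo r) - bdelta (i (lo r)) (i (hi r))) * be i.
Proof. by have := relP (B_yhipsi r i); rewrite !(clsD,clsN,clsM) bdeltaE. Qed.
Lemma bbraid (r r' : 'I_n.-1) i : r' = r.+1 :> nat ->
  bpsi r * bpsi r' * bpsi r * be i =
  (bpsi r' * bpsi r * bpsi r'
     + balpha (i (lo r)) (i (hi r)) (i (hi r'))) * be i.
Proof.
by move=> h; have := relP (B_braid i h); rewrite !(clsD,clsM) balphaE.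
Qed.

Lemma lo_succ (r r' : 'I_n.-1) : r' = r.+1 :> nat -> lo r' = hi r.
Proof. by move=> h; apply: val_inj. Qed.

Section Braid.
Variables (r r' : 'I_n.-1) (h : r' = r.+1 :> nat) (i : iseq).
Let loh := lo_succ h.
Let n1 : lo r <> hi r. Proof. by move=> /(congr1 val) /=; lia. Qed.
Let n2 : lo r <> hi r'. Proof. by move=> /(congr1 val) /=; lia. Qed.
Let n3 : hi r <> hi r'. Proof. by move=> /(congr1 val) /=; lia. Qed.
Let n2' : hi r' <> lo r. Proof. by move/esym. Qed.
Let n3' : hi r' <> hi r. Proof. by move/esym. Qed.
Lemma sact_r_hi' j : sact r j (hi r') = j (hi r').
Proof. exact: sact_out. Qed.
Lemma sact_r'_lo j : sact r' j (lo r) = j (lo r).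
Proof. by apply: sact_out => //; rewrite loh. Qed.
Lemma sact_r'_mid j : sact r' j (hi r) = j (hi r').
Proof. by rewrite -loh sact_lo. Qed.
Lemma sact_r'_hi j : sact r' j (hi r') = j (hi r).
Proof. by rewrite -loh sact_hi. Qed.
Definition sact_braidE :=
  (sact_r_hi', sact_r'_lo, sact_r'_mid, sact_r'_hi, sact_lo, sact_hi).
Lemma sact_braid : sact r (sact r' (sact r i)) = sact r' (sact r (sact r' i)).
Proof.
apply/ffunP => k.
case: (k =P lo r) => [->|nl]; first by rewrite !sact_braidE.
case: (k =P hi r) => [->|nm]; first by rewrite !sact_braidE.
case: (k =P hi r') => [->|nh]; first by rewrite !sact_braidE.
by rewrite !sact_out ?loh.
Qed.
End Braid.

Lemma blob_rel_rev x y :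
  blob_rel x y -> bcls (rev_expr x) = bcls (rev_expr y) :> blob.
Proof.
case=> {x y}.
- move=> i j /=; rewrite clsM -/(be i) -/(be j) be_idem eq_sym.
  by case: eqP => [->|].
- rewrite (big_morph (@rev_expr F blob_gen) (id1 := Zero) (op1 := @Add F blob_gen)) //=.
  by rewrite cls_sum -[RHS]be_sum.
- by move=> i k h1 h2; apply: (relP (B_first h1 h2)).
- by move=> i k k' h1 h2 h3 h4; apply: (relP (B_second h1 h2 h3 h4)).
- move=> i k h1 h2; have := relP (B_y1 h1 h2).
  by rewrite /= !clsM -/(by_ k) -/(be i) by_e.
- by move=> k i /=; rewrite !clsM -/(by_ k) -/(be i) by_e.
- by move=> r i /=; rewrite !clsM -/(bpsi r) -/(be _) be_psi.
- by move=> k k'; apply: (relP (B_yy k' k)).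
- by move=> r k h1 h2; apply/esym/(relP (B_psiy h1 h2)).
- by move=> r s h; apply/esym/(relP (B_psipsi h)).
- move=> r i /=; rewrite rev_delta !(clsD,clsN,clsM) bdeltaE.
  rewrite -/(bpsi r) -!/(by_ _) -/(be i).
  rewrite [LHS]mulrA -by_e -mulrA be_psi mulrA byhi_psi sact_lo sact_hi.
  rewrite mulrBl mulrBr [be i * (_ * _)]mulrA be_psi -!mulrA by_e.
  congr (_ - _).
  rewrite bdelta_swap /bdelta; case: eqP => [h|_]; last by rewrite mul0r mulr0.
  by rewrite sact_eq // mul1r mulr1.
- move=> r i /=; rewrite rev_delta !(clsD,clsN,clsM) bdeltaE.
  rewrite -/(bpsi r) -!/(by_ _) -/(be i).
  rewrite [LHS]mulrA be_psi -mulrA -by_e mulrA bpsi_yhi sact_lo sact_hi.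
  rewrite mulrBl mulrBr [be i * (_ * _)]mulrA -by_e -[_ * be i * _]mulrA be_psi.
  rewrite -!mulrA.
  congr (_ - _).
  rewrite bdelta_swap /bdelta; case: eqP => [h|_]; last by rewrite mul0r mulr0.
  by rewrite sact_eq // mul1r mulr1.
- move=> r i h; have := relP (B_sq_eq h); rewrite /= !clsM -!/(bpsi _) -!/(be _).
  by rewrite mulrA be_psi -!mulrA be_psi sactK.
- move=> r i h1 h2 h3; have := relP (B_sq_far h1 h2 h3).
  rewrite /= !clsM -!/(bpsi _) -!/(be _).
  by rewrite mulrA be_psi -!mulrA be_psi sactK.
- move=> r i h; have := relP (B_sq_up h).
  rewrite /= !(clsM,clsD,clsN) -!/(bpsi _) -!/(be _) -!/(by_ _).
  by rewrite mulrA be_psi -!mulrA be_psi sactK mulrBl mulrBr !by_e.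
- move=> r i h; have := relP (B_sq_down h).
  rewrite /= !(clsM,clsD,clsN) -!/(bpsi _) -!/(be _) -!/(by_ _).
  by rewrite mulrA be_psi -!mulrA be_psi sactK mulrBl mulrBr !by_e.
- move=> r r' i h; rewrite /= rev_alpha !(clsM,clsD) balphaE.
  rewrite -!/(bpsi _) -!/(be _).
  pose j := sact r (sact r' (sact r i)).
  have := bbraid j h.
  rewrite /j !(sact_braidE h) balpha_swap -/j mulrDl => bj.
  have e1 : be i * (bpsi r * (bpsi r' * bpsi r)) =
            bpsi r * bpsi r' * bpsi r * be j.
    by rewrite mulrA be_psi -mulrA [be _ * (_ * _)]mulrA be_psi -[_ * be _ * _]mulrA be_psi !mulrA.
  have e2 : be i * (bpsi r' * (bpsi r * bpsi r')) =
            bpsi r' * bpsi r * bpsi r' * be j.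
    rewrite mulrA be_psi -mulrA [be _ * (_ * _)]mulrA be_psi -[_ * be _ * _]mulrA be_psi.
    by rewrite -sact_braid // !mulrA.
  rewrite e1 bj mulrDr e2; congr (_ + _).
  rewrite /balpha; case: (_ =P i (lo r)) => [e3|_] /=.
    have -> : j = i.
      apply/ffunP => k; rewrite /j.
      case: (k =P lo r) => [->|nl]; first by rewrite !(sact_braidE h).
      case: (k =P hi r) => [->|nm]; first by rewrite !(sact_braidE h).
      case: (k =P hi r') => [->|nh]; first by rewrite !(sact_braidE h).
      by rewrite !sact_out ?(lo_succ h).
    by do 2?case: ifP => _; rewrite ?mulN1r ?mulrN1 ?mulr1 ?mul1r ?mulr0 ?mul0r.
  by rewrite mulr0 mul0r.
Qed.

Lemma blob_starE x : blob_star (bcls x) = bcls (rev_expr x).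
Proof. exact: (pres_starE blob_rel_rev). Qed.

Lemma blob_star_gen x : blob_star (bgen x) = bgen x.
Proof. exact: blob_starE. Qed.
Lemma blob_star1 : blob_star 1 = 1.
Proof. exact: blob_starE. Qed.
Lemma blob_starP (a : F) (x y : blob) :
  blob_star (a *: x + y) = a *: blob_star x + blob_star y.
Proof.
elim/pres_ind: x => x; elim/pres_ind: y => y.
by rewrite -clsZ -clsD !blob_starE /= !clsE.
Qed.
Lemma blob_starM (x y : blob) : blob_star (x * y) = blob_star y * blob_star x.
Proof.
elim/pres_ind: x => x; elim/pres_ind: y => y.
by rewrite -clsM !blob_starE /= !clsE.
Qed.
Lemma blob_starK : involutive blob_star.
Proof.
elim/pres_ind => x; rewrite !blob_starE; congr (bcls _).
by elim: x => //=; congruence.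
Qed.

(* To see that the homogeneous components are in direct sum, let B_n act on
   functions from int to B_n by left multiplication with degree shifts. *)
Local Notation G := (int -> blob).

Fixpoint gop (x : bexpr) (f : G) : G :=
  match x with
  | Var (GPsi r) => fun d => \sum_i bpsi r * be i * f (d - psi_deg r i)
  | Var (GY k) => fun d => by_ k * f (d - 2)
  | Var (GE i) => fun d => be i * f d
  | Zero => fun=> 0
  | One => f
  | Opp x => fun d => - gop x f d
  | Add x y => fun d => gop x f d + gop y f d
  | Mul x y => gop x (gop y f)
  | Scale a x => fun d => a *: gop x f d
  end.

Lemma gop_lin x (a : F) (f g : G) :
  gop x (fun d => a *: f d + g d) = fun d => a *: gop x f d + gop x g d.
Proof.
elim: x f g => /=.
- case=> [r|k|i] f g; apply/funext => d /=.
  + rewrite scaler_sumr -big_split; apply: eq_bigr => i _ /=.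
    by rewrite pres_mulPr.
  + by rewrite pres_mulPr.
  + by rewrite pres_mulPr.
- by move=> f g; apply/funext => d; rewrite scaler0 addr0.
- by [].
- move=> x IH f g; apply/funext => d; rewrite IH scalerN opprD //.
- move=> x IHx y IHy f g; apply/funext => d.
  by rewrite IHx IHy scalerDr addrACA.
- by move=> x IHx y IHy f g; rewrite IHy IHx.
- move=> b x IH f g; apply/funext => d.
  by rewrite IH scalerDr !scalerA mulrC.
Qed.
Lemma gop0 x : gop x (fun=> 0) = fun=> 0.
Proof.
have := gop_lin x (-1) (fun=> 0) (fun=> 0).
have -> : (fun d : int => -1 *: (0 : blob) + 0) = (fun=> 0).
  by apply/funext => d; rewrite scaler0 addr0.
move=> h; apply/funext => d; move: (congr1 (@^~ d) h) => /= ->.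
by rewrite scaleN1r addNr.
Qed.
Lemma gopZ x (a : F) (f : G) :
  gop x (fun d => a *: f d) = fun d => a *: gop x f d.
Proof.
have := gop_lin x a f (fun=> 0); rewrite gop0 => h.
rewrite (_ : (fun d => _) = fun d => a *: f d + 0); last first.
  by apply/funext => d; rewrite addr0.
by rewrite h; apply/funext => d; rewrite addr0.
Qed.
Lemma gopD x (f g : G) :
  gop x (fun d => f d + g d) = fun d => gop x f d + gop x g d.
Proof.
have := gop_lin x 1 f g => h.
rewrite (_ : (fun d => _) = fun d => 1 *: f d + g d); last first.
  by apply/funext => d; rewrite scale1r.
by rewrite h; apply/funext => d; rewrite scale1r.
Qed.
Lemma gopN x (f : G) : gop x (fun d => - f d) = fun d => - gop x f d.
Proof.
rewrite (_ : (fun d => - f d) = fun d => -1 *: f d); last first.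
  by apply/funext => d; rewrite scaleN1r.
by rewrite gopZ; apply/funext => d; rewrite scaleN1r.
Qed.

Definition fixe i (g : G) := forall d, be i * g d = g d.

Lemma fixe_e i (f : G) : fixe i (fun d => be i * f d).
Proof. by move=> d; rewrite mulrA be_idem eqxx. Qed.
Lemma fixe_y k i (g : G) : fixe i g -> fixe i (fun d => by_ k * g (d - 2)).
Proof. by move=> h d; rewrite mulrA -by_e -mulrA h. Qed.
Lemma fixe_psi r i (g : G) p :
  fixe i g -> fixe (sact r i) (fun d => bpsi r * g (d - p)).
Proof. by move=> h d; rewrite mulrA be_psi sactK -mulrA h. Qed.
Lemma gop_psi r i (g : G) : fixe i g ->
  gop (Var (GPsi r)) g = fun d => bpsi r * g (d - psi_deg r i).
Proof.
move=> h; apply/funext => d /=; rewrite (bigD1 i) //= big1 ?addr0.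
  by rewrite -mulrA h.
move=> j nj; rewrite -h mulrA -[_ * be j * be i]mulrA be_idem (negPf nj).
by rewrite mulr0 mul0r.
Qed.

Definition gdeg (a b : 'Z_e) : int :=
  if a == b then -2 else if (a == b + 1) || (a == b - 1) then 1 else 0.
Lemma gdeg_sym a b : gdeg a b = gdeg b a.
Proof.
have h (x y : 'Z_e) : (x == y + 1) = (y == x - 1) by rewrite -subr_eq eq_sym.
by rewrite /gdeg [b == a]eq_sym (h a b) (h b a) orbC.
Qed.
Lemma psi_degE r i : psi_deg r i = gdeg (i (lo r)) (i (hi r)).
Proof. by []. Qed.

Lemma gop_rel x y : blob_rel x y -> gop x = gop y.
Proof.
have rl x' y' : blob_rel x' y' -> bcls x' = bcls y' :> blob by exact: relP.
case=> {x y}.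
- move=> i j; apply/funext => f; apply/funext => d /=.
  by rewrite mulrA be_idem; case: eqP => //= _; rewrite mul0r.
- apply/funext => f; apply/funext => d /=.
  rewrite (big_morph (fun x => gop x f d) (id1 := 0) (op1 := +%R)) //=.
  by rewrite -mulr_suml be_sum mul1r.
- move=> i k h1 h2; apply/funext => f; apply/funext => d /=.
  by rewrite (_ : be i = 0) ?mul0r //; apply: rl (B_first h1 h2).
- move=> i k k' h1 h2 h3 h4; apply/funext => f; apply/funext => d /=.
  by rewrite (_ : be i = 0) ?mul0r //; apply: rl (B_second h1 h2 h3 h4).
- move=> i k h1 h2; apply/funext => f; apply/funext => d /=.
  by have /rl := B_y1 h1 h2; rewrite clsM mulrA -/(by_ k) -/(be i) => ->; rewrite mul0r.
- move=> k i; apply/funext => f; apply/funext => d /=.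
  by rewrite mulrA by_e mulrA.
- move=> r i; apply/funext => f.
  rewrite /= -/(gop (Var (GPsi r)) (fun d => be i * f d)).
  rewrite (gop_psi r (fixe_e i f)); apply/funext => d.
  rewrite mulr_sumr (bigD1 i) //= big1 ?addr0.
    by rewrite !mulrA be_psi sactK -[_ * be i * be i]mulrA be_idem eqxx.
  move=> j nj; rewrite !mulrA be_psi sactK -[_ * be i * be j]mulrA be_idem.
  by rewrite eq_sym (negPf nj) mulr0 mul0r.
- move=> k k'; apply/funext => f; apply/funext => d /=.
  have /rl := B_yy k k'; rewrite !clsM -!/(by_ _) !mulrA => ->.
  by [].
- move=> r k h1 h2; apply/funext => f; apply/funext => d /=.
  rewrite mulr_sumr; apply: eq_bigr => i _.
  have /rl := B_psiy h1 h2; rewrite !clsM -!/(by_ _) -/(bpsi _) => h.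
  by rewrite !mulrA -[_ * be i * _]mulrA -by_e mulrA h addrAC.
- move=> r s h; apply/funext => f; apply/funext => d /=.
  have /rl := B_psipsi h; rewrite !clsM -!/(bpsi _) => h'.
  have key (a b : 'I_n.-1) : (a.+1 < b)%N || (b.+1 < a)%N ->
      \sum_i bpsi a * be i * (\sum_j bpsi b * be j *
         f (d - psi_deg a i - psi_deg b j)) =
      \sum_j bpsi a * bpsi b * be j * f (d - psi_deg a j - psi_deg b j).
    move=> hab; under eq_bigr do rewrite mulr_sumr.
    rewrite exchange_big; apply: eq_bigr => j _ /=.
    rewrite (bigD1 (sact b j)) //= big1 ?addr0.
      rewrite !mulrA -[_ * be _ * bpsi b]mulrA be_psi sactK !mulrA.
      rewrite -[_ * be j * be j]mulrA be_idem eqxx.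
      congr (_ * f (_ - _ - _)); rewrite !psi_degE !sact_out //;
        move=> /(congr1 val) /=; lia.
    move=> i ni; rewrite !mulrA -[_ * be _ * bpsi b]mulrA be_psi !mulrA.
    rewrite -[_ * be _ * be j]mulrA be_idem.
    rewrite (_ : sact b i == j = false) ?mulr0 ?mul0r //.
    by apply: contraNF ni => /eqP <-; rewrite sactK.
  rewrite key // key 1?orbC //; apply: eq_bigr => j _.
  by rewrite h' addrAC.
- move=> r i; apply/funext => f; apply/funext => d.
  have fg := fixe_e i f; set g : G := fun d => be i * f d in fg.
  change (gop (Var (GPsi r)) (gop (Var (GY (hi r))) g) d =
    by_ (lo r) * gop (Var (GPsi r)) g (d - 2)
      - gop (delta_expr (i (lo r)) (i (hi r))) g d).
  clearbody g.
  rewrite !(gop_psi r fg) (gop_psi r (fixe_y (hi r) fg)) -(fg (_ - 2)).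
  rewrite !mulrA bpsi_yhi -[_ * be i * _]mulrA fg mulrBl addrAC; congr (_ - _).
  rewrite /bdelta /delta_expr psi_degE /gdeg; case: eqP => /= _.
    by rewrite mul1r opprK -addrA addrN addr0.
  by rewrite mul0r.
- move=> r i; apply/funext => f; apply/funext => d.
  have fg := fixe_e i f; set g : G := fun d => be i * f d in fg.
  change (by_ (hi r) * gop (Var (GPsi r)) g (d - 2) =
    gop (Var (GPsi r)) (gop (Var (GY (lo r))) g) d
      - gop (delta_expr (i (lo r)) (i (hi r))) g d).
  clearbody g.
  rewrite !(gop_psi r fg) (gop_psi r (fixe_y (lo r) fg)).
  rewrite -(fg (_ - psi_deg r i)).
  rewrite !mulrA byhi_psi -[_ * be i * _]mulrA fg mulrBl addrAC; congr (_ - _).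
  rewrite /bdelta /delta_expr psi_degE /gdeg; case: eqP => /= _.
    by rewrite mul1r addrAC opprK -addrA addrN addr0.
  by rewrite mul0r.
- move=> r i h; apply/funext => f; apply/funext => d.
  have fg := fixe_e i f; set g : G := fun d => be i * f d in fg.
  change (gop (Var (GPsi r)) (gop (Var (GPsi r)) g) d = 0).
  clearbody g.
  rewrite (gop_psi r fg) (gop_psi r (fixe_psi r _ fg)) -fg !mulrA.
  by have /rl := B_sq_eq h; rewrite !clsM => ->; rewrite mul0r.
- move=> r i h1 h2 h3; apply/funext => f; apply/funext => d.
  have fg := fixe_e i f; set g : G := fun d => be i * f d in fg.
  change (gop (Var (GPsi r)) (gop (Var (GPsi r)) g) d = g d).
  clearbody g.
  rewrite (gop_psi r fg) (gop_psi r (fixe_psi r _ fg)) -fg !mulrA.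
  have /rl := B_sq_far h1 h2 h3; rewrite !clsM => ->.
  have d0 : psi_deg r i = 0.
    rewrite psi_degE /gdeg; move/eqP/negPf: h1 => ->.
    by move/eqP/negPf: h2 => ->; move/eqP/negPf: h3 => ->.
  have d1 : psi_deg r (sact r i) = 0.
    by rewrite psi_degE sact_lo sact_hi gdeg_sym -psi_degE.
  by rewrite -/(be i) fg d0 d1 !subr0.
- move=> r i h; apply/funext => f; apply/funext => d.
  have fg := fixe_e i f; set g : G := fun d => be i * f d in fg.
  change (gop (Var (GPsi r)) (gop (Var (GPsi r)) g) d =
    by_ (hi r) * g (d - 2) - by_ (lo r) * g (d - 2)).
  clearbody g.
  rewrite (gop_psi r fg) (gop_psi r (fixe_psi r _ fg)) -fg !mulrA.
  have /rl := B_sq_up h; rewrite !(clsM, clsD, clsN) => ->.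
  have d0 : psi_deg r i = 1.
    rewrite psi_degE /gdeg h addrK eqxx orbT.
    by rewrite -subr_eq0 opprD addNKr oppr_eq0 oner_eq0.
  have d1 : psi_deg r (sact r i) = 1.
    by rewrite psi_degE sact_lo sact_hi gdeg_sym -psi_degE.
  by rewrite -/(be i) -[_ * be i * _]mulrA fg d0 d1 -addrA -opprD mulrBl.
- move=> r i h; apply/funext => f; apply/funext => d.
  have fg := fixe_e i f; set g : G := fun d => be i * f d in fg.
  change (gop (Var (GPsi r)) (gop (Var (GPsi r)) g) d =
    by_ (lo r) * g (d - 2) - by_ (hi r) * g (d - 2)).
  clearbody g.
  rewrite (gop_psi r fg) (gop_psi r (fixe_psi r _ fg)) -fg !mulrA.
  have /rl := B_sq_down h; rewrite !(clsM, clsD, clsN) => ->.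
  have d0 : psi_deg r i = 1.
    rewrite psi_degE /gdeg h subrK eqxx /=.
    by rewrite -subr_eq0 opprB addrCA addrN addr0 oner_eq0.
  have d1 : psi_deg r (sact r i) = 1.
    by rewrite psi_degE sact_lo sact_hi gdeg_sym -psi_degE.
  by rewrite -/(be i) -[_ * be i * _]mulrA fg d0 d1 -addrA -opprD mulrBl.
- move=> r r' i h; apply/funext => f; apply/funext => d.
  have fg := fixe_e i f; set g : G := fun d => be i * f d in fg.
  change (gop (Var (GPsi r)) (gop (Var (GPsi r')) (gop (Var (GPsi r)) g)) d =
    gop (Var (GPsi r')) (gop (Var (GPsi r)) (gop (Var (GPsi r')) g)) d
    + gop (alpha_expr (i (lo r)) (i (hi r)) (i (hi r'))) g d).
  clearbody g.
  have f1 := fixe_psi r (psi_deg r i) fg.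
  have f2 := fixe_psi r' (psi_deg r' (sact r i)) f1.
  have f1' := fixe_psi r' (psi_deg r' i) fg.
  have f2' := fixe_psi r (psi_deg r (sact r' i)) f1'.
  rewrite (gop_psi r fg) (gop_psi r' f1) (gop_psi r f2).
  rewrite (gop_psi r' fg) (gop_psi r f1') (gop_psi r' f2').
  rewrite !psi_degE !(lo_succ h) !(sact_braidE h).
  rewrite -[X in bpsi r * (bpsi r' * (bpsi r * X))]fg !mulrA bbraid //.
  rewrite -[_ * be i * _]mulrA fg mulrDl; congr (_ + _).
    by congr (_ * g _); lia.
  rewrite /balpha /alpha_expr; case: eqP => [->|_] /=; last by rewrite mul0r.
  have gd a b : (a == b - 1) || (a == b + 1) -> gdeg a b = 1 /\ gdeg b a = 1.
    move=> hab; rewrite [gdeg b a]gdeg_sym /gdeg orbC hab.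
    suff /negPf -> : a != b by [].
    case/orP: hab => /eqP ->; rewrite -subr_eq0 addrAC addrN add0r.
      by rewrite oppr_eq0 oner_eq0.
    by rewrite oner_eq0.
  have gaa a : gdeg a a = -2 by rewrite /gdeg eqxx.
  case: ifP => [h1|_].
    have [] := gd (i (lo r)) (i (hi r)); first by rewrite h1.
    by move=> -> ->; rewrite gaa /= mulN1r; congr (- g _); lia.
  case: ifP => [h1|_]; last by rewrite mul0r.
  have [] := gd (i (lo r)) (i (hi r)); first by rewrite h1 orbT.
  by move=> -> ->; rewrite gaa /= mul1r; congr (g _); lia.
Qed.

Lemma gop_alg_eq x y : alg_eq blob_rel x y -> gop x = gop y.
Proof.
elim=> {x y} /=; try by move=> *; congruence.
all: try by move=> *; apply/funext => f; apply/funext => d; congruence.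
- exact: gop_rel.
all: move=> *; apply/funext => f; apply/funext => d /=.
all: rewrite ?gopD ?gopZ ?gopN ?addrA ?addNr ?add0r ?scalerA ?scale1r //.
- by rewrite addrC.
- by rewrite scalerDr.
- by rewrite scalerDl.
Qed.

Definition zop (x : blob) : G -> G := gop (repr x).
Lemma zopE x : zop (bcls x) = gop x.
Proof. exact/gop_alg_eq/clsK. Qed.
Lemma zop0 f d : zop 0 f d = 0.
Proof. by rewrite (zopE Zero). Qed.
Lemma zopP (a : F) x y f d : zop (a *: x + y) f d = a *: zop x f d + zop y f d.
Proof.
elim/pres_ind: x => x; elim/pres_ind: y => y.
by rewrite -clsZ -clsD !zopE.
Qed.
Lemma zopM x y f d : zop (x * y) f d = zop x (zop y f) d.
Proof.
elim/pres_ind: x => x; elim/pres_ind: y => y.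
by rewrite -clsM !zopE.
Qed.
Lemma zop_sum (s : seq int) (h : int -> blob) f d :
  zop (\sum_(k <- s) h k) f d = \sum_(k <- s) zop (h k) f d.
Proof.
rewrite (big_morph (fun x => zop x f d) (id1 := 0) (op1 := +%R)) ?zop0 //.
by move=> x y; have := zopP 1 x y f d; rewrite !scale1r.
Qed.

Lemma zop_homog (k : int) x : blob_homog k x -> forall f d, zop x f d = x * f (d - k).
Proof.
elim=> {k x}.
- by move=> i f d; rewrite zopE /= subr0.
- by move=> k f d; rewrite zopE.
- move=> r i f d; rewrite zopM !zopE.
  by rewrite (gop_psi r (fixe_e i f)) mulrA.
- by move=> k f d; rewrite zop0 mul0r.
- move=> k a x y _ IHx _ IHy f d.
  by rewrite zopP IHx IHy mulrDl pres_scaleAl.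
- move=> k k' x y _ IHx _ IHy f d.
  by rewrite zopM IHx IHy mulrA opprD addrA.
Qed.

Lemma blob_homog1 : blob_homog 0 1.
Proof.
rewrite -be_sum; apply: (big_ind (blob_homog 0)).
- exact: H_zero.
- by move=> x y hx hy; rewrite -[x]scale1r; apply: H_lin.
- by move=> i _; apply: H_e.
Qed.

Lemma blob_homog_sum (I : Type) (s : seq I) (P : pred I) d (f : I -> blob) :
  (forall x, P x -> blob_homog d (f x)) ->
  blob_homog d (\sum_(x <- s | P x) f x).
Proof.
move=> h; apply: big_ind => //; first exact: H_zero.
by move=> x y hx hy; rewrite -[x]scale1r; apply: H_lin.
Qed.

Lemma blob_homog_direct (s : seq int) (f : int -> blob) : uniq s ->
  (forall d, blob_homog d (f d)) -> \sum_(d <- s) f d = 0 ->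
  forall d, d \in s -> f d = 0.
Proof.
move=> us hf sf d ds.
pose one : int -> blob := fun k : int => if k == 0 then 1 else 0.
have := zop_sum s f one d; rewrite sf zop0 (bigD1_seq d) //= big1.
  by rewrite (zop_homog (hf d)) subrr /one eqxx mulr1 addr0.
move=> k kd; rewrite (zop_homog (hf k)) /one subr_eq0 eq_sym (negPf kd).
exact: mulr0.
Qed.

Definition hdecomp (x : blob) : Prop := exists s : seq (int * blob),
  (forall p, List.In p s -> blob_homog p.1 p.2) /\ x = \sum_(p <- s) p.2.

Lemma hdecomp_homog d x : blob_homog d x -> hdecomp x.
Proof.
move=> h; exists [:: (d, x)]; split; last by rewrite big_seq1.
by move=> p [<-|[]].
Qed.
Lemma hdecompD x y : hdecomp x -> hdecomp y -> hdecomp (x + y).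
Proof.
move=> [s [hs ->]] [t [ht ->]]; exists (s ++ t); rewrite big_cat; split=> //.
by move=> p ps; case: (List.in_app_or s t p ps) => [/hs|/ht].
Qed.
Lemma hdecomp0 : hdecomp 0.
Proof. exact/(@hdecomp_homog 0)/H_zero. Qed.
Lemma hdecomp_sum (I : Type) (s : seq I) (f : I -> blob) :
  (forall x, List.In x s -> hdecomp (f x)) -> hdecomp (\sum_(x <- s) f x).
Proof.
elim: s => [|x s IH] h; first by rewrite big_nil; apply: hdecomp0.
rewrite big_cons; apply: hdecompD; first by apply: h; left.
by apply: IH => y ys; apply: h; right.
Qed.
Lemma hdecompM x y : hdecomp x -> hdecomp y -> hdecomp (x * y).
Proof.
move=> [s [hs ->]] [t [ht ->]]; rewrite mulr_suml.
apply: hdecomp_sum => p /hs hp; rewrite mulr_sumr.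
by apply: hdecomp_sum => p' /ht hp'; apply: hdecomp_homog (H_mul hp hp').
Qed.
Lemma hdecompZ (a : F) x : hdecomp x -> hdecomp (a *: x).
Proof.
move=> [s [hs ->]]; rewrite scaler_sumr.
apply: hdecomp_sum => p /hs hp; apply: (@hdecomp_homog p.1).
by rewrite -[_ *: _]addr0; apply: H_lin => //; apply: H_zero.
Qed.
Lemma hdecomp_all x : hdecomp x.
Proof.
elim/pres_ind: x; elim.
- case=> [r|k|i].
  + rewrite -[X in hdecomp X]mulr1 -be_sum mulr_sumr.
    by apply: hdecomp_sum => i _; apply: hdecomp_homog (H_psi r i).
  + exact: hdecomp_homog (H_y k).
  + exact: hdecomp_homog (H_e i).
- exact: hdecomp0.
- exact: hdecomp_homog blob_homog1.
- by move=> x hx; rewrite clsN -scaleN1r; apply: hdecompZ.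
- by move=> x hx y hy; rewrite clsD; apply: hdecompD.
- by move=> x hx y hy; rewrite clsM; apply: hdecompM.
- by move=> a x hx; rewrite clsZ; apply: hdecompZ.
Qed.

Lemma blob_homog_span (x : blob) : exists (s : seq int) (f : int -> blob),
  (forall d, blob_homog d (f d)) /\ x = \sum_(d <- s) f d.
Proof.
have [s [hs ->]] := hdecomp_all x.
exists (undup (map fst s)), (fun d => \sum_(p <- s | p.1 == d) p.2); split.
  move=> d; elim: s hs => [|p s IH] hs; first by rewrite big_nil; apply: H_zero.
  rewrite big_cons; have hp := hs p (or_introl erefl).
  have {}IH := IH (fun q qs => hs q (or_intror qs)).
  case: eqP => [hd|] //; rewrite -[p.2]scale1r.
  by apply: H_lin => //; rewrite -hd.
rewrite (exchange_big_dep xpredT) //= [LHS]big_seq [RHS]big_seq.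
apply: eq_bigr => p ps; rewrite big_mkcond (bigD1_seq p.1) ?undup_uniq //=.
  by rewrite eqxx big1 ?addr0 // => d; rewrite eq_sym => /negPf ->.
by rewrite mem_undup map_f.
Qed.

Definition blob_grading : zgrading blob :=
  ZGrading H_zero H_lin blob_homog1 H_mul blob_homog_span blob_homog_direct.

Section CellularElements.
(* [red w] is the chosen reduced expression of [w]. *)
Variable red : 'S_n -> seq 'I_n.-1.

Definition psi_perm (w : 'S_n) : blob := \prod_(r <- red w) bpsi r.

Definition node_res (x : node l) : 'Z_e := kappa x.2 + 1 - (x.1)%:R.

Definition res_seq (lam : par1 l n) (t : tab lam) : iseq :=
  [ffun k => node_res (box_node (t k))].

Definition blob_m (lam : par1 l n) (s t : tab lam) : blob :=
  blob_star (psi_perm (dperm s)) * be (res_seq (tlam lam))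
    * psi_perm (dperm t).

Definition blob_c (lam : par1 l n) (s t : std lam) : blob :=
  blob_m (sval s) (sval t).

End CellularElements.
End Blob.

Definition khat_res (e l : nat) (khat : 'I_l -> int) : 'I_l -> 'Z_e :=
  fun m => (khat m)%:~R.

Definition strongly_adjacency_free (e l n : nat) (khat : 'I_l -> int) : Prop :=
  let kappa := khat_res e khat in
  [/\ forall m m' : 'I_l, m' = m.+1 :> nat -> n%:Z <= khat m' - khat m,
      forall i j : 'I_l, i <> j ->
        [/\ kappa i - kappa j <> 0, kappa i - kappa j <> 1 &
            kappa i - kappa j <> -1],
      forall i j : 'I_l, i = 0%N :> nat -> j = l.-1 :> nat ->
        kappa i <> kappa j + 2 &
      forall i j : 'I_l, (i < j)%N -> (val (kappa i) < val (kappa j))%N].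

(* Main.v *)
Require Import Defs.
From HB Require Import structures.
From mathcomp Require Import all_boot all_order all_algebra all_fingroup.
From mathcomp Require Import boolp generic_quotient zify ring.

Set Implicit Arguments.
Unset Strict Implicit.
Unset Printing Implicit Defensive.

Import GRing.Theory.
Local Open Scope ring_scope.

(** The proof has two halves, which meet in a deformation of the algebra.

    Spanning and the cell rule.  A node [(r, m)] is coded by the number
    [r * l + m], so that a larger node has a smaller code and a diagram is an
    increasing sequence of codes.  What strong adjacency-freeness provides is
    [nres_far]: two distinct nodes whose codes differ by less than [l] have
    residues that are neither equal nor adjacent, so that the strands of these
    nodes cross freely.  From this, [good_all] shows by induction that an
    idempotent whose residue sequence is that of a diagram [s] followed by one
    more residue lies in the ideal of the diagrams that dominate [s] with one
    node added, and that a dot acts on the idempotent of [s] by a scalar, up to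
    the ideal of the strictly larger diagrams.  Hence every idempotent is
    generated by idempotents of diagrams ([ee_any]); modulo larger diagrams,
    [psi_w e(s)] depends, up to shorter words, only on [w] ([matsumoto]), words
    that are not reduced are combinations of shorter ones
    ([low_nonreduced]), and so are the reduced words of non-standard tableaux
    ([low_nonstd]), because undoing their descents
    leads to an idempotent of a larger diagram ([swapped_higher]).  So the
    left module generated by [e(s)] is spanned, modulo larger diagrams, by the
    words of the standard tableaux ([gen_cell_span]), and the same result in
    the opposite algebra describes the right module.  Multiplying the two gives
    the spanning property ([gen_cells]) and the cell rule ([blob_cell_mul]).

    Linear independence.  All of the above holds, over any commutative ring of
    scalars, when the relation [y_1 e(i) = 0] is replaced by
    [y_1 e(i) = X_m e(i)], where [m] is the component with [i_1 = kappa_m].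
    For pairwise distinct [X_m] in a field [K] these laws have a seminormal
    representation on the space with basis the words of length [n] in the
    components ([rep_laws]); a word is the same as a standard tableau.
    Interpolating in the dots, which act diagonally with distinct joint
    eigenvalues, shows that the image contains the matrix units of all pairs
    of standard tableaux of equal shape ([gen_tunit]).  The cells span these
    linearly independent elements, and there are equally many of them, so that
    the cells are independent over [K] ([cells_free]).  Now let [K] be the field
    of fractions of [F[x]] and [X_m = x ^ (m + 1)].  The relations of the blob
    algebra hold in the representation up to [x] times the [F[x]]-subalgebra
    generated by the matrices ([ev_rel]), so a relation
    [sum r c = 0] in the blob algebra gives [sum r c = x * b] for the matrices,
    with [b] in that subalgebra.  By the spanning result over [F[x]],
    [b = sum o c]; independence over [K] yields [r = x * o], whence [r = 0].

    The grading is immediate: a word in the [psi] times an idempotent is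
    homogeneous of a degree that depends on the word and the residues only. *)

(** * Dominance of sets of codes *)
Section Dominance.
Local Open Scope nat_scope.

Definition cnt (b : nat) (s : seq nat) := count (fun x => x < b) s.

Arguments cnt : simpl never.

(** As a smaller code is a larger node, [cnt b] counts the nodes above a given
    one, and this is the dominance order on sets of [n] nodes, read on lists. *)
Definition domle (s t : seq nat) :=
  size s = size t /\ forall b, cnt b s <= cnt b t.

Definition domlt (s t : seq nat) := domle s t /\ exists b, cnt b s < cnt b t.

Lemma cnt_cat b s t : cnt b (s ++ t) = cnt b s + cnt b t.
Proof. exact: count_cat. Qed.

Lemma cnt_cons b x s : cnt b (x :: s) = (x < b) + cnt b s.
Proof. by []. Qed.

Lemma dom_refl s : domle s s.
Proof. by []. Qed.

Lemma dom_trans t s u : domle s t -> domle t u -> domle s u.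
Proof.
move=> [e1 h1] [e2 h2]; split=> [|b]; first by rewrite e1.
exact: leq_trans (h1 b) (h2 b).
Qed.

Lemma sdomW s t : domlt s t -> domle s t.
Proof. by case. Qed.

Lemma dom_sdom_trans t s u : domle s t -> domlt t u -> domlt s u.
Proof.
move=> d1 [d2 [b hb]]; split; first exact: dom_trans d2.
by exists b; apply: leq_ltn_trans hb; case: d1.
Qed.

Lemma sdom_dom_trans t s u : domlt s t -> domle t u -> domlt s u.
Proof.
move=> [d1 [b hb]] d2; split; first exact: dom_trans d2.
by exists b; apply: leq_trans hb _; case: d2.
Qed.

Lemma dom_cat s s' t t' : domle s s' -> domle t t' -> domle (s ++ t) (s' ++ t').
Proof.
move=> [e1 h1] [e2 h2]; split=> [|b]; first by rewrite !size_cat e1 e2.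
by rewrite !cnt_cat leq_add.
Qed.

Lemma sdom_cat s s' t t' : domlt s s' -> domle t t' -> domlt (s ++ t) (s' ++ t').
Proof.
move=> [d1 [b hb]] d2; split; first exact: dom_cat.
exists b; rewrite !cnt_cat -addSn leq_add //; by case: d2.
Qed.

Lemma dom_perm s t : perm_eq s t -> domle s t.
Proof. by move=> p; split=> [|b]; [exact: perm_size | rewrite /cnt (seq.permP p)]. Qed.

Lemma dom_cons x y s t : y <= x -> domle s t -> domle (x :: s) (y :: t).
Proof.
move=> xy [e1 h1]; split=> [|b] /=; first by rewrite e1.
by rewrite !cnt_cons leq_add //; case: (ltnP x b) => // /(leq_ltn_trans xy) ->.
Qed.

Lemma dom_all d s t : domle s t -> all (fun x => x < d) s -> all (fun x => x < d) t.
Proof.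
move=> [e1 /(_ d) h]; rewrite !all_count => /eqP hs.
by rewrite eqn_leq count_size -e1 -[X in X <= _]hs.
Qed.

(** Makes the sum of the codes decrease under dominance, so that inductions along
    the dominance order can be made on a natural number. *)
Lemma sum_cnt M s : all (fun x => x <= M) s ->
  sumn s + \sum_(b < M) cnt b.+1 s = size s * M.
Proof.
elim: s => [|x s IH] /=; first by rewrite big1.
case/andP=> xM /IH {}IH; rewrite mulSn -IH.
have -> : \sum_(b < M) cnt b.+1 (x :: s) =
          (M - x) + \sum_(b < M) cnt b.+1 s.
  transitivity (\sum_(b < M) (x < b.+1) + \sum_(b < M) cnt b.+1 s).
    by rewrite -big_split.
  congr (_ + _).
  elim: {s IH} M xM => [|N IHN] xN; first by rewrite big_ord0.
  rewrite big_ord_recr /=; case: (ltngtP x N.+1) xN => // [xN|->] _.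
    by rewrite IHN; lia.
  rewrite big1; first by lia.
  by move=> i _; have := ltn_ord i; lia.
lia.
Qed.

Lemma sdom_sumn s t : domlt s t -> sumn t < sumn s.
Proof.
move=> [[e1 h1] [b hb]].
have [M hM] : exists M, [/\ all (fun x => x <= M) s, all (fun x => x <= M) t & b < M].
  have mem_le u x : x \in u -> x <= sumn u.
    by elim: u => //= y u IH; rewrite inE => /orP[/eqP->|/IH]; lia.
  exists (sumn s + sumn t + b).+1; split; last by lia.
    by apply/allP => x /mem_le; lia.
  by apply/allP => x /mem_le; lia.
case: hM => hs ht bM.
have b0 : 0 < b.
  by case: b hb {bM} => // ; rewrite /cnt (eq_count (a2 := pred0)) // count_pred0 //
    (eq_count (a2 := pred0)) // count_pred0.
have := sum_cnt hs; have := sum_cnt ht; rewrite -e1.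
suff : \sum_(b < M) cnt b.+1 s < \sum_(b < M) cnt b.+1 t by lia.
have bM' : b.-1 < M by lia.
rewrite (bigD1 (Ordinal bM')) // [X in _ < X](bigD1 (Ordinal bM')) //=.
rewrite prednK // -addSn leq_add //.
by apply: leq_sum => i _; apply: h1.
Qed.

End Dominance.

Arguments cnt : simpl never.

(** * The deformed relations and the ideals of idempotents *)
Definition far (I : nzRingType) (a b : I) := [&& a != b, a != b + 1 & b != a + 1].

Definition braid_const (A : pzRingType) (I : nzRingType) (a b c : I) : A :=
  if (c == a) && (a == b - 1) then -1
  else if (c == a) && (a == b + 1) then 1 else 0.

(** The relations of the generalized blob algebra, with [y_1 e(i) = 0] deformed
    to [y_1 e(i) = xs m e(i)].  Strands are numbered from [0] by natural numbers
    and residue sequences are lists, which makes the two strands on which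
    [psi (size s)] acts visible in [s ++ [:: a, b & t]].  The first [l] codes of
    nodes are [l, ..., 2 l - 1]. *)
Record klr_laws (I : nzRingType) (n l : nat) (res : nat -> I) (A : pzRingType)
    (psi y : nat -> A) (ee : seq I -> A) (xs : nat -> A) : Prop := KlrLaws {
  law_idem s : size s = n -> ee s * ee s = ee s;
  law_orth s t : size s = n -> size t = n -> s <> t -> ee s * ee t = 0;
  law_one : exists2 ss : seq (seq I),
    all (fun s => size s == n) ss & 1 = \sum_(s <- ss) ee s;
  law_first a s : size (a :: s) = n ->
    (forall m, (l <= m < l + l)%N -> a <> res m) -> ee (a :: s) = 0;
  law_second m s : size s = n.-2 -> (l <= m < l + l)%N ->
    ee [:: res m, res m + 1 & s] = 0;
  law_y0 m s : size (res m :: s) = n -> (l <= m < l + l)%N ->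
    y 0 * ee (res m :: s) = xs m * ee (res m :: s);
  law_ye k s : (k < n)%N -> size s = n -> y k * ee s = ee s * y k;
  law_psie s a b t : size (s ++ [:: a, b & t]) = n ->
    psi (size s) * ee (s ++ [:: a, b & t]) = ee (s ++ [:: b, a & t]) * psi (size s);
  law_psiy k m : (k.+1 < n)%N -> (m < n)%N -> m <> k -> m <> k.+1 ->
    psi k * y m = y m * psi k;
  law_psipsi k m : (k.+1 < m)%N -> (m.+1 < n)%N -> psi k * psi m = psi m * psi k;
  law_psiyhi s a b t : size (s ++ [:: a, b & t]) = n ->
    psi (size s) * y (size s).+1 * ee (s ++ [:: a, b & t]) =
    (y (size s) * psi (size s) - (a == b)%:R) * ee (s ++ [:: a, b & t]);
  law_yhipsi s a b t : size (s ++ [:: a, b & t]) = n ->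
    y (size s).+1 * psi (size s) * ee (s ++ [:: a, b & t]) =
    (psi (size s) * y (size s) - (a == b)%:R) * ee (s ++ [:: a, b & t]);
  law_sq_eq s a t : size (s ++ [:: a, a & t]) = n ->
    psi (size s) * psi (size s) * ee (s ++ [:: a, a & t]) = 0;
  law_sq_far s a b t : size (s ++ [:: a, b & t]) = n -> far a b ->
    psi (size s) * psi (size s) * ee (s ++ [:: a, b & t]) = ee (s ++ [:: a, b & t]);
  law_sq_up s a t : size (s ++ [:: a, a + 1 & t]) = n ->
    psi (size s) * psi (size s) * ee (s ++ [:: a, a + 1 & t]) =
    (y (size s).+1 - y (size s)) * ee (s ++ [:: a, a + 1 & t]);
  law_sq_down s a t : size (s ++ [:: a + 1, a & t]) = n ->
    psi (size s) * psi (size s) * ee (s ++ [:: a + 1, a & t]) =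
    (y (size s) - y (size s).+1) * ee (s ++ [:: a + 1, a & t]);
  law_braid s a b c t : size (s ++ [:: a, b, c & t]) = n ->
    psi (size s) * psi (size s).+1 * psi (size s) * ee (s ++ [:: a, b, c & t]) =
    (psi (size s).+1 * psi (size s) * psi (size s).+1 + braid_const A a b c)
      * ee (s ++ [:: a, b, c & t])
}.

Section Ideals.
Variables (I : nzRingType) (n l : nat) (res : nat -> I).
Variables (O A : pzRingType) (sc : {rmorphism O -> A}).
Variables (psi y : nat -> A) (ee : seq I -> A) (X : nat -> O).
Hypothesis sc_central : forall c x, sc c * x = x * sc c.
Hypothesis L : klr_laws n l res psi y ee (fun m => sc (X m)).

(** The subalgebra generated by the generators and the scalars [sc]; matrices
    over a field of fractions will be considered with polynomials as scalars. *)
Inductive gen_alg : A -> Prop :=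
| B_psi k : (k.+1 < n)%N -> gen_alg (psi k)
| B_y k : (k < n)%N -> gen_alg (y k)
| B_ee s : size s = n -> gen_alg (ee s)
| B_sc c : gen_alg (sc c)
| B_add a b : gen_alg a -> gen_alg b -> gen_alg (a + b)
| B_mul a b : gen_alg a -> gen_alg b -> gen_alg (a * b).

Lemma B_one : gen_alg 1.
Proof. by rewrite -(rmorph1 sc); apply: B_sc. Qed.
Lemma B_zero : gen_alg 0.
Proof. by rewrite -(rmorph0 sc); apply: B_sc. Qed.
Lemma B_opp a : gen_alg a -> gen_alg (- a).
Proof.
by move=> h; rewrite -mulN1r -(rmorph1 sc) -rmorphN; apply: B_mul => //; apply: B_sc.
Qed.
Lemma B_sub a b : gen_alg a -> gen_alg b -> gen_alg (a - b).
Proof. by move=> ha hb; apply: B_add => //; apply: B_opp. Qed.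

Inductive ideal (S : seq I -> Prop) : A -> Prop :=
| ideal_gen a s b : gen_alg a -> gen_alg b -> size s = n -> S s ->
    ideal S (a * ee s * b)
| ideal_zero : ideal S 0
| ideal_add x z : ideal S x -> ideal S z -> ideal S (x + z).

Lemma ideal_mull S a x : gen_alg a -> ideal S x -> ideal S (a * x).
Proof.
move=> ha; elim=> [b s c hb hc ss Ss||u v _ hu _ hv].
- by rewrite !mulrA; apply: ideal_gen => //; apply: B_mul.
- by rewrite mulr0; apply: ideal_zero.
- by rewrite mulrDr; apply: ideal_add.
Qed.
Lemma ideal_mulr S a x : gen_alg a -> ideal S x -> ideal S (x * a).
Proof.
move=> ha; elim=> [b s c hb hc ss Ss||u v _ hu _ hv].
- by rewrite -mulrA; apply: ideal_gen => //; apply: B_mul.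
- by rewrite mul0r; apply: ideal_zero.
- by rewrite mulrDl; apply: ideal_add.
Qed.
Lemma ideal_opp S x : ideal S x -> ideal S (- x).
Proof. by move=> h; rewrite -mulN1r; apply: ideal_mull => //; apply/B_opp/B_one. Qed.
Lemma ideal_sub S x z : ideal S x -> ideal S z -> ideal S (x - z).
Proof. by move=> hx hz; apply: ideal_add => //; apply: ideal_opp. Qed.
Lemma ideal_ee (S : seq I -> Prop) s : size s = n -> S s -> ideal S (ee s).
Proof.
move=> hs Ss; rewrite -[ee s]mulr1 -[ee s]mul1r.
by apply: ideal_gen => //; apply: B_one.
Qed.
Lemma ideal_trans (S S' : seq I -> Prop) x :
  (forall s, size s = n -> S s -> ideal S' (ee s)) -> ideal S x -> ideal S' x.
Proof.
move=> h; elim=> [a s b ha hb ss Ss||u v _ hu _ hv].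
- by apply: ideal_mulr => //; apply: ideal_mull => //; apply: h.
- exact: ideal_zero.
- exact: ideal_add.
Qed.
Lemma ideal_sub_set (S S' : seq I -> Prop) x :
  (forall s, S s -> S' s) -> ideal S x -> ideal S' x.
Proof. by move=> h; apply: ideal_trans => s hs Ss; apply: ideal_ee => //; apply: h. Qed.
Lemma ideal_gen_alg S x : ideal S x -> gen_alg x.
Proof.
elim=> [a s b ha hb ss Ss||u v _ hu _ hv]; last exact: B_add.
  by apply: B_mul => //; apply: B_mul => //; apply: B_ee.
exact: B_zero.
Qed.

Lemma farC (a b : I) : far a b = far b a.
Proof. by rewrite /far eq_sym; case: eqP => //= _; rewrite andbC. Qed.

Lemma ee_far s a b t : size (s ++ [:: a, b & t]) = n -> far a b ->
  ee (s ++ [:: a, b & t]) =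
  psi (size s) * ee (s ++ [:: b, a & t]) * psi (size s).
Proof.
move=> h f; have h' : size (s ++ [:: b, a & t]) = n by rewrite -h !size_cat.
by rewrite -mulrA -(law_psie L h) mulrA (law_sq_far L).
Qed.

(** [ee s] is a product [a * ee t * b], so that [ee s] lies in every ideal that
    contains [ee t].  The left factor commutes with the first [k] dots, so that
    the same holds for [(y m - c) * ee s], [m < k]. *)
Definition factors k (s t : seq I) := exists a b,
  [/\ gen_alg a, gen_alg b, (forall m, (m < k)%N -> y m * a = a * y m) &
      ee s = a * ee t * b].

Lemma factors_refl k s : factors k s s.
Proof.
by exists 1, 1; rewrite mul1r mulr1; split=> //; try exact: B_one;
   move=> m _; rewrite mul1r mulr1.
Qed.
Lemma factors_trans k s t u : factors k s t -> factors k t u -> factors k s u.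
Proof.
move=> [a [b [ha hb ca e1]]] [c [d [hc hd cc e2]]].
exists (a * c), (d * b); split; try exact: B_mul.
- by move=> m hm; rewrite mulrA ca // -!mulrA cc.
- by rewrite e1 e2 !mulrA.
Qed.
Lemma factors_le k k' s t : (k <= k')%N -> factors k' s t -> factors k s t.
Proof.
move=> h [a [b [ha hb ca e1]]]; exists a, b; split=> // m hm.
by apply: ca; apply: leq_trans h.
Qed.
Lemma factors_far s a b t : size (s ++ [:: a, b & t]) = n -> far a b ->
  factors (size s) (s ++ [:: a, b & t]) (s ++ [:: b, a & t]).
Proof.
move=> h f; have hk : ((size s).+1 < n)%N by rewrite -h size_cat /=; lia.
exists (psi (size s)), (psi (size s)); split; try exact: B_psi.
- by move=> m hm; rewrite (law_psiy L) //; lia.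
- exact: ee_far.
Qed.

(** A strand moves across strands of far residues at no cost, because the square
    of each crossing is the idempotent. *)
Lemma factors_movel s R j t : size (s ++ R ++ j :: t) = n -> all (far j) R ->
  factors (size s) (s ++ R ++ j :: t) (s ++ j :: R ++ t).
Proof.
elim: R s => [|r R IH] s /=; first by move=> *; apply: factors_refl.
move=> hs /andP[f1 f2].
have := IH (rcons s r); rewrite !cat_rcons => /(_ hs f2) h1.
apply: factors_trans (factors_le _ h1) _; first by rewrite size_rcons.
by apply: factors_far; [rewrite -hs !size_cat /= !size_cat /=; lia | rewrite farC].
Qed.
Lemma factors_mover s R j t : size (s ++ R ++ j :: t) = n -> all (far j) R ->
  factors (size s) (s ++ j :: R ++ t) (s ++ R ++ j :: t).
Proof.
elim: R s => [|r R IH] s /=; first by move=> *; apply: factors_refl.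
move=> hs /andP[f1 f2].
have := IH (rcons s r); rewrite !cat_rcons => /(_ hs f2) h1.
apply: factors_trans _ (factors_le _ h1); last by rewrite size_rcons.
by apply: factors_far => //; rewrite -hs !size_cat /= !size_cat /=; lia.
Qed.

Lemma ideal_factors k s t S : factors k s t -> ideal S (ee t) -> ideal S (ee s).
Proof. by move=> [a [b [ha hb _ ->]]] h; apply/ideal_mulr/ideal_mull. Qed.

Lemma ideal_factors_y k m c s t S : factors k s t -> (m < k)%N ->
  ideal S ((y m - sc c) * ee t) -> ideal S ((y m - sc c) * ee s).
Proof.
move=> [a [b [ha hb ca ->]]] hm h.
rewrite !mulrA mulrBl ca // sc_central -mulrBr.
by rewrite -[a * _ * ee t]mulrA; apply/ideal_mulr/ideal_mull.
Qed.

(** A dot travels with its strand across strands of far residues. *)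
Lemma ideal_move_y s R j t c S : size (s ++ R ++ j :: t) = n -> all (far j) R ->
  ideal S ((y (size s) - sc c) * ee (s ++ j :: R ++ t)) ->
  ideal S ((y (size (s ++ R)) - sc c) * ee (s ++ R ++ j :: t)).
Proof.
elim: R s => [|r R IH] s /=; first by rewrite cats0.
move=> hs /andP[f1 f2] h.
have := IH (rcons s r); rewrite !cat_rcons; apply => //.
have hs' : size (s ++ [:: r, j & R ++ t]) = n.
  by rewrite -hs !size_cat /= !size_cat /=; lia.
have hs'' : size (s ++ [:: j, r & R ++ t]) = n by rewrite -hs' !size_cat.
have hk : ((size s).+1 < n)%N by rewrite -hs' size_cat /=; lia.
rewrite (ee_far hs'); last by rewrite farC.
rewrite size_rcons.
have := law_yhipsi L hs''.
case/and3P: f1 => /negPf -> _ _; rewrite subr0 => e1.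
have -> : (y (size s).+1 - sc c) *
   (psi (size s) * ee (s ++ [:: j, r & R ++ t]) * psi (size s)) =
   psi (size s) * ((y (size s) - sc c) * ee (s ++ [:: j, r & R ++ t])) * psi (size s).
  by rewrite !mulrA !mulrBl e1 mulrBr !mulrBl sc_central.
by apply/ideal_mulr/ideal_mull => //; apply: B_psi.
Qed.
End Ideals.

(** * Diagrams as lists of codes *)
Section Diagrams.
Local Open Scope nat_scope.
Variable l : nat.

(** The node above the node of code [c] has code [c - l]; codes below [l + l] are
    in the first row. *)
Definition diag (s : seq nat) := sorted ltn s /\
  forall c, c \in s -> l <= c /\ (l + l <= c -> c - l \in s).

Lemma sorted_split s1 c s2 : sorted ltn (s1 ++ c :: s2) ->
  [/\ all (fun z => z < c) s1, all (fun z => c < z) s2, sorted ltn s1 & sorted ltn s2].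
Proof.
move=> h; have h1 : subseq s1 (s1 ++ c :: s2) by apply: prefix_subseq.
have h2 : subseq s2 (s1 ++ c :: s2).
  by rewrite -cat_rcons; apply: suffix_subseq.
split; try by apply: subseq_sorted h => //; apply: ltn_trans.
- have : pairwise ltn (s1 ++ c :: s2) by rewrite -sorted_pairwise //; apply: ltn_trans.
  rewrite pairwise_cat allrel_consr => /andP[/andP[hh _] _].
  by apply/allP => z /(allP hh).
- have : pairwise ltn (s1 ++ c :: s2) by rewrite -sorted_pairwise //; apply: ltn_trans.
  rewrite pairwise_cat /= => /and3P[_ _ /andP[hh _]].
  by apply/allP => z /(allP hh).
Qed.

Lemma sorted_glue s1 c s2 : sorted ltn s1 -> sorted ltn s2 ->
  all (fun z => z < c) s1 -> all (fun z => c < z) s2 -> sorted ltn (s1 ++ c :: s2).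
Proof.
rewrite !(sorted_pairwise ltn_trans) => p1 p2 a1 a2.
rewrite pairwise_cat allrel_consr /= p1 p2 /= !andbT.
apply/andP; split; last by apply/allP => z /(allP a2).
apply/andP; split; first by apply/allP => z /(allP a1).
apply/allrelP => u v /(allP a1) h1 /(allP a2) h2; exact: ltn_trans h1 h2.
Qed.

Lemma sorted_prefix s1 s2 : sorted ltn (s1 ++ s2) -> sorted ltn s1.
Proof.
by move=> h; apply: subseq_sorted h; [apply: ltn_trans | apply: prefix_subseq].
Qed.

Lemma diag_prefix s1 s2 : diag (s1 ++ s2) -> diag s1.
Proof.
move=> [hs hc]; split; first exact: sorted_prefix hs.
move=> c cs; have := hc c; rewrite !mem_cat cs => /(_ isT) [h1 h2]; split=> //.
move=> h3; have := h2 h3; case/orP=> // cs2.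
have : pairwise ltn (s1 ++ s2) by rewrite -sorted_pairwise //; apply: ltn_trans.
rewrite pairwise_cat => /andP[/allrelP /(_ _ _ cs cs2) + _]; lia.
Qed.

Lemma sorted_insert s a : sorted ltn s -> a \notin s ->
  s = [seq z <- s | z < a] ++ [seq z <- s | a < z].
Proof.
elim: s => //= x s IH hs; rewrite inE negb_or => /andP[ax an].
have ss : sorted ltn s by apply: path_sorted hs.
case: (ltngtP x a) => h; last by rewrite h eqxx in ax.
- by rewrite /= -IH.
- have hx : all (fun z => a < z) s.
    have := @sorted_split [::] x s hs; case=> _ /allP hx _ _.
    by apply/allP => z /hx; apply: ltn_trans.
  rewrite (_ : [seq z <- s | z < a] = [::]) /=.
    by congr cons; apply/esym/all_filterP.
  apply/eqP; rewrite -[_ == _]negbK -has_filter -all_predC.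
  by apply/allP => z /(allP hx) /=; rewrite -leqNgt; apply: ltnW.
Qed.

Lemma diag_insert s a : 0 < l -> diag s -> a \notin s -> l <= a ->
  (l + l <= a -> a - l \in s) ->
  diag ([seq z <- s | z < a] ++ a :: [seq z <- s | a < z]).
Proof.
move=> l0 [hs hc] an la hp; split.
  apply: sorted_glue; try by apply: sorted_filter hs; apply: ltn_trans.
  by apply/allP => z; rewrite mem_filter => /andP[].
  by apply/allP => z; rewrite mem_filter => /andP[].
have memE c : (c \in [seq z <- s | z < a] ++ a :: [seq z <- s | a < z]) =
    (c == a) || (c \in s).
  by rewrite mem_cat inE !mem_filter; case: (ltngtP c a) => //=; rewrite ?orbF.
move=> c; rewrite !memE => /orP[/eqP ->|cs]; last first.
  by have [h1 h2] := hc c cs; split=> // /h2 ->; rewrite orbT.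
by split=> // /hp ->; rewrite orbT.
Qed.

Lemma last_has (T : Type) (p : pred T) s :
  all (predC p) s \/ exists s1 x s2, [/\ s = s1 ++ x :: s2, p x & all (predC p) s2].
Proof.
elim/last_ind: s => [|s x IH]; first by left.
case px: (p x); first by right; exists s, x, [::]; rewrite cats1.
case: IH => [h|[s1 [z [s2 [-> pz h]]]]]; first by left; rewrite all_rcons /= px h.
by right; exists s1, z, (rcons s2 x); rewrite rcons_cat all_rcons /= px h.
Qed.
End Diagrams.

(** * Placing residues in a diagram *)
Ltac size_simpl := do 4! rewrite /= ?size_cat ?size_rcons ?size_map.
Tactic Notation "size_lia" := size_simpl; clear; lia.
Tactic Notation "size_lia" hyp(h) := size_simpl; rewrite ?h; clear; lia.

Section Placement.
Variables (I : nzRingType) (n l : nat) (res : nat -> I).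
Variables (O A : pzRingType) (sc : {rmorphism O -> A}).
Variables (psi y : nat -> A) (ee : seq I -> A) (X : nat -> O).
Hypothesis sc_central : forall c x, sc c * x = x * sc c.
Hypothesis L : klr_laws n l res psi y ee (fun m => sc (X m)).
Hypothesis l_gt0 : (0 < l)%N.
Hypothesis res_below : forall c, res (c + l) = res c - 1.
Hypothesis res_far : forall c d, (c < d < c + l)%N -> far (res c) (res d).
Hypothesis two_neq0 : 1 + 1 != 0 :> I.
Hypothesis X_below : forall c, X (c + l)%N = X c.

Local Notation gen_alg := (gen_alg n sc psi y ee).
Local Notation ideal := (ideal n sc psi y ee).
Local Notation diag := (diag l).
Local Notation R := (map res).

Lemma far_neq (a b : I) : far a b -> [/\ a <> b, a <> b + 1 & b <> a + 1].
Proof. by case/and3P=> /eqP h1 /eqP h2 /eqP h3. Qed.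

Lemma addr1_neq (a : I) : a + 1 <> a.
Proof. by move/eqP; rewrite -subr_eq0 addrAC subrr add0r oner_eq0. Qed.
Lemma subr1_neq (a : I) : a - 1 <> a.
Proof. by move/eqP; rewrite subr_eq => /eqP/esym; apply: addr1_neq. Qed.

(** When a strand of residue [j] is added to a diagram with codes below [d], the
    node that it creates has a code below [d + l], hence at most [g]. *)
Definition lands d g (j : I) := (d <= g.+1)%N /\
  forall a, (a < d + l)%N -> res a = j -> (a <= g)%N.

(** The nodes that follow [g] within one row have residues far from that of [g],
    and the node below [g] has residue [res g - 1]. *)
Lemma lands_own d g : (d <= g.+1)%N -> lands d g (res g).
Proof.
move=> dg; split=> // a ad ra; rewrite leqNgt; apply/negP => ga.
case: (ltngtP a (g + l)) => h; last 2 [lia].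
  by have /far_neq[] := res_far (c := g) (d := a) ltac:(lia); rewrite ra.
by move: ra; rewrite h res_below; apply: subr1_neq.
Qed.
Lemma lands_up d g : (d <= g)%N -> lands d g (res g + 1).
Proof.
move=> dg; split=> [|a ad ra]; first exact: leqW.
rewrite leqNgt; apply/negP => ga.
by have /far_neq[] := res_far (c := g) (d := a) ltac:(lia); rewrite ra.
Qed.
Lemma lands_down d g : (d <= g)%N -> lands d g.-1 (res g - 1).
Proof.
move=> dg; split=> [|a ad ra]; first by lia.
suff : (a < g)%N by lia.
rewrite ltnNge leq_eqVlt; apply/negP => /orP[/eqP h|h].
  by move: ra; rewrite -h => /esym; apply: subr1_neq.
by have /far_neq[_ + _] := res_far (c := g) (d := a) ltac:(lia); rewrite ra subrK.
Qed.
Lemma landsW d d' g j : (d <= d')%N -> lands d' g j -> lands d g j.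
Proof. by move=> h [h1 hl]; split=> [|a ha]; [|apply: hl]; lia. Qed.

Definition above s t : seq I -> Prop :=
  fun i => exists s', [/\ diag s', domle s s' & i = R s' ++ t].
Definition sabove s t : seq I -> Prop :=
  fun i => exists s', [/\ diag s', domlt s s' & i = R s' ++ t].

(** Adding a strand of residue [j] to [s] leads to diagrams that dominate [s] with
    the node [g] added. *)
Definition good_add s := forall d g j t, (l <= d)%N -> all (fun z => z < d)%N s -> lands d g j ->
  (size s + (size t).+1 = n)%N -> ideal (above (g :: s) t) (ee (R s ++ j :: t)).

(** A dot on the strand of the node [c] acts by the scalar [X c], up to strictly
    more dominant diagrams. *)
Definition good_dot s := forall s1 c s2 t, s = s1 ++ c :: s2 ->
  (size s + size t = n)%N ->
  ideal (sabove s t) ((y (size s1) - sc (X c)) * ee (R s ++ t)).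

(** A list of pairs (bound for the code, residue) to be added one after the other;
    each bound enters the threshold for the next ones. *)
Fixpoint placeable d (sl : seq (nat * I)) : Prop :=
  if sl is (g, j) :: sl' then lands d g j /\ placeable (maxn d g.+1) sl' else True.

Definition own : seq nat -> seq (nat * I) := map (fun w => (w, res w)).

Lemma own_fst W : map fst (own W) = W.
Proof. by rewrite -map_comp map_id_in. Qed.
Lemma own_snd W : map snd (own W) = R W.
Proof. by rewrite -map_comp. Qed.

Lemma placeableW d d' sl : (d <= d')%N -> placeable d' sl -> placeable d sl.
Proof.
elim: sl d d' => //= -[g j] sl IH d d' h [h1 h2]; split; first exact: landsW h1.
by apply: IH h2; lia.
Qed.
Lemma placeable_cat d d' sl sl' : placeable d sl ->
  all (fun g => g < d')%N (map fst sl) -> (d <= d')%N -> placeable d' sl' ->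
  placeable d (sl ++ sl').
Proof.
elim: sl d => [|[g j] sl IH] d /=; first by move=> _ _ h; apply: placeableW.
move=> [h1 h2] /andP[h3 h4] h5 h6; split=> //.
by apply: IH => //; lia.
Qed.
Lemma placeable_own d W : sorted ltn W -> all (fun w => d <= w.+1)%N W ->
  placeable d (own W).
Proof.
elim: W d => //= w W IH d hs /andP[h1 h2]; split; first exact: lands_own.
have [_ hw _ hs'] := @sorted_split [::] w W hs.
by apply: IH => //; apply/allP => z zW; have := allP hw z zW; have := allP h2 z zW; lia.
Qed.

Lemma place N : (forall s, diag s -> (size s < N)%N -> good_add s) ->
  forall sl s d t, diag s -> (l <= d)%N -> all (fun z => z < d)%N s -> placeable d sl ->
  (size s + size sl <= N)%N -> (size s + size sl + size t = n)%N ->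
  ideal (above (map fst sl ++ s) t) (ee (R s ++ map snd sl ++ t)).
Proof.
move=> HN; elim=> [|[g j] sl IH] s d t ds ld sd /=.
  move=> _ _ hn; apply: ideal_ee; first by rewrite size_cat size_map; lia.
  by exists s; split=> //; apply: dom_refl.
move=> [h1 h2] hN hn.
have := HN s ds ltac:(lia) d g j (map snd sl ++ t) ld sd h1.
rewrite size_cat size_map => /(_ ltac:(lia)).
apply: ideal_trans => _ _ [s' [ds' dm ->]].
have e1 : size s' = (size s).+1 by case: dm => <-.
have sd' : all (fun z => z < maxn d g.+1)%N s'.
  apply: dom_all dm _ => /=; apply/andP; split; first lia.
  by apply/allP => z /(allP sd); lia.
have ld' : (l <= maxn d g.+1)%N by lia.
have := IH s' _ t ds' ld' sd' h2 ltac:(lia) ltac:(lia).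
apply: ideal_sub_set => _ [s'' [ds'' dm' ->]]; exists s''; split=> //.
apply: dom_trans dm'; apply: dom_trans (dom_cat (dom_refl _) dm).
apply: dom_perm; by rewrite -cat_cons perm_sym perm_catC /= perm_cons perm_catC.
Qed.

(** The residues of [b] and of the node [b + l] below it, exchanged.  The residue
    [res b - 1] comes before the place of [b + l], so that it can only give a node
    strictly before [b]; the other residues give nodes no later than the ones whose
    places they take. *)
Lemma place_swapped N nu b W T t :
  (forall s, diag s -> (size s < N)%N -> good_add s) ->
  diag (nu ++ b :: W ++ (b + l)%N :: T) ->
  (size (nu ++ b :: W ++ (b + l)%N :: T) <= N)%N ->
  (size (nu ++ b :: W ++ (b + l)%N :: T) + size t = n)%N ->
  ideal (above (nu ++ b.-1 :: W ++ (b + l)%N :: T) t)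
    (ee (R nu ++ (res b - 1) :: R W ++ res b :: R T ++ t)).
Proof.
move=> HN ds hN hn; have [ss _] := ds.
have [nub rest _ s2] := sorted_split ss.
have [Wc Tc sW sT] := sorted_split s2.
move: rest; rewrite all_cat => /andP[bW /andP[_ bT]].
pose sl := (b.-1, res b - 1) :: own W ++ ((b + l)%N, res b) :: own T.
have slf : map fst sl = b.-1 :: W ++ (b + l)%N :: T by rewrite /= map_cat /= !own_fst.
have sls : map snd sl = (res b - 1) :: R W ++ res b :: R T.
  by rewrite /= map_cat /= !own_snd.
have -> : R nu ++ (res b - 1) :: R W ++ res b :: R T ++ t = R nu ++ map snd sl ++ t.
  by rewrite sls /= -!catA.
have dnu : diag nu by apply: diag_prefix ds.
have szsl : (size nu + size sl)%N = size (nu ++ b :: W ++ (b + l)%N :: T).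
  by rewrite size_cat -(size_map fst sl) slf.
have /ds.2 [lb _] : b \in nu ++ b :: W ++ (b + l)%N :: T.
  by rewrite mem_cat inE eqxx orbT.
have := @place N HN sl nu b t dnu lb nub; rewrite szsl slf => /(_ _ hN hn).
move=> h; apply: ideal_sub_set (h _); last first.
  split; first exact: lands_down.
  apply: (@placeable_cat _ (b + l)%N); rewrite ?own_fst //; [|move: lb l_gt0; clear; lia|].
    by apply: placeable_own => //; apply/allP => z /(allP bW); clear; lia.
  split.
    by have := @lands_up (b + l)%N (b + l)%N (leqnn _); rewrite res_below subrK.
  apply: placeable_own => //; apply/allP => z /(allP Tc); clear; lia.
move=> _ [s' [ds' dm ->]]; exists s'; split=> //; apply: dom_trans dm.
by apply: dom_perm; rewrite perm_catC.
Qed.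

Lemma place_swapped_lt N nu b W T t :
  (forall s, diag s -> (size s < N)%N -> good_add s) ->
  diag (nu ++ b :: W ++ (b + l)%N :: T) ->
  (size (nu ++ b :: W ++ (b + l)%N :: T) <= N)%N ->
  (size (nu ++ b :: W ++ (b + l)%N :: T) + size t = n)%N ->
  ideal (sabove (nu ++ b :: W ++ (b + l)%N :: T) t)
    (ee (R nu ++ (res b - 1) :: R W ++ res b :: R T ++ t)).
Proof.
move=> HN ds hN hn; apply: ideal_sub_set (place_swapped HN ds hN hn).
move=> _ [s' [ds' dm ->]]; exists s'; split=> //; apply: sdom_dom_trans dm.
have /ds.2 [lb _] : b \in nu ++ b :: W ++ (b + l)%N :: T.
  by rewrite mem_cat inE eqxx orbT.
split; last exists b.
  by apply: dom_cat => //; apply: dom_cons => //; apply: leq_pred.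
by rewrite !cnt_cat !cnt_cons ltnn; lia.
Qed.

(** A last node [q] may be left out when proving that something lies in the ideal
    of the more dominant diagrams. *)
Lemma dot_extend s q t x : diag (rcons s q) -> (forall s', diag s' ->
    size s' = size s -> good_add s') ->
  (size s + (size t).+1 = n)%N ->
  ideal (sabove s (res q :: t)) x -> ideal (sabove (rcons s q) t) x.
Proof.
move=> ds HN hn; apply: ideal_trans => _ _ [s' [ds' dm ->]].
have sz : size s' = size s by case: dm => -[].
have [ss _] := ds; rewrite -cats1 in ss; have [sq _ _ _] := sorted_split ss.
have sq' := dom_all (sdomW dm) sq.
have /ds.2 [lq _] : q \in rcons s q by rewrite mem_rcons inE eqxx.
have := HN s' ds' sz q q (res q) t lq sq' (lands_own (leqnSn _)).
rewrite sz => /(_ hn); apply: ideal_sub_set => _ [s'' [ds'' dm' ->]].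
exists s''; split=> //; apply: sdom_dom_trans dm'; rewrite -cats1.
apply: sdom_dom_trans (sdom_cat dm (dom_refl [:: q])) _.
by apply: dom_perm; rewrite perm_catC.
Qed.

(** Only a dot on the last node [c] has to be considered.  If [c] is in the first
    row, its strand moves to the left end, where the dot is the scalar [X c].
    Otherwise it moves next to the strand of [b = c - l]; the difference of the
    dots on the two strands is, up to sign, the square of their crossing, which
    factors through the idempotent with these two residues exchanged, and the dot
    on [b] is a dot on a smaller diagram. *)
Lemma good_dot_step N :
  (forall s, diag s -> (size s < N)%N -> good_add s) ->
  (forall s, diag s -> (size s < N)%N -> good_dot s) ->
  forall s, diag s -> size s = N -> good_dot s.
Proof.
move=> HA HD s ds hs s1 c s2 t es hn; subst s.
have ext s0 q t' x : diag (rcons s0 q) -> size (rcons s0 q) = N ->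
    (size s0 + (size t').+1 = n)%N ->
    ideal (sabove s0 (res q :: t')) x -> ideal (sabove (rcons s0 q) t') x.
  move=> h1 h2 h3; apply: dot_extend => // s' ds' sz; apply: HA => //.
  by rewrite sz -h2 size_rcons.
case/lastP: s2 => [|s2 q] in ds hs hn *; last first.
  rewrite -rcons_cons -rcons_cat in ds hs hn *.
  apply: ext => //; first by rewrite -hn size_rcons; clear; lia.
  have sz : (size (s1 ++ c :: s2) < N)%N by rewrite -hs size_rcons.
  have ds0 : diag (s1 ++ c :: s2) by move: ds; rewrite -cats1 => /diag_prefix.
  have := HD _ ds0 sz s1 c s2 (res q :: t) erefl.
  rewrite -cats1 [map res (_ ++ [:: q])]map_cat -catA; apply.
  by rewrite -hn size_rcons /=; clear; lia.
have [ss hc] := ds; have [s1c _ _ _] := sorted_split ss.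
have /hc [lc hcl] : c \in s1 ++ [:: c] by rewrite mem_cat inE eqxx orbT.
have sze : size (R s1 ++ res c :: t) = n.
  by rewrite size_cat size_map /= -hn size_cat /=; lia.
rewrite map_cat -catA /=.
case: (ltnP c (l + l)) => c2.
  have hf : all (far (res c)) (R s1).
    rewrite all_map; apply/allP => z zs /=; rewrite farC; apply: res_far.
    have := allP s1c z zs; have /hc[] : z \in s1 ++ [:: c] by rewrite mem_cat zs.
    lia.
  have := @ideal_move_y I n l res O A sc psi y ee X sc_central L [::] (R s1) (res c) t (X c)
    (sabove (s1 ++ [:: c]) t) sze hf.
  rewrite /= size_map; apply.
  rewrite mulrBl (law_y0 L); first by rewrite subrr; apply: ideal_zero.
    by rewrite -sze /= !size_cat /= size_map; clear; lia.
  by apply/andP.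
have [b ec] : exists b, c = (b + l)%N by exists (c - l)%N; lia.
subst c; have := hcl c2; rewrite addnK mem_cat inE => /orP[bs1|/eqP]; last by lia.
case/splitPr: bs1 => nu W in ds hs hn ss s1c hc sze *.
rewrite -catA /= in ds hs hn ss hc *.
have [nub rest _ s2] := sorted_split ss.
move: rest; rewrite all_cat => /andP[bW _].
have [Wc _ _ _] := sorted_split s2.
have hfW : all (far (res (b + l)%N)) (R W).
  rewrite all_map; apply/allP => z zs /=; rewrite farC; apply: res_far.
  by have := allP bW z zs; have := allP Wc z zs; clear; lia.
have hfW' : all (far (res b)) (R W).
  rewrite all_map; apply/allP => z zs /=; apply: res_far.
  by have := allP bW z zs; have := allP Wc z zs; clear; lia.
rewrite map_cat /= -catA /= in sze *.
have sze1 : size (rcons (R nu) (res b) ++ R W ++ res (b + l)%N :: t) = n.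
  by rewrite -sze !size_cat /= size_rcons !size_cat /=; clear; lia.
have := @ideal_move_y I n l res O A sc psi y ee X sc_central L
  (rcons (R nu) (res b)) (R W) (res (b + l)%N) t (X (b + l)%N)
  (sabove (nu ++ b :: W ++ [:: (b + l)%N]) t) sze1 hfW.
have -> : size (rcons (R nu) (res b) ++ R W) = size (nu ++ b :: W).
  by rewrite !size_cat size_rcons !size_map /=; clear; lia.
rewrite !cat_rcons; apply; rewrite size_rcons.
set k := size (R nu).
set E := ee _.
have -> : (y k.+1 - sc (X (b + l)%N)) * E =
    (y k.+1 - y k) * E + (y k - sc (X b)) * E.
  by rewrite -mulrDl addrA subrK X_below.
have sze2 : size (R nu ++ [:: res b, res (b + l) & R W ++ t]) = n.
  by rewrite -sze !size_cat /= !size_cat /=; clear; lia.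
apply: ideal_add.
  have er : res b = res (b + l)%N + 1 by rewrite res_below subrK.
  have -> : (y k.+1 - y k) * E = - (psi k * psi k * E).
    rewrite /E {2}er (law_sq_down L) -?er //.
    by rewrite -mulNr opprB.
  apply: ideal_opp; rewrite /E -mulrA (law_psie L) // mulrA.
  have hk : (k.+1 < n)%N by rewrite -sze2 size_cat /= /k; clear; lia.
  apply: ideal_mulr; first exact: B_psi.
  apply: ideal_mull; first exact: B_psi.
  have hN : (size (nu ++ b :: W ++ (b + l)%N :: [::]) <= N)%N by rewrite hs.
  have := place_swapped_lt HA ds hN hn; rewrite -res_below /=.
  have := factors_mover L (s := rcons (R nu) (res (b + l)%N)) (t := t) _ hfW'.
  rewrite !cat_rcons => /(_ _) cj; apply: ideal_factors (cj _).
  by rewrite -sze2 !size_cat /= !size_cat /=; clear; lia.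
have -> : nu ++ b :: W ++ [:: (b + l)%N] = rcons (nu ++ b :: W) (b + l)%N.
  by rewrite -cats1 -catA.
have ds0 : diag (nu ++ b :: W) by apply: (@diag_prefix _ _ [:: (b + l)%N]); rewrite -catA.
apply: ext.
- by rewrite -cats1 -catA.
- by rewrite -cats1 -catA.
- by rewrite -hn !size_cat /= !size_cat /=; clear; lia.
have hd : (size (nu ++ b :: W) < N)%N by rewrite -hs !size_cat /= !size_cat /=; clear; lia.
have hn0 : (size (nu ++ b :: W) + size (res (b + l)%N :: t) = n)%N.
  by rewrite -hn !size_cat /= !size_cat /=; clear; lia.
have := HD _ ds0 hd nu b W (res (b + l)%N :: t) erefl hn0.
rewrite map_cat /= -catA /= -(size_map res nu) -/k => h.
apply: (ideal_factors_y sc_central (k := k.+1)) _ (ltnSn k) h.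
have := factors_mover L (s := rcons (R nu) (res b)) (t := t) _ hfW.
by rewrite !cat_rcons size_rcons; apply; rewrite -sze2 !size_cat /= !size_cat /=; clear; lia.
Qed.

(** The strand of residue [res a] moves to the left until it stands at the place
    of the node [a], which completes a diagram. *)
Lemma add_insert s a d g t : diag s -> a \notin s -> (l <= a)%N ->
  ((l + l <= a)%N -> (a - l)%N \in s) -> (a < d + l)%N -> lands d g (res a) ->
  (forall c, c \in s -> (a < c)%N -> far (res a) (res c)) ->
  (size s + (size t).+1 = n)%N -> ideal (above (g :: s) t) (ee (R s ++ res a :: t)).
Proof.
move=> ds an la hp ad hl hf hn; have [ss _] := ds.
set s1 := [seq z <- s | (z < a)%N]; set s2 := [seq z <- s | (a < z)%N].
have es : s = s1 ++ s2 := sorted_insert ss an.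
have ds' : diag (s1 ++ a :: s2) by apply: diag_insert.
have hsz : size (R s1 ++ R s2 ++ res a :: t) = n.
  by rewrite -hn {1}es !size_cat /= !size_map; clear; lia.
have hf2 : all (far (res a)) (R s2).
  rewrite all_map; apply/allP => z /=; rewrite mem_filter => /andP[az zs].
  exact: hf.
rewrite {2}es map_cat -catA; apply: ideal_factors (factors_movel L hsz hf2) _.
apply: ideal_ee; first by rewrite -hsz !size_cat /= !size_cat /=; clear; lia.
exists (s1 ++ a :: s2); split=> //; last by rewrite map_cat -catA.
apply: (dom_trans (t := a :: s)).
  by apply: dom_cons => //; apply: hl.2.
by apply: dom_perm; rewrite {1}es -cat_cons perm_sym perm_catC /= perm_cons perm_catC.
Qed.

(** Two adjacent strands of equal residue satisfy the nil-Hecke relations, by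
    which the idempotent is a combination of products that contain the dot minus
    any given scalar. *)
Lemma ee_repeat s a t c S : size (s ++ [:: a, a & t]) = n ->
  ideal S ((y (size s) - sc c) * ee (s ++ [:: a, a & t])) ->
  ideal S (ee (s ++ [:: a, a & t])).
Proof.
move=> hs; set k := size s; set E := ee _; set Z := _ * E => h.
have hk : (k.+1 < n)%N by rewrite -hs size_cat /= /k; clear; lia.
have e1 : E = psi k * y k * E - y k.+1 * psi k * E.
  by rewrite (law_yhipsi L hs) eqxx mulrBl opprB addrC subrK mul1r.
have e2 : psi k * E = E * psi k by rewrite (law_psie L hs).
have e3 : psi k * psi k * E = 0 by rewrite (law_sq_eq L hs).
have e4 : E = psi k * Z - (y k.+1 - sc c) * (psi k * E).
  rewrite /Z mulrBl mulrBr [psi k * (sc c * E)]mulrA -sc_central mulrBl.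
  by rewrite !mulrA opprB addrA subrK.
have e5 : psi k * E = psi k * (Z * psi k).
  rewrite /Z -mulrA -e2 mulrBl mulrBr.
  have -> : psi k * (sc c * (psi k * E)) = 0.
    by rewrite mulrA -sc_central -mulrA [psi k * _]mulrA e3 mulr0.
  have -> : y k * (psi k * E) = (psi k * y k.+1 + 1) * E.
    by rewrite mulrDl (law_psiyhi L hs) eqxx mulrBl mul1r subrK mulrA.
  rewrite subr0 mulrDl mul1r mulrDr -[psi k * y _ * _]mulrA !mulrA.
  by rewrite -mulrA (law_ye L) // mulrA e3 mul0r add0r.
have hZ : ideal S (psi k * (Z * psi k)).
  by apply: ideal_mull; [apply: B_psi | apply: ideal_mulr => //; apply: B_psi].
rewrite e4 e5; apply: ideal_sub.
  by apply: ideal_mull => //; apply: B_psi.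
apply: ideal_mull => //; apply: B_sub; last exact: B_sc.
exact: B_y.
Qed.

(** On the residues [a, a - 1, a] the two sides of the braid relation differ by
    the idempotent, and each side factors through one of the two other
    arrangements. *)
Lemma ee_braid s a t S : size (s ++ [:: a, a - 1, a & t]) = n ->
  ideal S (ee (s ++ [:: a - 1, a, a & t])) -> ideal S (ee (s ++ [:: a, a, a - 1 & t])) ->
  ideal S (ee (s ++ [:: a, a - 1, a & t])).
Proof.
move=> hs h1 h2; set k := size s; set E := ee _.
have hk : (k.+2 < n)%N. by rewrite -hs size_cat /= /k !addnS !ltnS leq_addr.
have Bk : gen_alg (psi k) by apply: B_psi; lia.
have Bk1 : gen_alg (psi k.+1) by apply: B_psi.
have e1 : psi k * psi k.+1 * psi k * E =
    psi k.+1 * psi k * psi k.+1 * E + E.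
  rewrite (law_braid L hs) mulrDl /braid_const eqxx subrK eqxx /=.
  case: eqP => [/eqP|_]; last by rewrite mul1r.
  by rewrite -subr_eq0 !opprB addrC addrA subrK (negPf two_neq0).
have hs1 : size (rcons s a ++ [:: a - 1, a & t]) = n by rewrite cat_rcons.
have -> : E = psi k * (psi k.+1 * ee (s ++ [:: a - 1, a, a & t]) * psi k) -
    psi k.+1 * (psi k * ee (s ++ [:: a, a, a - 1 & t]) * psi k.+1).
  have := law_psie L hs1; rewrite size_rcons !cat_rcons -/k => e2.
  rewrite -!mulrA -e2 -(law_psie L hs) !mulrA -/E e1.
  by rewrite addrAC subrr add0r.
by apply: ideal_sub; apply: ideal_mull => //; apply: ideal_mulr => //; apply: ideal_mull.
Qed.

Lemma far_cases (a b : I) : ~~ far a b -> [\/ a = b, a = b + 1 | b = a + 1].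
Proof.
by rewrite !negb_and !negbK => /or3P[] /eqP->; [apply: Or31 | apply: Or32 | apply: Or33].
Qed.
Lemma far_refl (a : I) : far a a = false.
Proof. by rewrite /far eqxx. Qed.

(** The strand of residue [j] moves to the left until it meets the last node [x]
    whose residue is not far from [j].  If there is none, it reaches the left end
    and either starts a new component or is killed.  If [x] has residue [j + 1],
    the node below [x] can be added.  If [x] has residue [j], the dot of [x]
    generates the idempotent, so that [good_dot] applies.  If [x] has residue
    [j - 1], the node [b] above [x] has residue [j], and the braid relation on the
    strands of [b], [x] and the new strand gives two arrangements that lead to
    strictly more dominant diagrams, to which the induction on the sum of the
    codes applies; if [x] is in the first row, the sequence can be made to start
    with [res x, res x + 1], and the idempotent is zero. *)
Lemma good_add_step N :
  (forall s, diag s -> (size s < N)%N -> good_add s) ->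
  (forall s, diag s -> (size s <= N)%N -> good_dot s) ->
  forall s, diag s -> size s = N -> good_add s.
Proof.
move=> HA HD s; move: {2}(sumn s).+1 (ltnSn (sumn s)) => m.
elim: m s => // m IH s sm ds hs d g j t ld sd hl hn; have [ss hc] := ds.
have next s' S x : diag s' -> domlt s s' -> ideal (fun i => i = R s' ++ j :: t) x ->
    (forall s'', diag s'' -> domle (g :: s) s'' -> S (R s'' ++ t)) -> ideal S x.
  move=> ds' dm hx hS; apply: ideal_trans hx => _ _ ->.
  have sz : size s' = size s by case: dm => -[].
  have hsm : (sumn s' < m)%N := leq_trans (sdom_sumn dm) sm.
  have := IH s' hsm ds' (etrans sz hs) d g j t ld (dom_all (sdomW dm) sd) hl.
  rewrite sz => /(_ hn); apply: ideal_sub_set => _ [s'' [ds'' dm' ->]].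
  by apply: hS => //; apply: dom_trans dm'; apply: dom_cons => //; apply: sdomW.
have next' x : ideal (sabove s (j :: t)) x -> ideal (above (g :: s) t) x.
  apply: ideal_trans => i hi [s' [ds' dm ei]]; apply: (next s') => //.
    by apply: ideal_ee.
  by move=> s'' ds'' dm'; exists s''.
have hsz : size (R s ++ j :: t) = n by rewrite size_cat size_map.
case: (last_has (fun x => ~~ far j (res x)) s) => [hf|[s1 [x [s2 [es nf hf]]]]].
  have hf' : all (far j) (R s).
    by rewrite all_map; apply/allP => z /(allP hf) /=; rewrite negbK.
  case hj : (has (fun a => j == res a) (iota l l)).
    case/hasP: hj => a; rewrite mem_iota => /andP[la al] /eqP ej.
    rewrite ej in hl hf' *; apply: (add_insert (d := d)) => //; try lia.
      by apply/negP => /(map_f res) /(allP hf'); rewrite far_refl.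
    by move=> c cs _; apply: (allP hf'); apply: map_f.
  have := factors_movel L (s := [::]) hsz hf' => /= cj; apply: ideal_factors cj _.
  rewrite (law_first L); first exact: ideal_zero.
    by rewrite -hsz /= !size_cat /= addnS.
  move=> a ha ej; move/hasPn: (negbT hj) => /(_ a); rewrite mem_iota ha ej eqxx.
  by move/(_ isT).
have xs : x \in s by rewrite es mem_cat inE eqxx orbT.
have [lx hx] := hc x xs.
move: (ss); rewrite {1}es => /sorted_split [s1x s2x ss1 ss2].
have hf2 : all (far j) (R s2).
  by rewrite all_map; apply/allP => z /(allP hf) /=; rewrite negbK.
have xd : (x < d)%N by apply: (allP sd).
case: (far_cases nf) => ej.
- (* [x] has the residue of the new strand *)
  have sze : size (R s1 ++ [:: j, j & R s2 ++ t]) = n.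
    by rewrite -hsz es map_cat !size_cat /= !size_cat /=; clear; lia.
  have sze' : size (rcons (R s1) j ++ R s2 ++ j :: t) = n.
    by rewrite -hsz es map_cat !size_cat /= size_rcons /=; clear; lia.
  have cj := factors_movel L sze' hf2.
  have cj' := factors_mover L sze' hf2.
  rewrite !cat_rcons size_rcons in cj cj'.
  rewrite {2}es map_cat -catA /= -ej; apply: ideal_factors cj _.
  apply: (ee_repeat (c := X x)) => //; apply: ideal_factors_y cj' _ _ => //.
  apply: next'; have := HD s ds (eq_leq hs) s1 x s2 (j :: t) es hn.
  by rewrite {2}es map_cat -catA /= -ej size_map.
- (* [x] has residue [j - 1] *)
  have sz1 : size (rcons (R s1) (res x) ++ R s2 ++ j :: t) = n.
    by rewrite -hsz es map_cat !size_cat /= size_rcons /=; clear; lia.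
  have cj1 := factors_movel L sz1 hf2; rewrite !cat_rcons in cj1.
  rewrite {2}es map_cat -catA /=; apply: ideal_factors cj1 _.
  (* In the first row, the sequence can be made to start with [res x], [res x + 1]. *)
  case: (ltnP x (l + l)) => x2.
    have ev : res (x - l)%N = j by rewrite ej -{2}(subnK lx) res_below subrK.
    have s1l z : z \in s1 -> (l <= z < x)%N.
      move=> zs; have [-> _] : (l <= z)%N /\ _ := hc z ltac:(by rewrite es mem_cat zs).
      exact: (allP s1x).
    have hfx : all (far (res x)) (R s1).
      rewrite all_map; apply/allP => z /s1l h /=; rewrite farC; apply: res_far; move: h x2; clear; lia.
    have hfj : all (far j) (R s1).
      rewrite all_map; apply/allP => z /s1l h /=; rewrite -ev; apply: res_far; move: h lx x2; clear; lia.
    have sz2 : size ([::] ++ R s1 ++ res x :: j :: R s2 ++ t) = n.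
      by rewrite -sz1 cat_rcons !size_cat /= !size_cat /=; clear; lia.
    apply: ideal_factors (factors_movel L sz2 hfx) _ => /=.
    have sz3 : size ([:: res x] ++ R s1 ++ j :: R s2 ++ t) = n.
      by rewrite -sz2 !size_cat /= !size_cat /=; clear; lia.
    apply: ideal_factors (factors_movel L sz3 hfj) _ => /=.
    rewrite ej (law_second L); first exact: ideal_zero.
      by rewrite -sz3 /= !size_cat /= !size_cat; clear; lia.
    by rewrite lx.
  have [b ex] : exists b, x = (b + l)%N by exists (x - l)%N; rewrite subnK.
  subst x; have bs := hx x2; rewrite addnK es mem_cat inE in bs.
  case/orP: bs => [bs1|]; last first.
    by case/orP=> [/eqP|/(allP s2x)]; move: l_gt0; clear; lia.
  have ejb : res b = j by rewrite ej res_below subrK.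
  have ejx : res (b + l)%N = j - 1 by rewrite res_below ejb.
  have [nu [W es1]] : exists nu W : seq nat, s1 = nu ++ b :: W.
    by case/splitPr: bs1 => nu W; exists nu, W.
  subst s1.
  have [nub bW snu sW] := sorted_split ss1.
  have hfW : all (far j) (R W).
    rewrite all_map; apply/allP => z zs /=; rewrite -ejb; apply: res_far.
    have := allP bW z zs; have := allP s1x z; rewrite mem_cat inE zs !orbT; clear; lia.
  have hfW' : all (far (j - 1)) (R W).
    rewrite all_map; apply/allP => z zs /=; rewrite -ejx farC; apply: res_far.
    have := allP bW z zs; have := allP s1x z; rewrite mem_cat inE zs !orbT; clear; lia.
  rewrite ejx map_cat /= ejb -!catA /= in sz1 *.
  have szb : size (R nu ++ [:: j, j - 1, j & R W ++ R s2 ++ t]) = n.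
    by rewrite -sz1; size_lia.
  have resz u : size u = (size nu + size W + size s2 + size t).+3 -> size u = n.
    by move=> ->; rewrite -szb size_cat /= !size_cat !size_map; clear; lia.
  have := factors_movel L (s := rcons (R nu) j) (t := j :: R s2 ++ t) _ hfW'.
  rewrite !cat_rcons => h1; apply: ideal_factors (h1 _) _.
    by apply: resz; size_lia.
  have := factors_movel L (s := rcons (rcons (R nu) j) (j - 1)) (t := R s2 ++ t) _ hfW.
  rewrite !cat_rcons => h2; apply: ideal_factors (h2 _) _.
    by apply: resz; size_lia.
  have es' : s = nu ++ b :: W ++ (b + l)%N :: s2 by rewrite es -catA.
  apply: ee_braid => //.
    have hfWs : all (far j) (R W ++ R s2) by rewrite all_cat hfW.
    have := factors_mover L (s := rcons (rcons (R nu) (j - 1)) j) (t := t) _ hfWs.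
    rewrite !cat_rcons -!catA => h3; apply: ideal_factors (h3 _) _.
      by apply: resz; size_lia.
    have := factors_mover L (s := rcons (R nu) (j - 1)) (t := R s2 ++ j :: t) _ hfW.
    rewrite !cat_rcons => h4; apply: ideal_factors (h4 _) _.
      by apply: resz; size_lia.
    apply: next'; rewrite -{2}ejb -{2}ejb es'; apply: place_swapped_lt HA _ _ _.
    - by rewrite -es'.
    - by rewrite -es' hs.
    - by rewrite -es'.
  have dnb : diag (nu ++ [:: b]).
    by apply: (@diag_prefix _ _ (W ++ (b + l)%N :: s2)); rewrite -catA -es'.
  (* The second arrangement repeats [j] next to [b]: its dot replaces [nu ++ [:: b]]
     by a larger diagram, to which the other residues are then added again; the
     new strand takes the place [b + l], and the last residue [res q] is added by
     the induction hypothesis. *)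
  apply: (ee_repeat (c := X b)); first by apply: resz; size_lia.
  have := HD _ dnb _ nu b [::] (j :: (j - 1) :: R W ++ R s2 ++ t) erefl.
  rewrite map_cat /= -catA /= ejb size_map.
  move=> h5; apply: ideal_trans (h5 _ _); last 2 first.
  - by rewrite -hs es'; size_lia.
  - by rewrite -szb; size_lia.
  move=> _ _ [s' [ds' dm ->]].
  have szs' : size s' = (size nu).+1 by case: dm => -[<- _] _; size_lia.
  have h6 := factors_mover L (s := rcons (R s') j) (t := R s2 ++ t) _ hfW'.
  rewrite !cat_rcons in h6; apply: ideal_factors (h6 _) _.
    by rewrite -szb; size_lia szs'.
  have h7 := factors_mover L (s := R s') (t := (j - 1) :: R s2 ++ t) _ hfW.
  apply: ideal_factors (h7 _) _; first by rewrite -szb; size_lia szs'.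
  have ex : R ((b + l)%N :: s2) = (j - 1) :: R s2 by rewrite /= ejx.
  rewrite -[_ :: R s2 ++ t]cat_cons -ex.
  have sx : sorted ltn ((b + l)%N :: s2) by apply: (sorted_glue (s1 := [::])).
  have [Q [q eQ]] : exists Q q, (b + l)%N :: s2 = rcons Q q.
    by exists (belast (b + l)%N s2), (last (b + l)%N s2); rewrite -lastI.
  have Qx z : z \in rcons Q q -> (b + l <= z)%N.
    by rewrite -eQ inE => /orP[/eqP->//|/(allP s2x)]; apply: ltnW.
  have qx : (b + l <= q)%N by apply: Qx; rewrite mem_rcons inE eqxx.
  have szQ : size s2 = size Q by have := congr1 size eQ; rewrite size_rcons => -[].
  have dQ : domle s2 Q.
    split=> [|c] //; have := congr1 (cnt c) eQ.
    by rewrite -cats1 cnt_cat !cnt_cons /=; move: qx; rewrite /cnt /=; clear; lia.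
  rewrite eQ in sx *.
  have sQ : sorted ltn Q by move: sx; rewrite -cats1 => /sorted_prefix.
  have ds0 : all (fun z => z < b.+1)%N s'.
    apply: dom_all (sdomW dm) _; rewrite all_cat /= ltnSn !andbT.
    by apply/allP => z /(allP nub); apply: ltnW.
  pose sl := own W ++ ((b + l)%N, j) :: own Q.
  have slf : map fst sl = W ++ (b + l)%N :: Q by rewrite map_cat /= !own_fst.
  have sls : map snd sl = R W ++ j :: R Q by rewrite map_cat /= !own_snd.
  have szsl : size sl = (size W + (size s2).+1)%N by rewrite -(size_map fst) slf; size_lia szQ.
  have pl : placeable b.+1 sl.
    apply: (@placeable_cat _ (b + l)%N); rewrite ?own_fst.
    - by apply: placeable_own => //; apply/allP => z /(allP bW); apply: ltnW.
    - by move: s1x; rewrite all_cat => /and3P[].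
    - by move: l_gt0; clear; lia.
    split.
      by have := @lands_up (b + l)%N (b + l)%N (leqnn _); rewrite ejx subrK.
    apply: placeable_own => //; apply/allP => z zQ.
    have := Qx z; rewrite mem_rcons inE zQ orbT => /(_ isT); clear; lia.
  have lb : (l <= b.+1)%N.
    by have [] := hc b ltac:(by rewrite es' mem_cat inE eqxx orbT); clear; lia.
  have hN : (size s' + size sl <= N)%N by rewrite szs' szsl -hs es'; size_lia.
  have hn' : (size s' + size sl + size (res q :: t) = n)%N.
    by rewrite szs' szsl -szb; size_lia.
  have := place HA ds' lb ds0 pl hN hn'; rewrite slf sls.
  have -> : R s' ++ (R W ++ j :: R Q) ++ res q :: t =
            R s' ++ R W ++ j :: R (rcons Q q) ++ t.
    by rewrite map_rcons cat_rcons -catA.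
  apply: ideal_trans => _ _ [s'' [ds'' dm' ->]].
  have lt0 : domlt s ((W ++ (b + l)%N :: Q) ++ s').
    rewrite es'; apply: (dom_sdom_trans (t := (nu ++ [:: b]) ++ W ++ (b + l)%N :: s2)).
      by rewrite -catA.
    apply: sdom_dom_trans (sdom_cat dm (dom_cat (dom_refl W) (dom_cons (leqnn _) dQ))) _.
    by apply: dom_perm; rewrite perm_catC.
  have lt1 := sdom_dom_trans lt0 dm'.
  have sz'' : size s'' = N by case: lt1 => -[<- _] _.
  have hq : all (fun z => z < q.+1)%N s''.
    apply: dom_all dm' _; rewrite !all_cat /= -!andbA.
    have Qq : all (fun z => z < q.+1)%N Q.
      move: sx; rewrite -cats1 => /sorted_split [Qq _ _ _].
      by apply/allP => z /(allP Qq); apply: ltnW.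
    rewrite Qq ltnS qx /=; apply/andP; split.
      move: s1x; rewrite all_cat => /and3P[_ _ hW].
      by apply/allP => z /(allP hW); move: qx; clear; lia.
    by apply/allP => z /(allP ds0); move: qx; clear; lia.
  have lq : (l <= q.+1)%N by move: qx; clear; lia.
  have := IH s'' (leq_trans (sdom_sumn lt1) sm) ds'' sz'' q.+1 q (res q) t lq hq
    (lands_own (leqnn _)).
  rewrite sz'' -{1}hs => /(_ hn); apply: ideal_sub_set => _ [u [du dmu ->]].
  exists u; split=> //; apply: dom_trans dmu; apply: dom_trans (dom_cons (leqnn q) dm').
  have xg : (b + l <= g)%N by move: xd hl.1; clear; lia.
  apply: (dom_trans (t := (g :: nu ++ [:: b]) ++ W ++ (b + l)%N :: s2)).
    by rewrite es' /= -catA.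
  apply: dom_trans (dom_cat (dom_cons xg (sdomW dm)) (dom_refl _)) _.
  apply: dom_perm; rewrite /= eQ.
  have e0 : perm_eq (q :: (W ++ (b + l)%N :: Q) ++ s') ((b + l)%N :: s' ++ W ++ rcons Q q).
    rewrite -cats1; apply/seq.permP => p; do 3! rewrite /= ?count_cat.
    by clear; lia.
  by rewrite perm_sym.
- (* [x] has residue [j + 1] *)
  have rj : res (x + l)%N = j by rewrite res_below ej addrK.
  have s2P c : c \in s -> (x < c)%N -> far j (res c).
    rewrite es mem_cat inE => /orP[/(allP s1x)|/orP[/eqP->|cs]]; rewrite ?ltnn //.
      by move=> h1 h2; have := ltn_trans h1 h2; rewrite ltnn.
    by move=> _; apply: (allP hf2); apply: map_f.
  rewrite -rj in hl s2P *; have xl : (x < x + l)%N by rewrite -[X in (X < _)%N]addn0 ltn_add2l.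
  apply: (add_insert (d := d)) => //.
  + by apply/negP => h; have := s2P _ h xl; rewrite far_refl.
  + exact: leq_addl.
  + by rewrite addnK.
  + by rewrite ltn_add2r.
  + by move=> c cs h; apply: s2P => //; apply: ltn_trans h.
Qed.

(** The dots on a diagram need the additions to smaller diagrams, and an addition
    needs the dots on diagrams of the same size. *)
Lemma good_all s : diag s -> good_add s /\ good_dot s.
Proof.
suff H N : forall s', diag s' -> (size s' < N)%N -> good_add s' /\ good_dot s'.
  by move=> ds; apply: (H (size s).+1).
elim: N => // N IH s' ds' hs.
have HA u : diag u -> (size u < size s')%N -> good_add u.
  by move=> du hu; apply IH => //; apply: leq_trans hu hs.
have HD u : diag u -> (size u < size s')%N -> good_dot u.
  by move=> du hu; apply IH => //; apply: leq_trans hu hs.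
have HD' u : diag u -> (size u <= size s')%N -> good_dot u.
  rewrite leq_eqVlt => du /orP[/eqP eu|]; last exact: HD.
  exact: good_dot_step HA HD _ du eu.
by split; [apply: good_add_step HA HD' _ ds' erefl | apply: HD'].
Qed.

End Placement.

(** * Words in the symmetric group *)
Section Swaps.
Local Open Scope nat_scope.

Fixpoint swap_at (T : Type) k (t : seq T) : seq T :=
  match k, t with
  | 0, a :: b :: t' => b :: a :: t'
  | k.+1, a :: t' => a :: swap_at k t'
  | _, _ => t
  end.

(** The number of inversions, which is the length of the permutation that sorts
    [t]. *)
Fixpoint inv (t : seq nat) : nat := if t is a :: t' then cnt a t' + inv t' else 0.

Lemma swap_atE (T : Type) (t1 : seq T) a b t2 :
  swap_at (size t1) (t1 ++ [:: a, b & t2]) = t1 ++ [:: b, a & t2].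
Proof. by elim: t1 => //= c t1 ->. Qed.

Lemma split_at (T : Type) k (t : seq T) : k.+1 < size t ->
  exists t1 a b t2, t = t1 ++ [:: a, b & t2] /\ size t1 = k.
Proof.
elim: k t => [|k IH] [|a t] //=; first by case: t => // b t _; exists [::], a, b, t.
by rewrite ltnS => /IH [t1 [c [b [t2 [-> <-]]]]]; exists (a :: t1), c, b, t2.
Qed.

Lemma swap_atK (T : Type) k : involutive (@swap_at T k).
Proof.
elim: k => [|k IH] [|a t] //=; first by case: t.
by rewrite IH.
Qed.

Lemma cat_inj_size (T : Type) (t1 t1' t2 t2' : seq T) :
  size t1 = size t1' -> t1 ++ t2 = t1' ++ t2' -> t1 = t1' /\ t2 = t2'.
Proof.
by elim: t1 t1' => [|a t1 IH] [|b t1'] //= [hs] [-> /(IH _ hs) [-> ->]].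
Qed.

Lemma map_swap_at (T U : Type) (f : T -> U) k t :
  map f (swap_at k t) = swap_at k (map f t).
Proof.
elim: k t => [|k IH] [|a t] //=; first by case: t.
by rewrite IH.
Qed.

Lemma perm_swap_at (T : eqType) k (t : seq T) : perm_eq (swap_at k t) t.
Proof.
elim: k t => [|k IH] [|a t] //=; last by rewrite perm_cons.
case: t => // b t; rewrite -[b :: a :: t]/([:: b] ++ [:: a] ++ t).
by rewrite perm_catCA.
Qed.

Lemma inv_cat t1 t2 :
  inv (t1 ++ t2) = inv t1 + inv t2 + \sum_(a <- t1) cnt a t2.
Proof.
elim: t1 => [|a t1 IH]; first by rewrite big_nil addn0.
by rewrite /= big_cons IH cnt_cat; clear; lia.
Qed.

Lemma inv_swap t1 a b t2 : a < b ->
  inv (t1 ++ [:: b, a & t2]) = (inv (t1 ++ [:: a, b & t2])).+1.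
Proof.
move=> ab; rewrite !inv_cat /= !cnt_cons ab.
rewrite (_ : b < a = false); last by move: ab; clear; lia.
rewrite (eq_bigr (fun c => cnt c [:: a, b & t2])); last first.
  by move=> c _; rewrite !cnt_cons; clear; lia.
by clear; lia.
Qed.

Lemma descent t : 0 < inv t ->
  exists t1 a b t2, t = t1 ++ [:: a, b & t2] /\ b < a.
Proof.
elim: t => // a t IH /=.
case: (posnP (inv t)) => [i0 h|/IH [t1 [c [b [t2 [-> cb]]]]] _]; last first.
  by exists (a :: t1), c, b, t2.
case: t i0 h {IH} => // b t /=; rewrite cnt_cons => h1.
case: (ltnP b a) => ba h2; first by exists [::], a, b, t.
suff : cnt a t <= cnt b t by move: h1 h2; clear; lia.
by apply: sub_count => z /=; move: ba; clear; lia.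
Qed.

Lemma inv_sorted t : inv t = 0 -> uniq t -> sorted ltn t.
Proof.
elim: t => // a [//|b t] IH /=; rewrite cnt_cons => h /and3P[h1 h2 h3].
have -> : path ltn b t.
  by apply: IH; rewrite /= ?h2 //; move: h; clear => /=; lia.
move: h1; rewrite inE negb_or => /andP[h1 _]; rewrite andbT.
by move: h h1; clear; lia.
Qed.
End Swaps.

(** * Straightening words modulo more dominant diagrams *)
Section Straightening.
Variables (I : nzRingType) (n l : nat) (res : nat -> I).
Variables (O A : pzRingType) (sc : {rmorphism O -> A}).
Variables (psi y : nat -> A) (ee : seq I -> A) (X : nat -> O).
Hypothesis sc_central : forall c x, sc c * x = x * sc c.
Hypothesis L : klr_laws n l res psi y ee (fun m => sc (X m)).
Hypothesis l_gt0 : (0 < l)%N.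
Hypothesis res_below : forall c, res (c + l) = res c - 1.
Hypothesis res_far : forall c d, (c < d < c + l)%N -> far (res c) (res d).
Hypothesis two_neq0 : 1 + 1 != 0 :> I.
Hypothesis X_below : forall c, X (c + l)%N = X c.

Local Notation gen_alg := (gen_alg n sc psi y ee).
Local Notation ideal := (ideal n sc psi y ee).
Local Notation R := (map res).

Variable s0 : seq nat.
Hypothesis ds0 : diag l s0.
Hypothesis size_s0 : size s0 = n.

Let J := ideal (sabove l res s0 [::]).

(** The word [u] is read as successive exchanges of adjacent entries of [s0], the
    list of the nodes in increasing order, so that [state u] lists the nodes of a
    tableau by their entries and [Psi u] is the corresponding [psi]-word, the
    last letter of [u] being leftmost. *)
Definition state (u : seq nat) := foldl (fun t k => swap_at k t) s0 u.
Definition Psi (u : seq nat) : A := foldl (fun x k => psi k * x) (ee (R s0)) u.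
Definition valid := all (fun k => k.+1 < n)%N.

Lemma state_rcons u k : state (rcons u k) = swap_at k (state u).
Proof. exact: foldl_rcons. Qed.
Lemma Psi_rcons u k : Psi (rcons u k) = psi k * Psi u.
Proof. exact: foldl_rcons. Qed.
Lemma valid_rcons u k : valid (rcons u k) = (k.+1 < n)%N && valid u.
Proof. exact: all_rcons. Qed.
Lemma perm_state u : perm_eq (state u) s0.
Proof.
elim/last_ind: u => // u k IH; rewrite state_rcons.
exact: perm_trans (perm_swap_at _ _) IH.
Qed.
Lemma size_state u : size (state u) = n.
Proof. by rewrite (perm_size (perm_state u)). Qed.
Lemma uniq_s0 : uniq s0.
Proof. by case: ds0 => h _; apply: sorted_uniq h; [apply: ltn_trans | apply: ltnn]. Qed.
Lemma uniq_state u : uniq (state u).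
Proof. by rewrite (perm_uniq (perm_state u)) uniq_s0. Qed.

Lemma state_split u k : (k.+1 < n)%N -> exists t1 a b t2,
  [/\ state u = t1 ++ [:: a, b & t2], size t1 = k,
      state (rcons u k) = t1 ++ [:: b, a & t2] & a != b].
Proof.
move=> hk; have [|t1 [a [b [t2 [e1 e2]]]]] := @split_at _ k (state u).
  by rewrite size_state.
exists t1, a, b, t2; split=> //; first by rewrite state_rcons e1 -e2 swap_atE.
have := uniq_state u; rewrite e1 cat_uniq => /and3P[_ _ /=].
by rewrite inE negb_or => /andP[/andP[]].
Qed.

Lemma size_Rstate u t1 a b t2 : state u = t1 ++ [:: a, b & t2] ->
  size (R t1 ++ [:: res a, res b & R t2]) = n.
Proof. by move=> e; rewrite -(size_state u) e !size_cat /= !size_map. Qed.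

Lemma Psi_left u : valid u -> ee (R (state u)) * Psi u = Psi u.
Proof.
elim/last_ind: u => [_|u k IH]; first by rewrite (law_idem L) // size_map.
rewrite valid_rcons => /andP[hk hu].
have [t1 [a [b [t2 [e1 e2 e3 _]]]]] := state_split u hk.
rewrite e3 Psi_rcons -{2}(IH hu) e1 !map_cat /= mulrA.
have hs := size_Rstate e1.
have <- : size (R t1) = k by rewrite size_map.
rewrite -(law_psie L); last by rewrite -hs !size_cat.
by rewrite -mulrA; congr (_ * _); rewrite -{2}(IH hu) e1 map_cat.
Qed.

(** The span of the words of fewer than [N] letters, modulo the ideal [J] of the
    strictly more dominant diagrams. *)
Inductive low (N : nat) : A -> Prop :=
| low_J x : J x -> low N x
| low_Psi u : valid u -> (size u < N)%N -> low N (Psi u)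
| low_sc c x : low N x -> low N (sc c * x)
| low_add x z : low N x -> low N z -> low N (x + z).

Lemma low0 N : low N 0.
Proof. by apply/low_J/ideal_zero. Qed.
Lemma low_opp N x : low N x -> low N (- x).
Proof.
by move=> h; rewrite -mulN1r -(rmorph1 sc) -rmorphN; apply: low_sc.
Qed.
Lemma low_sub N x z : low N x -> low N z -> low N (x - z).
Proof. by move=> h1 h2; apply: low_add => //; apply: low_opp. Qed.
Lemma lowW N N' x : (N <= N')%N -> low N x -> low N' x.
Proof.
move=> h; elim=> {x} [x Jx|u hu hs|c x _|x z _ h1 _ h2]; first exact: low_J.
- by apply: low_Psi => //; apply: leq_trans h.
- exact: low_sc.
- exact: low_add.
Qed.

Lemma low_psi N k x : (k.+1 < n)%N -> low N x -> low N.+1 (psi k * x).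
Proof.
move=> hk; elim=> {x} [x Jx|u hu hs|c x _ h|x z _ h1 _ h2].
- by apply/low_J/ideal_mull => //; apply: B_psi.
- by rewrite -Psi_rcons; apply: low_Psi; rewrite ?valid_rcons ?hk // size_rcons.
- by rewrite mulrA -sc_central -mulrA; apply: low_sc.
- by rewrite mulrDr; apply: low_add.
Qed.

Lemma low_ee N s x : size s = n -> low N x -> low N (ee s * x).
Proof.
move=> hs; elim=> {x} [x Jx|u hu hsz|c x _ h|x z _ h1 _ h2].
- by apply/low_J/ideal_mull => //; apply: B_ee.
- rewrite -(Psi_left hu) mulrA; have hu' : size (R (state u)) = n.
    by rewrite size_map size_state.
  case: (s =P R (state u)) => [->|ne].
    by rewrite (law_idem L) // Psi_left //; apply: low_Psi.
  by rewrite (law_orth L) // mul0r; apply: low0.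
- by rewrite mulrA -sc_central -mulrA; apply: low_sc.
- by rewrite mulrDr; apply: low_add.
Qed.

Lemma low_nat N (b : bool) x : low N x -> low N (b%:R * x).
Proof. by case: b => h; rewrite ?mul1r ?mul0r //; apply: low0. Qed.

(** A dot moves through the crossings to [ee (R s0)], where it is a scalar modulo
    [J]; a correction term has one crossing less. *)
Lemma low_y_Psi u k : valid u -> (k < n)%N -> low (size u).+1 (y k * Psi u).
Proof.
elim/last_ind: u k => [|u m IH] k.
  move=> _ hk; have hk' : (k < size s0)%N by rewrite size_s0.
  have [s1 [c [s2 [e1 e2]]]] : exists s1 c s2, s0 = s1 ++ c :: s2 /\ size s1 = k.
    exists (take k s0), (nth 0%N s0 k), (drop k.+1 s0).
    by rewrite -drop_nth // cat_take_drop size_takel // ltnW.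
  have := (good_all sc_central L l_gt0 res_below res_far two_neq0 X_below ds0).2.
  move/(_ s1 c s2 [::] e1); rewrite addn0 cats0 e2 => /(_ size_s0) h.
  rewrite -[y k](subrK (sc (X c))) mulrDl; apply: low_add; first exact: low_J.
  by apply: low_sc; apply: (@low_Psi _ [::]).
rewrite valid_rcons size_rcons Psi_rcons => /andP[hm hu] hk.
have [t1 [a [b [t2 [e1 e2 e3 _]]]]] := state_split u hm.
have hP : Psi u = ee (R t1 ++ [:: res a, res b & R t2]) * Psi u.
  by rewrite -{1}(Psi_left hu) e1 map_cat.
have hs := size_Rstate e1; have ht : size (R t1) = m by rewrite size_map.
have lowu : low (size u).+2 (Psi u) by apply: low_Psi.
case: (k =P m.+1) => [->|km1].
  rewrite mulrA hP mulrA -{1 2}ht (law_yhipsi L hs) -mulrA -hP mulrBl ht.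
  apply: low_sub; last exact: low_nat.
  by rewrite -mulrA; apply: low_psi => //; apply: IH => //; apply: ltnW.
case: (k =P m) => [->|km].
  have -> : y m * (psi m * Psi u) =
      psi m * y m.+1 * Psi u + (res a == res b)%:R * Psi u.
    rewrite hP !mulrA -{3 4}ht (law_psiyhi L hs) ht.
    by rewrite -mulrDl -mulrDl subrK.
  apply: low_add; last exact: low_nat.
  by rewrite -mulrA; apply: low_psi => //; apply: IH.
rewrite mulrA -(law_psiy L) // -mulrA.
by apply: low_psi => //; apply: IH.
Qed.

Lemma low_y N k x : (k < n)%N -> low N x -> low N (y k * x).
Proof.
move=> hk; elim=> {x} [x Jx|u hu hs|c x _ h|x z _ h1 _ h2].
- by apply/low_J/ideal_mull => //; apply: B_y.
- by apply: lowW hs _; apply: low_y_Psi.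
- by rewrite mulrA -sc_central -mulrA; apply: low_sc.
- by rewrite mulrDr; apply: low_add.
Qed.

Lemma low_sq u k : valid u -> (k.+1 < n)%N -> low (size u).+1 (psi k * (psi k * Psi u)).
Proof.
move=> hu hk; have [t1 [a [b [t2 [e1 e2 e3 _]]]]] := state_split u hk.
have hP : Psi u = ee (R t1 ++ [:: res a, res b & R t2]) * Psi u.
  by rewrite -{1}(Psi_left hu) e1 map_cat.
have hs := size_Rstate e1; have ht : size (R t1) = k by rewrite size_map.
have lowu : low (size u).+1 (Psi u) by apply: low_Psi.
have hk' : (k < n)%N by apply: ltnW.
have hs' c d : size (R t1 ++ [:: c, d & R t2]) = n by rewrite -hs !size_cat.
rewrite hP !mulrA -ht; case: (boolP (far (res a) (res b))) => hf.
  by rewrite (law_sq_far L) // -hP.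
case: (far_cases hf) => er.
- by rewrite er (law_sq_eq L (hs' _ _)) mul0r; apply: low0.
- rewrite er (law_sq_down L (hs' _ _)) -er -mulrA -hP mulrBl ht.
  by apply: low_sub; apply: low_y.
- rewrite er (law_sq_up L (hs' _ _)) -er -mulrA -hP mulrBl ht.
  by apply: low_sub; apply: low_y.
Qed.

Definition reduced u := size u == inv (state u).

Lemma inv_step u k t1 a b t2 : state u = t1 ++ [:: a, b & t2] -> size t1 = k ->
  state (rcons u k) = t1 ++ [:: b, a & t2] /\
  ((a < b)%N -> inv (state (rcons u k)) = (inv (state u)).+1) /\
  ((b < a)%N -> inv (state u) = (inv (state (rcons u k))).+1).
Proof.
move=> e1 e2; have e3 : state (rcons u k) = t1 ++ [:: b, a & t2].
  by rewrite state_rcons e1 -e2 swap_atE.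
by rewrite e3 e1; split=> //; split=> h; apply: inv_swap.
Qed.

Lemma inv_state u : valid u -> (inv (state u) <= size u)%N.
Proof.
elim/last_ind: u => [_|u k IH].
  suff -> : inv (state [::]) = 0%N by [].
  have : sorted ltn s0 by case: ds0.
  rewrite /state /=; elim: (s0) => //= a s IHs hs.
  rewrite IHs ?(path_sorted hs) // addn0; apply/eqP; rewrite -leqn0 leqNgt -has_count.
  apply/hasPn => x xs; rewrite -leqNgt; apply: ltnW.
  have := @sorted_split [::] a s hs; case=> _ /allP /(_ x xs) + _ _.
  by [].
rewrite valid_rcons size_rcons => /andP[hk /IH h].
have [t1 [a [b [t2 [e1 e2 e3 ab]]]]] := state_split u hk.
have [_ [h1 h2]] := inv_step e1 e2.
case: (ltngtP a b) ab => // [/h1 ->|/h2 h3] _ //.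
by move: h; rewrite h3; clear; lia.
Qed.

Lemma reduced_rcons u k : valid (rcons u k) -> reduced (rcons u k) ->
  reduced u /\ exists t1 a b t2, [/\ state (rcons u k) = t1 ++ [:: a, b & t2],
    size t1 = k, state u = t1 ++ [:: b, a & t2] & (b < a)%N].
Proof.
move=> hv; have := hv; rewrite valid_rcons => /andP[hk hu] /eqP; rewrite size_rcons => hr.
have [t1 [a [b [t2 [e1 e2 e3 ab]]]]] := state_split u hk.
have [_ [h1 h2]] := inv_step e1 e2; have := inv_state hu.
case: (ltngtP a b) ab => // [ab|/h2 h3] _.
  move=> _; split; last by exists t1, b, a, t2.
  by apply/eqP; move: (h1 ab); rewrite -hr => -[].
by rewrite h3 -hr ltnNge leqnSn.
Qed.

Lemma rcons_reduced u k t1 a b t2 : reduced u -> state u = t1 ++ [:: a, b & t2] ->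
  size t1 = k -> (a < b)%N -> reduced (rcons u k).
Proof.
move=> /eqP hr e1 e2 ab; have [_ [h1 _]] := inv_step e1 e2.
by rewrite /reduced size_rcons h1 // hr.
Qed.

Lemma reduced_exists t : perm_eq t s0 ->
  exists u, [/\ valid u, reduced u & state u = t].
Proof.
move: {2}(inv t) (erefl (inv t)) => N; elim: N t => [|N IH] t it pt.
  exists [::]; have -> : t = s0.
    apply: (irr_sorted_eq ltn_trans ltnn); last exact: perm_mem pt.
      by apply: inv_sorted => //; rewrite (perm_uniq pt) uniq_s0.
    by case: ds0.
  split=> //; apply/eqP/esym/eqP; rewrite -leqn0; exact: (@inv_state [::]).
have [t1 [a [b [t2 [et ba]]]]] : exists t1 a b t2, t = t1 ++ [:: a, b & t2] /\ (b < a)%N.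
  by apply: descent; rewrite it.
have pt' : perm_eq (t1 ++ [:: b, a & t2]) s0.
  by apply: perm_trans pt; rewrite -(swap_atE t1 a b t2) et perm_swap_at.
have [|u [h1 h2 h3]] := IH (t1 ++ [:: b, a & t2]) _ pt'.
  by move: it; rewrite et inv_swap // => -[].
exists (rcons u (size t1)); split.
- rewrite valid_rcons h1 andbT -(size_state u) h3 size_cat /=; clear; lia.
- exact: rcons_reduced h2 h3 _ ba.
- by rewrite state_rcons h3 swap_atE.
Qed.
Lemma state_pred u k : state u = swap_at k (state (rcons u k)).
Proof. by rewrite state_rcons swap_atK. Qed.

Section MatsumotoStep.
Variables (N : nat) (u v : seq nat) (k m : nat).
Hypothesis IH : forall u v, valid u -> valid v -> size u = N -> reduced u ->
  size v = N -> state u = state v -> low N (Psi u - Psi v).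
Hypothesis vu : valid (rcons u k).
Hypothesis vv : valid (rcons v m).
Hypothesis su : size u = N.
Hypothesis sv : size v = N.
Hypothesis ru : reduced (rcons u k).
Hypothesis rv : reduced (rcons v m).
Hypothesis st : state (rcons u k) = state (rcons v m).

Let hk : (k.+1 < n)%N. Proof. by move: vu; rewrite valid_rcons => /andP[]. Qed.
Let hm : (m.+1 < n)%N. Proof. by move: vv; rewrite valid_rcons => /andP[]. Qed.
Let vu' : valid u. Proof. by move: vu; rewrite valid_rcons => /andP[]. Qed.
Let vv' : valid v. Proof. by move: vv; rewrite valid_rcons => /andP[]. Qed.

Lemma matsumoto_same : k = m -> low N.+1 (Psi (rcons u k) - Psi (rcons v m)).
Proof.
move=> ekm; rewrite !Psi_rcons -ekm -mulrBr; apply: low_psi => //.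
apply: IH => //; first by case: (reduced_rcons vu ru).
by rewrite (state_pred u k) (state_pred v m) st ekm.
Qed.

Lemma size_reduced w w' : reduced w -> reduced w' -> state w = state w' ->
  size w = size w'.
Proof. by move=> /eqP -> /eqP -> ->. Qed.

(** The words [u k] and [v m] end in commuting exchanges; both are compared with
    words that go through the list where the two descents are undone. *)
Lemma matsumoto_far : (k.+1 < m)%N -> low N.+1 (Psi (rcons u k) - Psi (rcons v m)).
Proof.
move=> km; have [ru' [t1 [a [b [t2 [e1 e2 e3 ba]]]]]] := reduced_rcons vu ru.
have [rv' [t1' [c [d [t3 [e1' e2' e3' dc]]]]]] := reduced_rcons vv rv.
have szt : (size t1 + (size t2).+2 = n)%N by rewrite -(size_state (rcons u k)) e1 size_cat.
have [|r [c' [d' [t3' [er sr]]]]] := @split_at _ (m - k.+2)%N t2.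
  by move: szt hm km; rewrite e2; clear; lia.
have sr' : size (t1 ++ [:: a, b & r]) = m.
  by rewrite size_cat /= sr e2; move: km; clear; lia.
have : (t1 ++ [:: a, b & r]) ++ [:: c', d' & t3'] = t1' ++ [:: c, d & t3].
  by rewrite -catA /= -er -e1 st e1'.
case/cat_inj_size; first by rewrite sr' e2'.
move=> et1' [ec ed et3]; subst c' d' t3' t1' t2.
have px : perm_eq (t1 ++ [:: b, a & r ++ [:: d, c & t3]]) s0.
  apply: perm_trans (perm_state (rcons u k)); rewrite e1.
  rewrite -(swap_atE t1 a b) -[_ ++ _ :: _ :: r ++ _]/(t1 ++ [:: a, b & r ++ _]).
  apply: perm_trans (perm_swap_at _ _) _.
  rewrite -!cat_cons !catA -(swap_atE _ c d); exact: perm_swap_at.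
have [w [vw rw ew]] := reduced_exists px.
have ewm : state w = (t1 ++ [:: b, a & r]) ++ [:: d, c & t3] by rewrite ew -catA.
have rwm : reduced (rcons w m).
  by apply: rcons_reduced rw ewm _ dc; rewrite -sr' !size_cat.
have rwk : reduced (rcons w k) by apply: rcons_reduced rw ew e2 ba.
have swm : state (rcons w m) = state u.
  have sr2 : size (t1 ++ [:: b, a & r]) = m by rewrite -sr' !size_cat.
  by rewrite state_rcons ewm -sr2 swap_atE e3 -catA.
have swk : state (rcons w k) = state v.
  by rewrite state_rcons ew -e2 swap_atE e3' -catA.
have vwm : valid (rcons w m) by rewrite valid_rcons vw hm.
have vwk : valid (rcons w k) by rewrite valid_rcons vw hk.
rewrite !Psi_rcons.
have h1 := IH vu' vwm su ru' (etrans (size_reduced rwm ru' swm) su) (esym swm).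
have h2 := IH vv' vwk sv rv' (etrans (size_reduced rwk rv' swk) sv) (esym swk).
have -> : psi k * Psi u - psi m * Psi v =
    psi k * (Psi u - Psi (rcons w m)) - psi m * (Psi v - Psi (rcons w k)).
  rewrite !Psi_rcons !mulrBr !mulrA (law_psipsi L km hm) opprB.
  by rewrite addrA subrK.
by apply: low_sub; apply: low_psi.
Qed.

(** As for commuting exchanges, with the list where three adjacent nodes are put in
    increasing order; the correction term of the braid relation is shorter. *)
Lemma matsumoto_braid : m = k.+1 -> low N.+1 (Psi (rcons u k) - Psi (rcons v m)).
Proof.
move=> km; have [ru' [t1 [a [b [t2 [e1 e2 e3 ba]]]]]] := reduced_rcons vu ru.
have [rv' [t1' [b' [c [t3 [e1' e2' e3' cb]]]]]] := reduced_rcons vv rv.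
have : rcons t1 a ++ b :: t2 = t1' ++ [:: b', c & t3] by rewrite cat_rcons -e1 st.
case/cat_inj_size; first by rewrite size_rcons e2 e2' km.
move=> et1' [eb et2]; subst b' t1' t2.
rewrite cat_rcons in e3'.
have px : perm_eq (t1 ++ [:: c, b, a & t3]) s0.
  apply: perm_trans (perm_state (rcons u k)); rewrite e1 perm_cat2l.
  by apply/seq.permP => p /=; clear; lia.
have [w [vw rw ew]] := reduced_exists px.
have st1 x : size (rcons t1 x) = m by rewrite size_rcons e2 km.
have rwk : reduced (rcons w k) by apply: rcons_reduced rw ew e2 cb.
have swk : state (rcons w k) = t1 ++ [:: b, c, a & t3].
  by rewrite state_rcons ew -e2 swap_atE.
have rwm : reduced (rcons w m).
  have ewc : state w = rcons t1 c ++ [:: b, a & t3] by rewrite cat_rcons.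
  exact: rcons_reduced rw ewc (st1 _) ba.
have swm : state (rcons w m) = t1 ++ [:: c, a, b & t3].
  by rewrite state_rcons ew -(st1 c) -cat_rcons swap_atE cat_rcons.
have ca : (c < a)%N by apply: ltn_trans ba.
have rwkm : reduced (rcons (rcons w k) m).
  have ewb : state (rcons w k) = rcons t1 b ++ [:: c, a & t3] by rewrite cat_rcons.
  exact: rcons_reduced rwk ewb (st1 _) ca.
have swkm : state (rcons (rcons w k) m) = state u.
  by rewrite state_rcons swk -(st1 b) -cat_rcons swap_atE cat_rcons e3.
have rwmk : reduced (rcons (rcons w m) k) by apply: rcons_reduced rwm swm e2 ca.
have swmk : state (rcons (rcons w m) k) = state v.
  by rewrite state_rcons swm -e2 swap_atE e3'.
have vwkm : valid (rcons (rcons w k) m) by rewrite !valid_rcons vw hm hk.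
have vwmk : valid (rcons (rcons w m) k) by rewrite !valid_rcons vw hm hk.
rewrite !Psi_rcons.
have sw1 := etrans (size_reduced rwkm ru' swkm) su.
have h1 := IH vu' vwkm su ru' sw1 (esym swkm).
have h2 := IH vv' vwmk sv rv' (etrans (size_reduced rwmk rv' swmk) sv) (esym swmk).
have hP : Psi w = ee (R t1 ++ [:: res c, res b, res a & R t3]) * Psi w.
  by rewrite -{1}(Psi_left vw) ew map_cat.
have hs : size (R t1 ++ [:: res c, res b, res a & R t3]) = n.
  by rewrite -(size_state w) ew !size_cat /= !size_map.
have hbr : psi k * (psi m * (psi k * Psi w)) =
   psi m * (psi k * (psi m * Psi w)) + braid_const A (res c) (res b) (res a) * Psi w.
  have := law_braid L hs; rewrite size_map e2 -km => hb.
  by rewrite hP !mulrA hb !mulrDl.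
have -> : psi k * Psi u - psi m * Psi v =
    psi k * (Psi u - Psi (rcons (rcons w k) m)) - psi m * (Psi v - Psi (rcons (rcons w m) k))
    + braid_const A (res c) (res b) (res a) * Psi w.
  rewrite !Psi_rcons !mulrBr hbr.
  rewrite -{1}[psi k * Psi u](subrK (psi m * (psi k * (psi m * Psi w)) +
    braid_const A (res c) (res b) (res a) * Psi w)).
  rewrite opprB -!addrA; do 3 congr (_ + _).
  by rewrite addrC.
apply: low_add; first by apply: low_sub; apply: low_psi.
have lw : low N.+1 (Psi w).
  by apply: low_Psi => //; rewrite -sw1 !size_rcons; clear; lia.
rewrite /braid_const; case: ifP => _; first by rewrite mulN1r; apply: low_opp.
by case: ifP => _; rewrite ?mul1r ?mul0r //; apply: low0.
Qed.
End MatsumotoStep.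

(** Two reduced words of the same permutation are linked by braid moves, and the
    failure of the braid relation in the algebra is a shorter word. *)
Lemma matsumoto N u v : valid u -> valid v -> size u = N -> reduced u ->
  size v = N -> state u = state v -> low N (Psi u - Psi v).
Proof.
elim: N u v => [|N IH] u v.
  by move=> _ _ /size0nil -> _ /size0nil -> _; rewrite subrr; apply: low0.
case/lastP: u => // u k; case/lastP: v => // v m.
move=> vu vv; rewrite !size_rcons => -[su] ru [sv] st.
have rv : reduced (rcons v m).
  by rewrite /reduced -st -(eqP ru) !size_rcons su sv.
case: (ltngtP k m) => km; last exact: matsumoto_same.
- rewrite leq_eqVlt in km; case/orP: km => [/eqP km|km].
    exact: matsumoto_braid.
  exact: matsumoto_far.
- rewrite -opprB; apply: low_opp.
  rewrite leq_eqVlt in km; case/orP: km => [/eqP km|km].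
    by apply: matsumoto_braid => //.
  by apply: matsumoto_far.
Qed.

(** At the first letter that fails to create an inversion, another reduced word of
    the same permutation ends with that letter, and its square is straightened by
    the quadratic relation. *)
Lemma low_nonreduced u : valid u -> ~~ reduced u -> low (size u) (Psi u).
Proof.
elim/last_ind: u => [|u k IH].
  by move=> v0; rewrite /reduced eq_sym -leqn0 (@inv_state [::]).
move=> hv nr; have := hv; rewrite valid_rcons => /andP[hk hu].
rewrite Psi_rcons size_rcons; case: (boolP (reduced u)) => [ru|/(IH hu) h]; last exact: low_psi.
have [t1 [a [b [t2 [e1 e2 e3 ab]]]]] := state_split u hk.
case: (ltngtP a b) ab => // [ab|ba] _.
  by case/negP: nr; apply: rcons_reduced ru e1 e2 ab.
have [w [vw rw ew]] := reduced_exists (perm_state (rcons u k)).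
have ew' : state w = t1 ++ [:: b, a & t2] by rewrite ew.
have rwk := rcons_reduced rw ew' e2 ba.
have swk : state (rcons w k) = state u by rewrite state_rcons ew' -e2 swap_atE.
have vwk : valid (rcons w k) by rewrite valid_rcons hk vw.
have szw := size_reduced rwk ru swk.
have h := matsumoto hu vwk erefl ru szw (esym swk).
rewrite -[Psi u](subrK (Psi (rcons w k))) mulrDr; apply: low_add; first exact: low_psi.
by rewrite Psi_rcons; apply: lowW (low_sq vw hk); rewrite -szw size_rcons leqW.
Qed.
Lemma gen_Psi u : valid u -> gen_alg (Psi u).
Proof.
elim/last_ind: u => [_|u k IH]; first by apply: B_ee; rewrite size_map.
by rewrite valid_rcons Psi_rcons => /andP[hk /IH h]; apply: B_mul => //; apply: B_psi.
Qed.

Lemma factors_perm M M' s t : perm_eq M M' -> uniq M ->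
  (forall a b, a \in M -> b \in M -> a != b -> far (res a) (res b)) ->
  size (s ++ R M ++ t) = n ->
  factors n sc psi y ee 0 (s ++ R M ++ t) (s ++ R M' ++ t).
Proof.
elim: M' s M => [|x M' IH] s M pM uM hf hs.
  have -> : M = [::] by apply/size0nil; rewrite (perm_size pM).
  exact: factors_refl.
have [P [Q eM]] : exists P Q : seq nat, M = P ++ x :: Q.
  have : x \in M by rewrite (perm_mem pM) inE eqxx.
  by case/splitPr => P Q; exists P, Q.
subst M; rewrite map_cat /= -catA /= in hs *.
have [xP uPQ] : x \notin P ++ Q /\ uniq (P ++ Q).
  by move: uM; rewrite -cat1s uniq_catCA /= => /andP[].
have hf1 : all (far (res x)) (R P).
  rewrite all_map; apply/allP => z zP; apply: hf.
  - by rewrite mem_cat inE eqxx orbT.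
  - by rewrite mem_cat zP.
  - by apply: contraNneq xP => ->; rewrite mem_cat zP.
apply: factors_trans (factors_le (leq0n _) (factors_movel L hs hf1)) _.
have pM' : perm_eq (P ++ Q) M'.
  by rewrite -(perm_cons x); apply: perm_trans pM; rewrite -cat1s perm_catCA.
have := IH (rcons s (res x)) (P ++ Q) pM' uPQ; rewrite map_cat !cat_rcons -catA.
apply; last by rewrite -hs; size_lia.
by move=> a b; rewrite !mem_cat => /orP[] h1 /orP[] h2; apply: hf;
   rewrite mem_cat ?inE ?h1 ?h2 ?orbT.
Qed.

(** Some node is listed after the node below it. *)
Definition nonstd (t : seq nat) :=
  exists x p q, t = p ++ (x + l)%N :: q /\ x \in q.

(** The nodes before [x + l] and those after [x] being sorted, all strands between
    [x] and [x + l] in the order of codes are pairwise far, and they can be moved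
    between the two strands: this is the situation of [place_swapped]. *)
Lemma swapped_higher x p q : perm_eq (p ++ [:: (x + l)%N, x & q]) s0 ->
  sorted ltn (rcons p (x + l)%N) -> sorted ltn (x :: q) ->
  J (ee (R (p ++ [:: (x + l)%N, x & q]))).
Proof.
move=> pt; rewrite -cats1 => /sorted_split [pxl _ sp _] sxq.
have /= [_ xq _ sq] := @sorted_split [::] x q sxq.
have ut : uniq (p ++ [:: (x + l)%N, x & q]) by rewrite (perm_uniq pt) uniq_s0.
have hmem z : z \in s0 = [|| z \in p, z == (x + l)%N, z == x | z \in q].
  by rewrite -(perm_mem pt) mem_cat !inE.
have xp : x \notin p.
  move: ut; rewrite cat_uniq /= !negb_or => /and3P[_ /andP[_ /andP[h _]] _] //.
have xlq : (x + l)%N \notin q.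
  by move: ut; rewrite cat_uniq /= !inE !negb_or => /and5P[_ _ /andP[]].
have ss0 : sorted ltn s0 by case: ds0.
pose nu := [seq z <- p | (z < x)%N]; pose W1 := [seq z <- p | (x < z)%N].
pose W2 := [seq z <- q | (z < x + l)%N]; pose T := [seq z <- q | (x + l < z)%N].
have ep : p = nu ++ W1 := sorted_insert sp xp.
have eq : q = W2 ++ T := sorted_insert sq xlq.
pose W := [seq z <- s0 | (x < z < x + l)%N].
have filter_sorted := sorted_filter ltn_trans.
have es0 : s0 = nu ++ x :: W ++ (x + l)%N :: T.
  apply: (irr_sorted_eq ltn_trans ltnn) => //.
    apply: sorted_glue; first exact: filter_sorted.
    - apply: sorted_glue; try exact: filter_sorted.
        by apply/allP => z; rewrite mem_filter => /andP[/andP[]].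
      by apply/allP => z; rewrite mem_filter => /andP[].
    - by apply/allP => z; rewrite mem_filter => /andP[].
    - rewrite all_cat /=; apply/and3P; split; last 1 first.
      + apply/allP => z; rewrite mem_filter => /andP[h _].
        by apply: leq_ltn_trans h; apply: leq_addr.
      + by apply/allP => z; rewrite mem_filter => /andP[/andP[]].
      + by move: l_gt0; clear; lia.
  move=> z; rewrite !(mem_cat, inE, mem_filter) hmem.
  have : (z \in p) ==> (z < x + l)%N by apply/implyP => /(allP pxl).
  have : (z \in q) ==> (x < z)%N by apply/implyP => /(allP xq).
  by move: (z \in p) (z \in q) l_gt0; clear; lia.
have hf a b : a \in W -> b \in W -> a != b -> far (res a) (res b).
  rewrite !mem_filter => /andP[ha _] /andP[hb _] ab.
  case: (ltngtP a b) ab => // h _; last rewrite farC; apply: res_far; move: ha hb h;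
    clear; lia.
have pW : perm_eq (W1 ++ W2) W.
  apply: uniq_perm; last 1 first.
  - move=> z; rewrite mem_cat !mem_filter hmem.
    have : (z \in p) ==> (z < x + l)%N by apply/implyP => /(allP pxl).
    have : (z \in q) ==> (x < z)%N by apply/implyP => /(allP xq).
    by move: (z \in p) (z \in q) l_gt0; clear; lia.
  - apply: (subseq_uniq (s2 := p ++ [:: (x + l)%N, x & q])) => //.
    apply: cat_subseq; first exact: filter_subseq.
    apply: subseq_trans (filter_subseq _ _) _.
    by rewrite -[X in subseq _ X](cat1s) -[x :: q]cat1s catA; apply: suffix_subseq.
  - by rewrite filter_uniq // uniq_s0.
have szt : size (R (p ++ [:: (x + l)%N, x & q])) = n.
  by rewrite size_map (perm_size pt).
have e1 : R (p ++ [:: (x + l)%N, x & q]) =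
    R nu ++ R W1 ++ res (x + l)%N :: res x :: R W2 ++ R T.
  by rewrite !map_cat /= {1}ep {1}eq !map_cat -catA.
have hfW1 : all (far (res (x + l)%N)) (R W1).
  rewrite all_map; apply/allP => z; rewrite mem_filter /= => /andP[h1 h2].
  rewrite farC; apply: res_far; have := allP pxl z h2; move: h1; clear; lia.
have hfW2 : all (far (res x)) (R W2).
  rewrite all_map; apply/allP => z; rewrite mem_filter /= => /andP[h1 h2].
  apply: res_far; have := allP xq z h2; move: h1; clear; lia.
rewrite e1 in szt *; apply: ideal_factors (factors_movel L szt hfW1) _.
have cj2 := factors_mover L (s := rcons (R nu) (res (x + l)%N) ++ R W1) (t := R T) _ hfW2.
rewrite !cat_rcons -!catA /= in cj2; apply: ideal_factors (cj2 _) _.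
  by rewrite -szt; size_lia.
have uW12 : uniq (W1 ++ W2) by rewrite (perm_uniq pW) filter_uniq // uniq_s0.
have cj3 := factors_perm (s := rcons (R nu) (res (x + l)%N)) (t := res x :: R T) pW uW12.
rewrite !cat_rcons map_cat -catA in cj3; apply: ideal_factors (cj3 _ _) _.
- by move=> a b; rewrite !(perm_mem pW); apply: hf.
- by rewrite -szt; size_lia.
have HA s : diag l s -> (size s < size s0)%N -> good_add n l res sc psi y ee s.
  by move=> ds _; case: (good_all sc_central L l_gt0 res_below res_far two_neq0 X_below ds).
have := place_swapped_lt (t := [::]) (N := size s0) l_gt0 res_below res_far two_neq0 HA.
move/(_ nu x W T); rewrite -es0 cats0 res_below addn0; apply=> //.
Qed.
(** A reduced word of [state u] can be chosen to end with the exchange that creates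
    a given descent. *)
Lemma low_descent u t1 a b t2 : valid u -> reduced u ->
  state u = t1 ++ [:: a, b & t2] -> (b < a)%N ->
  (forall w, valid w -> reduced w -> (size w < size u)%N ->
     state w = t1 ++ [:: b, a & t2] -> low (size w) (Psi w)) ->
  low (size u) (Psi u).
Proof.
move=> vu ru eu ba hw.
have px : perm_eq (t1 ++ [:: b, a & t2]) s0.
  apply: perm_trans (perm_state u); rewrite eu -(swap_atE t1 a b).
  exact: perm_swap_at.
have [w [vw rw ew]] := reduced_exists px.
have rwk := rcons_reduced rw ew erefl ba.
have swk : state (rcons w (size t1)) = state u by rewrite state_rcons ew swap_atE.
have hk : ((size t1).+1 < n)%N by rewrite -(size_state w) ew; size_lia.
have vwk : valid (rcons w (size t1)) by rewrite valid_rcons hk vw.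
have szw := size_reduced rwk ru swk.
have h := matsumoto vu vwk erefl ru szw (esym swk).
rewrite -[Psi u](subrK (Psi (rcons w (size t1)))); apply: low_add => //.
rewrite -szw size_rcons Psi_rcons; apply: low_psi => //; apply: hw => //.
by rewrite -szw size_rcons.
Qed.

Lemma unsorted_descent t : uniq t -> ~~ sorted ltn t ->
  exists t1 a b t2, t = t1 ++ [:: a, b & t2] /\ (b < a)%N.
Proof.
move=> ut us; apply: descent; rewrite lt0n; apply: contra us => /eqP it.
exact: inv_sorted.
Qed.

(** As long as there is a descent other than one between [x + l] and [x] themselves,
    it is undone, which keeps [x + l] before [x].  When none is left, [x + l] and [x]
    are adjacent and [swapped_higher] applies. *)
Lemma low_nonstd u : valid u -> reduced u -> nonstd (state u) -> low (size u) (Psi u).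
Proof.
move: {2}(size u).+1 (ltnSn (size u)) => N; elim: N u => // N IH u uN vu ru.
move=> [x [p [q [eu xq]]]]; have ut := uniq_state u; rewrite eu in ut.
have {}IH w : valid w -> reduced w -> (size w < size u)%N -> nonstd (state w) ->
    low (size w) (Psi w).
  by move=> vw rw sw; apply: IH => //; apply: leq_trans sw _.
case: (boolP (sorted ltn (rcons p (x + l)%N))) => sp; last first.
  have [|t1 [a [b [t2 [et ba]]]]] := unsorted_descent _ sp.
    by move: ut; rewrite -cat_rcons cat_uniq => /and3P[].
  have eu' : state u = t1 ++ [:: a, b & t2 ++ q] by rewrite eu -cat_rcons et -catA.
  apply: (low_descent vu ru eu' ba) => w vw rw sw ew; apply: IH => //.
  have [P [Q eP]] : exists P Q : seq nat, t1 ++ [:: b, a & t2] = P ++ (x + l)%N :: Q.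
    have : (x + l)%N \in rcons p (x + l)%N by rewrite mem_rcons inE eqxx.
    rewrite et -(perm_mem (perm_swap_at (size t1) _)) swap_atE.
    by case/splitPr => P Q; exists P, Q.
  exists x, P, (Q ++ q); rewrite ew mem_cat xq orbT; split=> //.
  by rewrite -[t1 ++ _]/(t1 ++ [:: b, a & t2] ++ q) catA eP -catA.
case: (boolP (sorted ltn q)) => sq; last first.
  have [|t1 [a [b [t2 [et ba]]]]] := unsorted_descent _ sq.
    by move: ut; rewrite -cat_rcons cat_uniq => /and3P[].
  have eu' : state u = (p ++ (x + l)%N :: t1) ++ [:: a, b & t2] by rewrite eu et -catA.
  apply: (low_descent vu ru eu' ba) => w vw rw sw ew; apply: IH => //.
  exists x, p, (t1 ++ [:: b, a & t2]); rewrite ew -catA; split=> //.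
  by move: xq; rewrite et -(perm_mem (perm_swap_at (size t1) _)) swap_atE.
case: q xq sq eu ut => // y0 q xq sq eu ut.
have [_ /allP yq _ _] := @sorted_split [::] y0 q sq.
case: (x =P y0) => [ex|/eqP nx].
  subst y0; apply: low_J; rewrite -(Psi_left vu); apply: ideal_mulr; first exact: gen_Psi.
  by rewrite eu; apply: swapped_higher => //; rewrite -eu perm_state.
have yx : (y0 < x)%N by move: xq; rewrite inE (negPf nx) => /yq.
apply: (low_descent vu ru eu); first by apply: leq_trans yx (leq_addr _ _).
move=> w vw rw sw ew; apply: IH => //.
exists x, (rcons p y0), q; rewrite ew cat_rcons; split=> //.
by move: xq; rewrite inE (negPf nx).
Qed.

Section CellSpan.
Variable Ch : seq nat -> Prop.
Hypothesis Ch_ok : forall t, perm_eq t s0 -> ~ nonstd t ->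
  exists u, [/\ Ch u, valid u, reduced u & state u = t].

Inductive cell_span : A -> Prop :=
| cs_J x : J x -> cell_span x
| cs_ch u : Ch u -> cell_span (Psi u)
| cs_sc c x : cell_span x -> cell_span (sc c * x)
| cs_add x z : cell_span x -> cell_span z -> cell_span (x + z).

Lemma low_cell_span N x : low N x -> cell_span x.
Proof.
elim: N x => [|N IH] x; elim=> {x} [x Jx|u hu hs|c x _ h|x z _ h1 _ h2] //;
  try exact: cs_J; try exact: cs_sc; try exact: cs_add.
have {}IH y' : low (size u) y' -> cell_span y' by move=> h; apply: IH; apply: lowW h.
case: (boolP (reduced u)) => [ru|nu]; last by apply: IH; apply: low_nonreduced.
case: (pselect (nonstd (state u))) => st; first by apply: IH; apply: low_nonstd.
have [v [cv vv rv ev]] := Ch_ok (perm_state u) st.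
rewrite -[Psi u](subrK (Psi v)); apply: cs_add; last exact: cs_ch.
apply: IH; apply: matsumoto => //.
by apply: size_reduced.
Qed.

Lemma low_gen a : gen_alg a -> forall N x, low N x -> exists M, low M (a * x).
Proof.
elim=> {a} [k hk|k hk|s hs|c|a b _ ha _ hb|a b _ ha _ hb] N x hx.
- by exists N.+1; apply: low_psi.
- by exists N; apply: low_y.
- by exists N; apply: low_ee.
- by exists N; apply: low_sc.
- have [M1 h1] := ha _ _ hx; have [M2 h2] := hb _ _ hx.
  exists (maxn M1 M2); rewrite mulrDl; apply: low_add.
    by apply: lowW h1; apply: leq_maxl.
  by apply: lowW h2; apply: leq_maxr.
- have [M1 h1] := hb _ _ hx; have [M2 h2] := ha _ _ h1.
  by exists M2; rewrite -mulrA.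
Qed.

Lemma gen_cell_span a u : gen_alg a -> valid u -> cell_span (a * Psi u).
Proof.
move=> ha vu; have h0 : low (size u).+1 (Psi u) by apply: low_Psi.
have [M hM] := low_gen ha h0; exact: low_cell_span hM.
Qed.
End CellSpan.
End Straightening.

(** * The right-hand version and the spanning theorem *)
Section Opposite.
Variables (O : comPzRingType) (A : pzRingType) (sc : {rmorphism O -> A}).

Definition sc_op : O -> A^c := sc.
Lemma sc_op_additive : zmod_morphism sc_op.
Proof. by move=> a b; rewrite /sc_op raddfB. Qed.
HB.instance Definition _ := GRing.isZmodMorphism.Build O A^c sc_op sc_op_additive.
Lemma sc_op_multiplicative : monoid_morphism sc_op.
Proof.
split; first by rewrite /sc_op rmorph1.
by move=> a b; rewrite mulrC /sc_op rmorphM.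
Qed.
HB.instance Definition _ := GRing.isMonoidMorphism.Build O A^c sc_op sc_op_multiplicative.

Variables (I : nzRingType) (n l : nat) (res : nat -> I).
Variables (psi y : nat -> A) (ee : seq I -> A) (X : nat -> O).
Hypothesis sc_central : forall c x, sc c * x = x * sc c.
Hypothesis L : klr_laws n l res psi y ee (fun m => sc (X m)).

(** The relations are invariant under reversing products, so that all results on
    left multiplication give results on right multiplication. *)
Lemma klr_laws_op :
  klr_laws (A := A^c) n l res psi y ee (fun m => (sc_op (X m) : A^c)).
Proof.
have flip (s : seq I) a b t : size (s ++ [:: a, b & t]) = n -> size (s ++ [:: b, a & t]) = n.
  by rewrite !size_cat.
have ebp s a b t : size (s ++ [:: a, b & t]) = n ->
    ee (s ++ [:: a, b & t]) * psi (size s) = psi (size s) * ee (s ++ [:: b, a & t]).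
  by move=> h; rewrite -(law_psie L (flip _ _ _ _ h)).
have kn (s : seq I) a b t : size (s ++ [:: a, b & t]) = n -> ((size s).+1 < n)%N.
  by move=> <-; size_lia.
have epp s a b t : size (s ++ [:: a, b & t]) = n ->
    ee (s ++ [:: a, b & t]) * (psi (size s) * psi (size s)) =
    psi (size s) * psi (size s) * ee (s ++ [:: a, b & t]).
  move=> h; rewrite mulrA ebp // -!mulrA; congr (_ * _).
  by rewrite ebp // (flip _ _ _ _ h).
split.
- exact: law_idem L.
- move=> s t hs ht st; exact: (law_orth L ht hs (fun e => st (esym e))).
- exact: law_one L.
- exact: law_first L.
- exact: law_second L.
- move=> m s hs hm; rewrite -[RHS]/(ee (res m :: s) * sc (X m)) -sc_central.
  rewrite -(law_y0 L hs hm) -[LHS]/(ee (res m :: s) * y 0) -(law_ye L) //.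
  by rewrite -hs.
- by move=> k s hk hs; exact: (esym (law_ye L hk hs)).
- by move=> s a b t h; rewrite -[LHS]/(ee _ * psi _) ebp.
- by move=> k m h1 h2 h3 h4; exact: (esym (law_psiy L h1 h2 h3 h4)).
- by move=> k m h1 h2; exact: (esym (law_psipsi L h1 h2)).
- move=> s a b t h.
  rewrite -[LHS]/(ee _ * (y _ * psi _)) -[RHS]/(ee _ * (psi _ * y _ - _)).
  rewrite mulrA -(law_ye L) ?(kn _ _ _ _ h) // -mulrA ebp // mulrA.
  rewrite (law_yhipsi L (flip _ _ _ _ h)) mulrBr mulrA ebp // mulrBl -!mulrA.
  rewrite (law_ye L (ltnW (kn _ _ _ _ h)) (flip _ _ _ _ h)).
  rewrite [b == a]eq_sym; case: eqP => [->|_]; last by rewrite mul0r mulr0.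
  by rewrite mul1r mulr1.
- move=> s a b t h.
  rewrite -[LHS]/(ee _ * (psi _ * y _)) -[RHS]/(ee _ * (y _ * psi _ - _)).
  rewrite mulrA ebp // -mulrA -(law_ye L (kn _ _ _ _ h) (flip _ _ _ _ h)) mulrA.
  rewrite (law_psiyhi L (flip _ _ _ _ h)) mulrBr mulrA -(law_ye L) // ?(ltnW (kn _ _ _ _ h)) //.
  rewrite -[in RHS]mulrA ebp // mulrBl mulrA.
  rewrite [b == a]eq_sym; case: eqP => [->|_]; last by rewrite mul0r mulr0.
  by rewrite mul1r mulr1.
- move=> s a t h; rewrite -[LHS]/(ee _ * (psi _ * psi _)) epp //.
  by rewrite (law_sq_eq L h).
- move=> s a b t h hf; rewrite -[LHS]/(ee _ * (psi _ * psi _)) epp //.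
  by rewrite (law_sq_far L h hf).
- move=> s a t h; rewrite -[LHS]/(ee _ * (psi _ * psi _)) epp //.
  rewrite (law_sq_up L h) -[RHS]/(ee _ * (y _ - y _)) mulrBl mulrBr.
  by rewrite !(law_ye L) // ?(kn _ _ _ _ h) // ltnW // (kn _ _ _ _ h).
- move=> s a t h; rewrite -[LHS]/(ee _ * (psi _ * psi _)) epp //.
  rewrite (law_sq_down L h) -[RHS]/(ee _ * (y _ - y _)) mulrBl mulrBr.
  by rewrite !(law_ye L) // ?(kn _ _ _ _ h) // ltnW // (kn _ _ _ _ h).
- move=> s a b c t h.
  have hp a' b' c' : size (s ++ [:: a', b', c' & t]) = n by rewrite -h !size_cat.
  rewrite -[LHS]/(ee _ * (psi _ * (psi _ * psi _))).
  rewrite -[RHS]/(ee _ * (psi _ * (psi _ * psi _) + _)).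
  have ebp' a' b' c' : ee (s ++ [:: a', b', c' & t]) * psi (size s).+1 =
      psi (size s).+1 * ee (s ++ [:: a', c', b' & t]).
    have := @ebp (rcons s a') b' c' t; rewrite !cat_rcons size_rcons; apply.
    exact: hp.
  have ebp0 a' b' c' : ee (s ++ [:: a', b', c' & t]) * psi (size s) =
      psi (size s) * ee (s ++ [:: b', a', c' & t]) by apply: ebp; apply: hp.
  rewrite mulrDr.
  have e1 : ee (s ++ [:: a, b, c & t]) * (psi (size s) * (psi (size s).+1 * psi (size s))) =
      psi (size s) * psi (size s).+1 * psi (size s) * ee (s ++ [:: c, b, a & t]).
    by rewrite mulrA ebp0 -mulrA [ee _ * (_ * _)]mulrA ebp' -[_ * _ * psi _]mulrA ebp0 !mulrA.
  have e2 : ee (s ++ [:: a, b, c & t]) * (psi (size s).+1 * (psi (size s) * psi (size s).+1)) =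
      psi (size s).+1 * psi (size s) * psi (size s).+1 * ee (s ++ [:: c, b, a & t]).
    by rewrite mulrA ebp' -mulrA [ee _ * (_ * _)]mulrA ebp0 -[_ * _ * psi _]mulrA ebp' !mulrA.
  rewrite e1 e2 (law_braid L (hp _ _ _)) mulrDl; congr (_ + _).
  rewrite /braid_const [a == c]eq_sym; case: (c =P a) => [->|_] /=.
    by do 2?case: ifP => _; rewrite ?mulN1r ?mulrN1 ?mul1r ?mulr1 ?mul0r ?mulr0.
  by rewrite mul0r mulr0.
Qed.
End Opposite.

Section Spanning.
Variables (O : comPzRingType) (A : pzRingType) (sc : {rmorphism O -> A}).
Variables (I : nzRingType) (n l : nat) (res : nat -> I).
Variables (psi y : nat -> A) (ee : seq I -> A) (X : nat -> O).
Hypothesis sc_central : forall c x, sc c * x = x * sc c.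
Hypothesis L : klr_laws n l res psi y ee (fun m => sc (X m)).
Hypothesis l_gt0 : (0 < l)%N.
Hypothesis res_below : forall c, res (c + l) = res c - 1.
Hypothesis res_far : forall c d, (c < d < c + l)%N -> far (res c) (res d).
Hypothesis two_neq0 : 1 + 1 != 0 :> I.
Hypothesis X_below : forall c, X (c + l)%N = X c.

Local Notation gen_c := (gen_alg (A := A^c) n (sc_op sc) psi y ee).
Local Notation ideal_c := (ideal (A := A^c) n (sc_op sc) psi y ee).
Local Notation gen_alg := (gen_alg n sc psi y ee).
Local Notation ideal := (ideal n sc psi y ee).
Local Notation R := (map res).

Lemma sc_op_central c (x : A^c) : (sc_op sc c : A^c) * x = x * sc_op sc c.
Proof. exact: (esym (sc_central c x)). Qed.

Let Lop := klr_laws_op sc_central L.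

Lemma gen_alg_op x : gen_c x -> gen_alg x.
Proof.
elim=> {x}.
- exact: B_psi.
- exact: B_y.
- exact: B_ee.
- exact: (B_sc n sc psi y ee).
- by move=> a b _ ha _ hb; apply: B_add.
- by move=> a b _ ha _ hb; apply: (B_mul hb ha).
Qed.
Lemma gen_alg_to_op x : gen_alg x -> gen_c x.
Proof.
elim=> {x}.
- exact: B_psi.
- exact: B_y.
- exact: B_ee.
- exact: (B_sc (A := A^c) n (sc_op sc) psi y ee).
- by move=> a b _ ha _ hb; apply: (B_add (A := A^c)).
- by move=> a b _ ha _ hb; apply: (B_mul (A := A^c) hb ha).
Qed.
Lemma ideal_op S x : ideal_c S x -> ideal S x.
Proof.
elim=> {x} [a s b /gen_alg_op ha /gen_alg_op hb hs Ss||x z _ hx _ hz].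
- by change (ideal S ((b : A) * (ee s * (a : A)))); rewrite mulrA; apply: ideal_gen.
- exact: ideal_zero.
- exact: ideal_add.
Qed.

Definition left_word s u := Psi res psi ee s u.
Definition right_word s u : A := Psi (A := A^c) res psi ee s u.

Lemma left_wordE s u : left_word s u = \prod_(k <- rev u) psi k * ee (R s).
Proof.
elim/last_ind: u => [|u k IH]; first by rewrite big_nil mul1r.
by rewrite /left_word Psi_rcons rev_rcons big_cons -mulrA -IH.
Qed.
Lemma right_wordE s u : right_word s u = ee (R s) * \prod_(k <- u) psi k.
Proof.
elim/last_ind: u => [|u k IH]; first by rewrite big_nil mulr1.
have -> : right_word s (rcons u k) = right_word s u * psi k.
  by rewrite /right_word /Psi foldl_rcons.
by rewrite IH -cats1 big_cat big_seq1 mulrA.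
Qed.

Variable Ch : seq nat -> seq nat -> Prop.
Hypothesis Ch_ok : forall s t, diag l s -> size s = n -> perm_eq t s -> ~ nonstd l t ->
  exists u, [/\ Ch s u, valid n u, reduced s u & state s u = t].
Hypothesis Ch_valid : forall s u, Ch s u -> valid n u.

Inductive cells (D : seq nat -> Prop) : A -> Prop :=
| cells_gen s u v : diag l s -> size s = n -> D s -> Ch s u -> Ch s v ->
    cells D (left_word s u * right_word s v)
| cells_zero : cells D 0
| cells_sc c x : cells D x -> cells D (sc c * x)
| cells_add x z : cells D x -> cells D z -> cells D (x + z).

Lemma cellsW (D D' : seq nat -> Prop) x : (forall s, D s -> D' s) ->
  cells D x -> cells D' x.
Proof.
move=> h; elim=> {x} *; [apply: cells_gen|apply: cells_zero|apply: cells_sc|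
  apply: cells_add] => //; exact: h.
Qed.

Definition left_span s := cell_span n l res sc psi y ee s (Ch s).
Definition right_span s (x : A) :=
  cell_span (A := A^c) n l res (sc_op sc) psi y ee s (Ch s) x.

Lemma gen_left_span s a u : diag l s -> size s = n -> gen_alg a -> valid n u ->
  left_span s (a * left_word s u).
Proof.
move=> ds hs ga vu; apply: (gen_cell_span sc_central L) => //.
by move=> t; apply: Ch_ok.
Qed.
Lemma gen_right_span s a v : diag l s -> size s = n -> gen_alg a -> valid n v ->
  right_span s (right_word s v * a).
Proof.
move=> ds hs ga vv; change (right_span s ((a : A^c) * (right_word s v : A^c))).
apply: (gen_cell_span sc_op_central Lop) => //; last exact: gen_alg_to_op.
by move=> t; apply: Ch_ok.
Qed.

Lemma right_word_gen s v : size s = n -> valid n v -> gen_alg (right_word s v).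
Proof.
by move=> hs vv; apply: gen_alg_op; apply: gen_Psi.
Qed.
Lemma right_span_gen s x : size s = n -> right_span s x -> gen_alg x.
Proof.
move=> hs; elim=> {x} [x /ideal_op Jx|v /Ch_valid cv|c x _ h|x z _ h1 _ h2].
- exact: ideal_gen_alg Jx.
- exact: right_word_gen.
- by change (gen_alg ((x : A) * sc c)); apply: B_mul => //; apply: B_sc.
- exact: B_add.
Qed.

Lemma span_prod (D : seq nat -> Prop) s x z : diag l s -> size s = n -> D s ->
  (forall w, ideal (sabove l res s [::]) w -> cells D w) ->
  left_span s x -> right_span s z -> cells D (x * z).
Proof.
move=> ds hs Ds hJ hx hz; have gz := right_span_gen hs hz.
elim: hx => {x} [x Jx|u cu|c x _ h|x x' _ h1 _ h2].
- by apply: hJ; apply: ideal_mulr.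
- have gu : gen_alg (left_word s u) by apply: gen_Psi => //; apply: Ch_valid cu.
  elim: hz {gz} => {z} [z /ideal_op Jz|v cv|c z _ h|z z' _ h1 _ h2].
  + by apply: hJ; apply: ideal_mull.
  + exact: cells_gen.
  + change (cells D (left_word s u * ((z : A) * sc c))).
    by rewrite mulrA -sc_central; apply: cells_sc.
  + by rewrite mulrDr; apply: cells_add.
- by rewrite -mulrA; apply: cells_sc.
- by rewrite mulrDl; apply: cells_add.
Qed.

Lemma ee_prod (D : seq nat -> Prop) s a b : diag l s -> size s = n -> D s ->
  (forall w, ideal (sabove l res s [::]) w -> cells D w) ->
  gen_alg a -> gen_alg b -> cells D (a * ee (R s) * b).
Proof.
move=> ds hs Ds hJ ga gb.
have -> : a * ee (R s) * b = (a * left_word s [::]) * (right_word s [::] * b).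
  by rewrite -!mulrA [ee _ * (ee _ * b)]mulrA (law_idem L) // size_map.
apply: (span_prod ds hs) => //; first exact: gen_left_span.
exact: gen_right_span.
Qed.

(** By induction along dominance: the products attached to the idempotent of a
    larger diagram are cells of that diagram, up to the ideal of still larger
    ones. *)
Lemma ideal_cells s x : diag l s -> size s = n -> ideal (sabove l res s [::]) x ->
  cells (domlt s) x.
Proof.
move: {2}(sumn s).+1 (ltnSn (sumn s)) => N; elim: N s x => // N IH s x sN ds hs.
elim=> {x} [a i b ga gb _ [s' [ds' dm ->]]||x z _ h1 _ h2]; last 2 first.
- exact: cells_zero.
- exact: cells_add.
have hs' : size s' = n by case: dm => -[<-].
rewrite cats0; apply: ee_prod => // w hw.
apply: (@cellsW (domlt s')); first by move=> u; apply: dom_sdom_trans (sdomW dm).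
by apply: IH => //; apply: leq_trans (sdom_sumn dm) _.
Qed.

(** Starting from the empty diagram, each residue is placed with a bound so large
    that no node can exceed it. *)
Lemma ee_any i : size i = n ->
  ideal (fun i' => exists s, [/\ diag l s, size s = n & i' = R s]) (ee i).
Proof.
move=> hi.
have HA s : diag l s -> (size s < n)%N -> good_add n l res sc psi y ee s.
  by move=> ds _; case: (good_all sc_central L l_gt0 res_below res_far two_neq0 X_below ds).
have aux (i' : seq I) d : exists sl, map snd sl = i' /\ placeable l res d sl.
  elim: i' d => [|j i' IH] d; first by exists [::].
  have [sl [h1 h2]] := IH (d + l).+1; exists ((d + l, j)%N :: sl) => /=.
  rewrite h1 (_ : maxn _ _ = (d + l).+1); last by clear; lia.
  split=> //; split=> //; split=> [|a ad _]; [|move: ad]; clear; lia.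
have [sl [hsl pl]] := aux i l.
have d0 : diag l [::] by [].
have szl : size sl = n by rewrite -hi -hsl size_map.
have := place l_gt0 two_neq0 HA d0 (leqnn l) (isT : all _ [::]) pl (t := [::]).
rewrite /= addn0 add0n szl !cats0 hsl => /(_ (leqnn _) erefl).
apply: ideal_sub_set => _ [s [ds dm ->]]; exists s; rewrite cats0; split=> //.
by case: dm => <- _; rewrite size_map.
Qed.

Theorem gen_cells x : gen_alg x -> cells (fun=> True) x.
Proof.
move=> gx; have [ss hss e1] := law_one L.
rewrite -[x]mulr1 e1 mulr_sumr {e1}; elim: ss hss => [|i ss IH] /=.
  by rewrite big_nil => _; apply: cells_zero.
case/andP=> /eqP hi /IH h; rewrite big_cons; apply: cells_add => //.
elim: (ideal_mull gx (ee_any hi)) => {h} [a j b ga gb hj [s [ds hs ->]]||z w _ h1 _ h2].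
- apply: ee_prod => // w hw; apply: (@cellsW (domlt s)) => //.
  exact: ideal_cells.
- exact: cells_zero.
- exact: cells_add.
Qed.
End Spanning.

(** * Multipartitions, tableaux and reduced expressions as lists *)
Section Codes.
Local Open Scope nat_scope.
Variables (l n : nat).
Hypothesis l_gt0 : 0 < l.
Implicit Types lam mu : par1 l n.

Definition comp_of (c : nat) : 'I_l := Ordinal (ltn_pmod c l_gt0).
Definition code (x : node l) : nat := x.1 * l + x.2.
Definition bcode (g : box l n) : nat := code (box_node g).

Lemma code_div x : code x %/ l = x.1.
Proof. by rewrite /code divnMDl // divn_small // addn0. Qed.
Lemma code_mod x : comp_of (code x) = x.2.
Proof. by apply: val_inj; rewrite /= /code modnMDl modn_small. Qed.
Lemma codeK c : code (c %/ l, comp_of c) = c.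
Proof. by rewrite /code /= -divn_eq. Qed.

Lemma code_lt x y : node_lt x y = (code y < code x).
Proof.
rewrite /node_lt /code; case: x y => [r i] [r' j] /=.
have hi := ltn_ord i; have hj := ltn_ord j.
case: (ltngtP r' r) => [h|h|->] /=; last by rewrite ltn_add2l.
- apply/esym; apply: (@leq_trans (r'.+1 * l)); first by rewrite mulSn; move: hj; clear; lia.
  by apply: leq_trans (leq_addr _ _); rewrite leq_mul2r h orbT.
- apply/esym/negbTE; rewrite -leqNgt; apply: (@leq_trans (r.+1 * l)).
    by rewrite mulSn; move: hi; clear; lia.
  by apply: leq_trans (leq_addr _ _); rewrite leq_mul2r h orbT.
Qed.

Lemma bcode_inj : injective bcode.
Proof.
move=> [r i] [r' j] h; have h1 := code_div (box_node (r, i)).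
have h2 := code_mod (box_node (r, i)).
rewrite -/(bcode _) h code_div in h1; rewrite -/(bcode _) h code_mod in h2.
by move: h1 h2 => /= /ord_inj -> ->.
Qed.

Definition dseq (lam : par1 l n) : seq nat := map bcode (diagram_seq lam).

Lemma size_dseq lam : size (dseq lam) = n.
Proof. by rewrite size_map; apply/eqP/size_diagram_seq. Qed.

Lemma mem_dseq lam (g : box l n) : (bcode g \in dseq lam) = (g \in diagram lam).
Proof. by rewrite mem_map; [rewrite mem_sort mem_enum | apply: bcode_inj]. Qed.

Lemma sorted_dseq lam : sorted ltn (dseq lam).
Proof.
have us : uniq (dseq lam).
  by rewrite map_inj_uniq ?sort_uniq ?enum_uniq //; apply: bcode_inj.
rewrite ltn_sorted_uniq_leq us /= /dseq sorted_map.
have := sort_sorted (@node_ge_total l n) (enum (diagram lam)).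
apply: sub_sorted => x y /=; rewrite /node_ge code_lt /bcode -leqNgt; exact.
Qed.

Lemma dseqP lam c : reflect (exists2 g : box l n, g \in diagram lam & c = bcode g)
  (c \in dseq lam).
Proof.
apply: (iffP mapP) => -[g hg ->]; exists g => //.
  by move: hg; rewrite mem_sort mem_enum.
by rewrite mem_sort mem_enum.
Qed.

Lemma diag_dseq lam : diag l (dseq lam).
Proof.
split; first exact: sorted_dseq.
move=> _ /dseqP [[r i] hg ->]; have hi := ltn_ord i.
move: hg; rewrite inE /= => /andP[r1 rl].
rewrite /bcode /code /=; split; first by apply: leq_trans (leq_addr _ _); rewrite leq_pmull.
move=> h; have r2 : 1 < r.
  rewrite ltnNge; apply/negP => rle.
  have r1' : r = 1 :> nat by move: r1 rle; clear; lia.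
  by move: h; rewrite r1' mul1n leq_add2l leqNgt hi.
have hr : r.-1 < n.+1 by apply: leq_ltn_trans (leq_pred _) (ltn_ord r).
have -> : r * l + i - l = bcode (Ordinal hr, i).
  have e : r * l = l + r.-1 * l by rewrite -mulSn prednK.
  by rewrite /bcode /code /= e -addnA addKn.
rewrite mem_dseq inE /=; move: r2 rl; clear; lia.
Qed.

Lemma count_dseq lam b : cnt b (dseq lam) =
  #|[set g in diagram lam | node_lt (b %/ l, comp_of b) (box_node g)]|.
Proof.
rewrite /cnt /dseq count_map cardE /diagram_seq.
rewrite (eq_count (a2 := fun g => node_lt (b %/ l, comp_of b) (box_node g))); last first.
  by move=> g /=; rewrite code_lt codeK.
have -> : count (fun g => node_lt (b %/ l, comp_of b) (box_node g))
    (sort (@node_ge l n) (enum (diagram lam))) =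
   count (fun g => node_lt (b %/ l, comp_of b) (box_node g)) (enum (diagram lam)).
  by apply/seq.permP; rewrite perm_sort.
rewrite -size_filter; apply: perm_size; apply: uniq_perm.
- by rewrite filter_uniq // enum_uniq.
- exact: enum_uniq.
- by move=> g; rewrite mem_filter !mem_enum [RHS]in_set andbC.
Qed.

Lemma dom_nodes_dom (lam mu : par1 l n) :
  domle (dseq lam) (dseq mu) -> nodes_dom (diagram lam) (diagram mu).
Proof.
move=> [_ h] g0; have := h (code g0); rewrite !count_dseq.
by rewrite code_div code_mod; case: g0.
Qed.

Lemma dseq_inj : injective dseq.
Proof.
by move=> lam mu e; apply: nodes_dom_anti; apply: dom_nodes_dom; rewrite e.
Qed.

Lemma domlt_par1 (lam mu : par1 l n) : domlt (dseq lam) (dseq mu) -> (lam < mu)%O.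
Proof.
move=> h; rewrite Order.POrderTheory.lt_def; apply/andP; split.
  by apply/eqP => e; have := sdom_sumn h; rewrite e ltnn.
by apply/asboolP/dom_nodes_dom/sdomW.
Qed.

(** To be applied to the rows of the nodes of one column. *)
Lemma initial_segment (u : seq nat) r : uniq u ->
  (forall x, x \in u -> 0 < x /\ (1 < x -> x.-1 \in u)) ->
  (r \in u) = (0 < r <= size u).
Proof.
move=> uu hu; have down x k : k < x -> x \in u -> x - k \in u.
  elim: k => [|k IH] kx xu; first by rewrite subn0.
  have /hu[_] := IH (ltnW kx) xu; rewrite subnS; apply; move: kx; clear; lia.
apply/idP/idP => [ru|/andP[r0 rs]].
  rewrite (hu r ru).1 -[X in X <= _](size_iota 1 r) uniq_leq_size ?iota_uniq //.
  move=> x; rewrite mem_iota => hx.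
  have -> : x = r - (r - x) by move: hx; clear; lia.
  by apply: down => //; move: hx; clear; lia.
apply: contraLR rs => nr; rewrite -ltnNge.
suff : size u <= size (iota 1 r.-1) by rewrite size_iota; move: r0; clear; lia.
apply: uniq_leq_size => // x xu; rewrite mem_iota (hu x xu).1 /= add1n prednK //.
rewrite ltnNge; apply: contra nr => rx.
have -> : r = x - (x - r) by move: rx; clear; lia.
by apply: down => //; move: rx r0; clear; lia.
Qed.

Lemma dseq_exists s : diag l s -> size s = n -> exists lam, dseq lam = s.
Proof.
move=> [ss hs] sz.
have us : uniq s by apply: sorted_uniq ss; [apply: ltn_trans | apply: ltnn].
pose a (m : 'I_l) := count (fun c => comp_of c == m) s.
have an m : a m < n.+1 by rewrite ltnS -sz count_size.
have suma : \sum_(m < l) a m = n.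
  rewrite (eq_bigr (fun m => \sum_(c <- s) (comp_of c == m))); last first.
    move=> m _; rewrite /a -sum1_count big_mkcond /=.
    by apply: eq_bigr => c _; case: eqP.
  rewrite -sz -sum1_size exchange_big /=; apply: eq_bigr => c _.
  rewrite (bigD1 (comp_of c)) //= eqxx big1 // => m.
  by rewrite eq_sym => /negbTE ->.
have hlam : (\sum_(m < l) [ffun m => Ordinal (an m)] m == n)%N.
  by apply/eqP; rewrite -[RHS]suma; apply: eq_bigr => m _; rewrite ffunE.
pose lam : par1 l n := exist (fun a : {ffun 'I_l -> 'I_n.+1} => \sum_(m < l) a m == n)
  [ffun m => Ordinal (an m)] hlam.
have col c : (c \in s) = (0 < c %/ l <= a (comp_of c)).
  pose u := [seq c' %/ l | c' <- [seq c' <- s | comp_of c' == comp_of c]].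
  have divE c1 c2 : comp_of c1 = comp_of c2 -> c1 %/ l = c2 %/ l -> c1 = c2.
    by move=> h1 h2; rewrite -(codeK c1) -(codeK c2) h1 h2.
  have uu : uniq u.
    rewrite map_inj_in_uniq ?filter_uniq // => c1 c2.
    rewrite !mem_filter => /andP[/eqP h1 _] /andP[/eqP h2 _]; apply: divE.
    by rewrite h1 h2.
  have -> : a (comp_of c) = size u by rewrite size_map size_filter.
  rewrite -initial_segment //.
    apply/idP/mapP => [cs|[c']]; first by exists c; rewrite // mem_filter eqxx.
    by rewrite mem_filter => /andP[/eqP h1 h2] h3; rewrite (@divE c c').
  move=> x /mapP [c']; rewrite mem_filter => /andP[/eqP h1 h2] ->.
  have [h3 h4] := hs c' h2; split; first by rewrite divn_gt0.
  move=> h5; have h6 : l + l <= c'.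
    by rewrite -(codeK c') /code; apply: leq_trans (leq_addr _ _);
       rewrite addnn -mul2n leq_mul2r h5 orbT.
  apply/mapP; exists (c' - l).
    rewrite mem_filter h4 // andbT -h1; apply/eqP/val_inj => /=.
    by rewrite -[in RHS](subnK h3) modnDr.
  by rewrite -[in LHS](subnK h3) divnDr // divnn l_gt0 addn1.
exists lam; apply: (irr_sorted_eq ltn_trans ltnn) => //; first exact: sorted_dseq.
move=> c; rewrite col; apply/dseqP/idP => [[g hg ->]|h].
  move: hg; rewrite inE /= ffunE /=.
  by rewrite /bcode code_div code_mod.
have hc : c %/ l < n.+1.
  case/andP: h => _ h; apply: leq_ltn_trans h _; exact: an.
exists (Ordinal hc, comp_of c); last by rewrite /bcode codeK.
by rewrite inE /= ffunE.
Qed.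
Lemma size_swap_at (T : Type) k (t : seq T) : size (swap_at k t) = size t.
Proof. by elim: k t => [|k IH] [|a [|b t]] //=; rewrite IH. Qed.

Lemma nth_swap_at (T : Type) (x : T) k t i : k.+1 < size t ->
  nth x (swap_at k t) i =
  nth x t (if i == k then k.+1 else if i == k.+1 then k else i).
Proof.
elim: k t i => [|k IH] [|a t] i //=; first by case: t => //= b t _; case: i => [|[]].
by rewrite ltnS => /IH {}IH; case: i => // i; rewrite /= IH !eqSS; do 2?case: ifP.
Qed.

Lemma swap_at_enum (T : Type) (f : 'I_n -> T) (r : 'I_n.-1) :
  swap_at r [seq f k | k <- enum 'I_n] = [seq f (strans r k) | k <- enum 'I_n].
Proof.
case: n f r => [|m] f r; first by case: r.
have szE (g : 'I_m.+1 -> T) : size [seq g k | k <- enum 'I_m.+1] = m.+1.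
  by rewrite size_map size_enum_ord.
have hr : r.+1 < m.+1 by have := ltn_ord r; clear; lia.
have ne (g : 'I_m.+1 -> T) (k : 'I_m.+1) :
    nth (g ord0) [seq g k | k <- enum 'I_m.+1] k = g k.
  by rewrite (nth_map ord0) ?size_enum_ord // nth_ord_enum.
apply: (@eq_from_nth _ (f ord0)).
  by rewrite size_swap_at !szE.
move=> i lti; have {}lti : i < m.+1 by rewrite size_swap_at szE in lti.
rewrite nth_swap_at ?szE //.
have := ne (fun k => f (strans r k)) (Ordinal lti).
rewrite (set_nth_default (f ord0)) ?szE // => /= ->.
rewrite /strans; case: (i =P r) => [ir|nr].
  have -> : Ordinal lti = lo r by apply: val_inj.
  by rewrite tpermL -(ne f (hi r)).
case: (i =P r.+1) => [ir|nr'].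
  have -> : Ordinal lti = hi r by apply: val_inj.
  by rewrite tpermR -(ne f (lo r)).
rewrite tpermD; first by rewrite -(ne f (Ordinal lti)).
  by apply/eqP => /(congr1 val) /= e; apply: nr.
by apply/eqP => /(congr1 val) /= e; apply: nr'.
Qed.

Definition tseq lam (t : tab lam) : seq nat := [seq bcode (t k) | k <- enum 'I_n].

Lemma dseqE (lam : par1 l n) : dseq lam = tseq (tlam lam).
Proof.
rewrite /dseq /tseq -[diagram_seq lam]/(tval (Tuple (size_diagram_seq lam))).
rewrite -[tval _]map_tnth_enum -map_comp.
by apply: eq_map => k; rewrite /= /tab_fun /= ffunE.
Qed.

Lemma state_word (lam : par1 l n) (u : seq 'I_n.-1) :
  state (dseq lam) (map val u) =
  [seq bcode (tlam lam (word_perm u k)) | k <- enum 'I_n].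
Proof.
elim/last_ind: u => [|u r IH].
  by rewrite /state /= dseqE; apply: eq_map => k; rewrite perm1.
rewrite map_rcons /state foldl_rcons -/(state _ _) IH swap_at_enum.
apply: eq_map => k; congr (bcode (tlam lam _)).
have -> : word_perm (rcons u r) = (strans r * word_perm u)%g.
  elim: u {IH} => [|a u IH] /=; first by rewrite mul1g mulg1.
  by rewrite IH mulgA.
by rewrite permM.
Qed.
Lemma tab_inj lam (t : tab lam) : injective t.
Proof. by case/andP: (valP t) => /injectiveP. Qed.

Lemma tab_mem lam (t : tab lam) k : t k \in diagram lam.
Proof. by case/andP: (valP t) => _ /eqP <-; apply: imset_f. Qed.

Lemma uniq_tseq lam (t : tab lam) : uniq (tseq t).
Proof.
by rewrite map_inj_uniq ?enum_uniq // => i j /(@bcode_inj) /tab_inj.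
Qed.

Lemma perm_tseq lam (t : tab lam) : perm_eq (tseq t) (dseq lam).
Proof.
apply: uniq_perm; first exact: uniq_tseq.
  by apply: sorted_uniq (sorted_dseq lam); [apply: ltn_trans | apply: ltnn].
move=> c; apply/mapP/dseqP => -[]; first by move=> k _ ->; exists (t k); rewrite ?tab_mem.
move=> g + ->; case/andP: (valP t) => _ /eqP {1}<- /imsetP [k _ ->].
by exists k; rewrite // mem_enum.
Qed.

Lemma size_tseq lam (t : tab lam) : size (tseq t) = n.
Proof. by rewrite size_map size_enum_ord. Qed.

Lemma nth_tseq lam (t : tab lam) (k : 'I_n) : nth 0 (tseq t) k = bcode (t k).
Proof. by rewrite (nth_map k) ?size_enum_ord // nth_ord_enum. Qed.

Lemma bcode_below (g h : box l n) : bcode h = bcode g + l <->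
  h.2 = g.2 /\ h.1 = g.1.+1 :> nat.
Proof.
split=> [e|[e1 e2]]; last by rewrite /bcode /code /= e1 e2 mulSn; clear; lia.
have h1 : bcode h %/ l = h.1 := code_div (box_node h).
have g1 : bcode g %/ l = g.1 := code_div (box_node g).
have h2 : comp_of (bcode h) = h.2 := code_mod (box_node h).
have g2 : comp_of (bcode g) = g.2 := code_mod (box_node g).
rewrite -h2 -g2 -h1 -g1 e divnDr // divnn l_gt0 addn1; split=> //.
by apply: val_inj; rewrite /= modnDr.
Qed.

Lemma std_tseq lam (t : std lam) : ~ nonstd l (tseq (sval t)).
Proof.
move=> [x [p [q [e xq]]]]; set u := sval t in e.
have szp : size p < n.
  by rewrite -(size_tseq u) e size_cat /=; clear; lia.
have szj : size p + (index x q).+1 < n.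
  by rewrite -(size_tseq u) e size_cat /= ltn_add2l ltnS index_mem.
have ei : bcode (u (Ordinal szp)) = x + l.
  by rewrite -nth_tseq e nth_cat ltnn subnn.
have ej : bcode (u (Ordinal szj)) = x.
  rewrite -nth_tseq e nth_cat /= ltnNge leq_addr /= addKn /=.
  exact: nth_index.
have /bcode_below [h1 h2] : bcode (u (Ordinal szp)) = bcode (u (Ordinal szj)) + l.
  by rewrite ei ej.
have /forallP/(_ (Ordinal szj))/forallP/(_ (Ordinal szp)) := valP t.
rewrite -/u h1 eqxx h2 ltnS leqnn /=; clear; lia.
Qed.

(** Listing every node after the node directly above it is enough for the entries
    to increase along the whole column. *)
Lemma std_exists lam s : perm_eq s (dseq lam) -> ~ nonstd l s ->
  exists t : std lam, tseq (sval t) = s.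
Proof.
move=> ps nst; have szs : size s = n by rewrite (perm_size ps) size_dseq.
have us : uniq s.
  rewrite (perm_uniq ps).
  by apply: sorted_uniq (sorted_dseq lam); [apply: ltn_trans | apply: ltnn].
have ex (k : 'I_n) : exists g : box l n, (g \in diagram lam) && (nth 0 s k == bcode g).
  have : nth 0 s k \in dseq lam by rewrite -(perm_mem ps) mem_nth ?szs.
  by case/dseqP => g hg ->; exists g; rewrite hg eqxx.
pose f : {ffun 'I_n -> box l n} := [ffun k => xchoose (ex k)].
have fP k : f k \in diagram lam /\ nth 0 s k = bcode (f k).
  by rewrite ffunE; have /andP[h /eqP] := xchooseP (ex k).
have finj : injective f.
  move=> i j e; have := (fP i).2; rewrite e -(fP j).2 => /eqP.
  by rewrite nth_uniq ?szs // => /eqP/val_inj.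
have ft : is_tableau lam f.
  apply/andP; split; first exact/injectiveP.
  rewrite eqEcard; apply/andP; split.
    by apply/subsetP => g /imsetP [k _ ->]; case: (fP k).
  by rewrite card_diagram card_imset // cardsT card_ord.
pose t : tab lam := exist (fun t => is_tableau lam t) f ft.
have et : tseq t = s.
  apply: (@eq_from_nth _ 0); first by rewrite size_tseq szs.
  move=> i; rewrite size_tseq => hi.
  by rewrite (nth_tseq t (Ordinal hi)) (fP (Ordinal hi)).2.
have adj x : x \in s -> x + l \in s -> index x s < index (x + l) s.
  move=> xs xls; rewrite ltnNge; apply/negP => h; apply: nst.
  have [p [q [e np]]] : exists p q, s = p ++ (x + l) :: q /\ size p = index (x + l) s.
    exists (take (index (x + l) s) s), (drop (index (x + l) s).+1 s).
    rewrite size_takel ?index_size //; split=> //.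
    by rewrite -{2}(nth_index 0 xls) -drop_nth ?index_mem // cat_take_drop.
  exists x, p, q; split=> //; move: xs; rewrite e mem_cat inE => /or3P[xp|/eqP|//].
    move: h; rewrite -np e index_cat xp => /leq_ltn_trans/(_ (_ : _ < size p)).
    by rewrite index_mem xp ltnn => /(_ isT).
  by move: l_gt0; clear; lia.
have col k x : x \in s -> x + k.+1 * l \in s -> index x s < index (x + k.+1 * l) s.
  elim: k => [|k IH] xs xks; first by rewrite mul1n in xks *; apply: adj.
  have [_ hd] := diag_dseq lam; have [lx _] : l <= x /\ _ := hd x ltac:(by rewrite -(perm_mem ps)).
  have e : x + k.+2 * l = x + k.+1 * l + l by rewrite [k.+2 * l]mulSn; clear; lia.
  have h : x + k.+1 * l \in s.
    rewrite (perm_mem ps) -(addnK l (x + _)) -e; apply: (hd _ _).2.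
      by rewrite -(perm_mem ps).
    rewrite e; move: lx; clear; lia.
  by rewrite e in xks *; apply: ltn_trans (IH xs h) _; apply: adj.
have st : is_standard t.
  apply/forallP => i; apply/forallP => j; apply/implyP => /andP[/eqP h1 h2].
  have hk (k : 'I_n) : index (bcode (t k)) s = k.
    by rewrite -et -nth_tseq index_uniq ?size_tseq ?uniq_tseq.
  have hm (k : 'I_n) : bcode (t k) \in s by rewrite -et -nth_tseq mem_nth ?size_tseq.
  have e : bcode (t j) = bcode (t i) + ((t j).1 - (t i).1).-1.+1 * l.
    rewrite prednK ?subn_gt0 // /bcode /code /= h1 mulnBl.
    have : (t i).1 * l <= (t j).1 * l by rewrite leq_mul2r (ltnW h2) orbT.
    by clear; lia.
  by rewrite -(hk i) -(hk j) e; apply: col => //; rewrite -e.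
by exists (exist (fun t => is_standard t) t st).
Qed.

Section Words.
Variable red : 'S_n -> seq 'I_n.-1.
Hypothesis hred : forall w : 'S_n, reduced_expression w (red w).

Definition tword lam (t : tab lam) : seq nat := map val (red (dperm t)).

Lemma valid_word (u : seq 'I_n.-1) : valid n (map val u).
Proof. by apply/allP => _ /mapP [r _ ->] /=; have := ltn_ord r; clear; lia. Qed.

Lemma valid_lift u : valid n u -> exists v : seq 'I_n.-1, u = map val v.
Proof.
elim: u => [|k u IH] /=; first by exists [::].
case/andP=> hk /IH [v ->]; have hk' : k < n.-1 by move: hk; clear; lia.
by exists (Ordinal hk' :: v).
Qed.

Lemma state_tword lam (t : tab lam) : state (dseq lam) (tword t) = tseq t.
Proof.
rewrite /tword state_word; apply: eq_map => k; congr bcode.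
by rewrite (hred (dperm t)).1 dpermP.
Qed.

(** A reduced word in the sense of inversions gives an expression of [dperm t], so
    the chosen expression is no longer than it. *)
Lemma reduced_tword lam (t : tab lam) : reduced (dseq lam) (tword t).
Proof.
have ds := diag_dseq lam; have sz := size_dseq lam.
apply/eqP/anti_leq; rewrite (inv_state ds sz) ?valid_word // andbT.
have [v [vv rv ev]] := reduced_exists ds sz (perm_tseq t).
rewrite state_tword -ev -(eqP rv).
have [u eu] := valid_lift vv; subst v; rewrite !size_map.
apply: (hred (dperm t)).2; apply/permP => k.
move: ev; rewrite state_word /tseq => /eq_in_map /(_ k); rewrite mem_enum => /(_ isT).
by move=> /bcode_inj; rewrite -(dpermP t) => /tab_inj.
Qed.

Definition chosen s u := exists lam (t : std lam), s = dseq lam /\ u = tword (sval t).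

Lemma chosen_ok s t : diag l s -> size s = n -> perm_eq t s -> ~ nonstd l t ->
  exists u, [/\ chosen s u, valid n u, reduced s u & state s u = t].
Proof.
move=> ds sz pt nst; have [lam el] := dseq_exists ds sz; subst s.
have [T eT] := std_exists pt nst; exists (tword (sval T)); split.
- by exists lam, T.
- exact: valid_word.
- exact: reduced_tword.
- by rewrite state_tword.
Qed.

Lemma chosen_valid s u : chosen s u -> valid n u.
Proof. by move=> [lam [t [_ ->]]]; apply: valid_word. Qed.

End Words.
End Codes.

(** * Cells as linear combinations indexed by multipartitions *)
Section CellSums.
Variables (l n : nat) (l_gt0 : (0 < l)%N) (red : 'S_n -> seq 'I_n.-1).
Variables (O : comPzRingType) (A : pzRingType) (sc : {rmorphism O -> A}).
Variables (I : nzRingType) (res : nat -> I) (psi y : nat -> A) (ee : seq I -> A).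

Definition cell (lam : par1 l n) (s t : std lam) : A :=
  left_word res psi ee (dseq lam) (tword red (sval s)) *
  right_word res psi ee (dseq lam) (tword red (sval t)).

Local Notation idx lam s t := (Tagged (fun lam : par1 l n => (std lam * std lam)%type)
  (i := lam) (s, t)).

Lemma cell_single lam0 (s0 t0 : std lam0) (P : pred (par1 l n)) : P lam0 ->
  \sum_(lam | P lam) \sum_s \sum_t
    sc (idx lam s t == idx lam0 s0 t0)%:R * cell s t = cell s0 t0.
Proof.
move=> P0; rewrite (bigD1 lam0) //= [X in _ + X]big1 => [|lam /andP[_ ne]].
  rewrite addr0 (bigD1 s0) //= [X in _ + X]big1 => [|s ne].
    rewrite addr0 (bigD1 t0) //= [X in _ + X]big1 => [|t ne].
      by rewrite eqxx rmorph1 mul1r addr0.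
    by rewrite eq_Tagged xpair_eqE (negbTE ne) andbF rmorph0 mul0r.
  by apply: big1 => t _; rewrite eq_Tagged xpair_eqE (negbTE ne) rmorph0 mul0r.
apply: big1 => s _; apply: big1 => t _.
suff -> : (idx lam s t == idx lam0 s0 t0) = false by rewrite rmorph0 mul0r.
by apply/eqP => /(congr1 tag) /= e; rewrite e eqxx in ne.
Qed.

Lemma cells_sum (D : seq nat -> Prop) (P : pred (par1 l n)) x :
  (forall lam, D (dseq lam) -> P lam) ->
  cells sc n l res psi ee (chosen l red) D x ->
  exists r : forall lam, std lam -> std lam -> O,
    x = \sum_(lam | P lam) \sum_s \sum_t sc (r lam s t) * cell s t.
Proof.
move=> DP; elim=> {x} [s u v _ _ Ds [lam [T [e1 ->]]] [mu [T' [e2 ->]]]||c x _ [r ->]|x x' _ [r ->] _ [r' ->]].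
- subst s; have e3 := dseq_inj l_gt0 e2; subst mu.
  exists (fun mu s t => (idx mu s t == idx lam T T')%:R).
  by rewrite cell_single //; apply: DP.
- exists (fun _ _ _ => 0); rewrite big1 // => lam _; rewrite big1 // => s _.
  by rewrite big1 // => t _; rewrite rmorph0 mul0r.
- exists (fun lam s t => c * r lam s t); rewrite mulr_sumr; apply: eq_bigr => lam _.
  rewrite mulr_sumr; apply: eq_bigr => s _; rewrite mulr_sumr; apply: eq_bigr => t _.
  by rewrite rmorphM mulrA.
- exists (fun lam s t => r lam s t + r' lam s t); rewrite -big_split; apply: eq_bigr => lam _ /=.
  rewrite -big_split; apply: eq_bigr => s _ /=; rewrite -big_split; apply: eq_bigr => t _ /=.
  by rewrite rmorphD mulrDl.
Qed.

Lemma left_span_sum (lam : par1 l n) x :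
  left_span sc n l res psi y ee (chosen l red) (dseq lam) x ->
  exists (r : std lam -> O) (j : A), ideal n sc psi y ee (sabove l res (dseq lam) [::]) j /\
    x = j + \sum_u sc (r u) * left_word res psi ee (dseq lam) (tword red (sval u)).
Proof.
elim=> {x} [x Jx|u [mu [T [e ->]]]|c x _ [r [j [hj ->]]]|x x' _ [r [j [hj ->]]] _ [r' [j' [hj' ->]]]].
- exists (fun=> 0), x; split=> //; rewrite big1 ?addr0 // => u _.
  by rewrite rmorph0 mul0r.
- have e' := dseq_inj l_gt0 e; subst mu.
  exists (fun u => (u == T)%:R), 0; split; first exact: ideal_zero.
  rewrite add0r (bigD1 T) //= eqxx rmorph1 mul1r big1 ?addr0 // => v /negbTE ->.
  by rewrite rmorph0 mul0r.
- exists (fun u => c * r u), (sc c * j); split; first by apply: ideal_mull => //; apply: B_sc.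
  rewrite mulrDr mulr_sumr; congr (_ + _); apply: eq_bigr => u _.
  by rewrite rmorphM mulrA.
- exists (fun u => r u + r' u), (j + j'); split; first exact: ideal_add.
  rewrite addrACA -big_split; congr (_ + _); apply: eq_bigr => u _ /=.
  by rewrite rmorphD mulrDl.
Qed.
End CellSums.

(** * Residues of close nodes *)
Section Residues.
Variables (e l n : nat) (khat : 'I_l -> int).
Hypothesis he : (1 < e)%N.
Hypothesis hl : (1 < l)%N.
Hypothesis hk : strongly_adjacency_free e n khat.
Let kappa := khat_res e khat.
Let l_gt0 : (0 < l)%N := ltnW hl.
Implicit Types i j : 'I_l.

Lemma val_Zp_add (a b : 'Z_e) : val (a + b) = ((val a + val b) %% e)%N.
Proof. by congr (_ %% _)%N; apply: Zp_cast. Qed.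
Lemma val_Zp_lt (a : 'Z_e) : (val a < e)%N.
Proof. by have := ltn_ord a; rewrite [X in (_ < X)%N]Zp_cast. Qed.
Lemma val_Zp1 : val (1 : 'Z_e) = 1%N.
Proof. by rewrite /= modn_small. Qed.

Lemma kappa_sub i j : i <> j -> kappa i <> kappa j /\ kappa i <> kappa j + 1.
Proof.
case: hk => _ h _ _ /h [h1 h2 h3]; split.
  by move=> h4; apply: h1; rewrite -/kappa h4 subrr.
by move=> h4; apply: h2; rewrite -/kappa h4 addrAC subrr add0r.
Qed.

Lemma kappa_lt i j : (i < j)%N -> (val (kappa i) < val (kappa j))%N.
Proof. by case: hk => _ _ _ h; apply: h. Qed.

(** With [kappa] increasing as representatives below [e], the equality
    [kappa j = kappa i + 2] for [j < i] goes once around the cycle, so that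
    the representatives of [kappa j] and [kappa i] are [0] and [e - 2], or [1] and
    [e - 1].  A component before [j] or after [i] would have residue
    [kappa i + 1], and the case where there is none is excluded by
    hypothesis. *)
Lemma kappa_wrap (i j : 'I_l) : (j < i)%N -> kappa j <> kappa i + 2.
Proof.
move=> ji eij; have e1 : val (kappa j) = ((val (kappa i) + 2) %% e)%N.
  by rewrite eij -(addn1 1) natrD addrA val_Zp_add val_Zp_add val_Zp1 modnDml addnA.
have hlt := kappa_lt ji.
have hi := val_Zp_lt (kappa i); have hj := val_Zp_lt (kappa j).
have e2 : (val (kappa i) + 2 = val (kappa j) + e)%N.
  have := divn_eq (val (kappa i) + 2) e; rewrite -e1.
  case: (_ %/ e)%N => [|[|d]]; first by rewrite mul0n; move: hlt; clear; lia.
    by move=> ->; rewrite mul1n addnC.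
  by rewrite !mulSn; move: hi hj hlt he; clear; lia.
have last_lt : (l.-1 < l)%N by rewrite prednK.
case: (posnP j) => j0; last first.
  have z : (Ordinal l_gt0 < j)%N by [].
  have := kappa_lt z => h0.
  have := (kappa_sub (i := j) (j := Ordinal l_gt0) _).2; apply.
    by move=> ej; rewrite ej in j0.
  apply: val_inj; rewrite val_Zp_add val_Zp1.
  by rewrite modn_small; move: h0 e2 hi hj; clear; lia.
case: (ltnP i l.-1) => il; last first.
  case: hk => _ _ h3 _; apply: (h3 j i) => //.
  by have := ltn_ord i; move: il; clear; lia.
have h0 := @kappa_lt i (Ordinal last_lt) il.
have hm := val_Zp_lt (kappa (Ordinal last_lt)).
have := (kappa_sub (i := Ordinal last_lt) (j := i) _).2; apply.
  by move=> ej; move: il; rewrite -ej ltnn.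
apply: val_inj; rewrite val_Zp_add val_Zp1.
by rewrite modn_small; move: h0 e2 hi hj hm; clear; lia.
Qed.

Definition nres (c : nat) : 'Z_e := kappa (comp_of l_gt0 c) + 1 - (c %/ l)%:R.

Lemma nresE (g : box l n) : node_res kappa (box_node g) = nres (bcode g).
Proof. by rewrite /nres /bcode code_div // code_mod. Qed.

Lemma comp_of_below c : comp_of l_gt0 (c + l) = comp_of l_gt0 c.
Proof. by apply: val_inj; rewrite /= modnDr. Qed.

Lemma nres_below c : nres (c + l) = nres c - 1.
Proof.
rewrite /nres comp_of_below divnDr // divnn l_gt0.
by rewrite natrD opprD addrA.
Qed.

(** Nodes less than one row apart are in the same row, or in consecutive rows
    with the lower one in an earlier component; in the second case the residue
    of the lower node is [kappa j - 1] up to a shift common to both, which is where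
    [kappa_wrap] enters. *)
Lemma nres_far c d : (c < d < c + l)%N -> far (nres c) (nres d).
Proof.
move=> /andP[cd dl]; set i := comp_of l_gt0 c; set j := comp_of l_gt0 d.
have ec : c = (c %/ l * l + i)%N := divn_eq c l.
have ed : d = (d %/ l * l + j)%N := divn_eq d l.
have hi := ltn_ord i; have hj := ltn_ord j.
have q1 : (c %/ l <= d %/ l)%N by apply: leq_div2r; apply: ltnW.
have q2 : (d %/ l <= (c %/ l).+1)%N.
  have -> : (c %/ l).+1 = ((c + l) %/ l)%N by rewrite divnDr // divnn l_gt0 addn1.
  by apply: leq_div2r; apply: ltnW.
rewrite leq_eqVlt ltnS in q2; case/orP: q2 => [/eqP q2|q2].
  have ji : (j < i)%N.
    move: dl; rewrite {1}ec {1}ed q2 mulSn; clear; move: (_ * l)%N => m; lia.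
  have nij : i <> j by move=> e0; rewrite e0 ltnn in ji.
  have nji : j <> i by move/esym.
  have ed' : nres d = kappa j - (c %/ l)%:R.
    by rewrite /nres -/j q2 -(addn1 (c %/ l)) natrD opprD addrA addrAC addrK.
  have ec' : nres c = kappa i + 1 - (c %/ l)%:R by [].
  rewrite ed' ec'; apply/and3P; split; apply/eqP.
  - by move/addIr => h; apply: (@kappa_sub j i nji).2.
  - by rewrite addrAC => /addIr/addIr; apply: (@kappa_sub i j nij).1.
  - rewrite [RHS]addrAC => /addIr; rewrite -addrA; exact: kappa_wrap.
have {q1 q2} q : (d %/ l = c %/ l)%N by apply/eqP; rewrite eqn_leq q1 q2.
have ij : (i < j)%N.
  move: cd; rewrite {1}ec {1}ed q; clear; move: (_ * l)%N => m; lia.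
have nij : i <> j by move=> e0; rewrite e0 ltnn in ij.
have [h1 h2] := @kappa_sub i j nij.
have [_ h3] := @kappa_sub j i (fun e0 => nij (esym e0)).
rewrite /nres -/i -/j q; apply/and3P; split; apply/eqP.
- by move=> /addIr/addIr.
- by rewrite addrAC => /addIr/addIr.
- by rewrite [RHS]addrAC => /addIr/addIr.
Qed.

Lemma two_neq0 : 1 + 1 != 0 :> 'Z_e.
Proof.
have h01 : (Ordinal l_gt0 : 'I_l) <> Ordinal hl by move=> /(congr1 val).
have [h1 h2] := @kappa_sub _ _ h01.
have [_ h3] := @kappa_sub _ _ (fun e0 => h01 (esym e0)).
apply/eqP => h; move: (kappa _) (kappa _) h1 h2 h3 => a b h1 h2 h3.
have e2 : (e %| 2)%N.
  by have := congr1 val h; rewrite val_Zp_add val_Zp1 => e0; apply/eqP; exact: e0.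
have ee : e = 2 by have := dvdn_leq (isT : (0 < 2)%N) e2; move: he; clear; lia.
have ha := val_Zp_lt a; have hb := val_Zp_lt b.
have nab : val a <> val b by move=> h4; apply/h1/val_inj.
apply: h2; apply: val_inj; rewrite val_Zp_add val_Zp1.
move: (val a) (val b) ha hb nab => va vb; rewrite {}ee.
by case: va => [|[|va]]; case: vb => [|[|vb]].
Qed.
End Residues.

(** * The blob algebra satisfies the laws *)
Section SeqResidues.
Variables (e n : nat).

Definition seqf (s : seq 'Z_e) : iseq e n := [ffun k : 'I_n => nth 0 s k].
Definition fseq (i : iseq e n) : seq 'Z_e := [seq i k | k <- enum 'I_n].

Lemma size_fseq i : size (fseq i) = n.
Proof. by rewrite size_map size_enum_ord. Qed.
Lemma fseqK i : seqf (fseq i) = i.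
Proof.
by apply/ffunP => k; rewrite ffunE (nth_map k) ?size_enum_ord // nth_ord_enum.
Qed.
Lemma seqfK s : size s = n -> fseq (seqf s) = s.
Proof.
move=> hs; apply: (@eq_from_nth _ 0); first by rewrite size_fseq.
move=> k; rewrite size_fseq => hk.
rewrite (nth_map (Ordinal hk)) ?size_enum_ord // ffunE.
by rewrite (nth_ord_enum (Ordinal hk) (Ordinal hk)).
Qed.

Section Split.
Variables (s : seq 'Z_e) (a b : 'Z_e) (t : seq 'Z_e).
Hypothesis hs : size (s ++ [:: a, b & t]) = n.
Variable r : 'I_n.-1.
Hypothesis hr : val r = size s.
Lemma seqf_lo : seqf (s ++ [:: a, b & t]) (lo r) = a.
Proof. by rewrite ffunE /= -[nat_of_ord r]/(val r) hr nth_cat ltnn subnn. Qed.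
Lemma seqf_hi : seqf (s ++ [:: a, b & t]) (hi r) = b.
Proof.
by rewrite ffunE /= -[nat_of_ord r]/(val r) hr nth_cat ltnNge leqnSn /= subSnn.
Qed.
Lemma seqf_swap : sact r (seqf (s ++ [:: a, b & t])) = seqf (s ++ [:: b, a & t]).
Proof.
apply: (can_inj (g := seqf)); first exact: fseqK.
rewrite [RHS]seqfK; last by rewrite -hs !size_cat.
rewrite -(swap_atE s a b t) -hr -[in RHS](seqfK hs) swap_at_enum.
by apply: eq_map => k; rewrite ffunE.
Qed.
End Split.
End SeqResidues.

Section BlobLaws.
Variables (F : fieldType) (e l n : nat) (khat : 'I_l -> int).
Hypothesis he : (1 < e)%N.
Hypothesis hl : (1 < l)%N.
Hypothesis hn : (1 < n)%N.
Let kappa := khat_res e khat.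
Let l_gt0 : (0 < l)%N := ltnW hl.
Local Notation B := (blob F n kappa).
Local Notation res := (nres e khat hl).

Definition bsc (c : F) : B := c *: (1 : B).
Lemma bsc_additive : zmod_morphism bsc.
Proof. by move=> a b; rewrite /bsc scalerBl. Qed.
HB.instance Definition _ := GRing.isZmodMorphism.Build F B bsc bsc_additive.
Lemma bsc_multiplicative : monoid_morphism bsc.
Proof.
split; first by rewrite /bsc scale1r.
by move=> a b; rewrite /bsc -pres_scaleAl mul1r scalerA.
Qed.
HB.instance Definition _ := GRing.isMonoidMorphism.Build F B bsc bsc_multiplicative.

Lemma bscE c (x : B) : bsc c * x = c *: x.
Proof. by rewrite /bsc -pres_scaleAl mul1r. Qed.
Lemma bsc_central c (x : B) : bsc c * x = x * bsc c.
Proof. by rewrite bscE /bsc -pres_scaleAr mulr1. Qed.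

Definition psiN (k : nat) : B := oapp (@bpsi F e n l kappa) 0 (insub k).
Definition yN (k : nat) : B := oapp (@by_ F e n l kappa) 0 (insub k).
Definition eeN (s : seq 'Z_e) : B := be F kappa (seqf n s).

Lemma psiNE (r : 'I_n.-1) : psiN r = bpsi F kappa r.
Proof. by rewrite /psiN valK. Qed.
Lemma yNE (k : 'I_n) : yN k = by_ F kappa k.
Proof. by rewrite /yN valK. Qed.

Lemma nres_row1 (m : 'I_l) : res (l + m) = kappa m.
Proof.
rewrite /nres; have -> : comp_of (ltnW hl) (l + m) = m.
  by apply: val_inj; rewrite /= modnDl modn_small.
by rewrite divnDl // divnn l_gt0 divn_small // addrK.
Qed.

Lemma row1_nres m : (l <= m < l + l)%N -> res m = kappa (comp_of l_gt0 m).
Proof.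
move=> /andP[h1 h2]; have h3 : (m - l < l)%N by move: h1 h2; clear; lia.
rewrite -(subnKC h1) -[(m - l)%N]/(val (Ordinal h3)) nres_row1; congr kappa.
by apply: val_inj; rewrite /= modnDl modn_small.
Qed.

Lemma blob_laws :
  klr_laws n l res psiN yN eeN (fun m => bsc ((fun=> 0) m)).
Proof.
have split_r (s : seq 'Z_e) a b t : size (s ++ [:: a, b & t]) = n ->
    exists2 r : 'I_n.-1, val r = size s & psiN (size s) = bpsi F kappa r /\
      yN (size s) = by_ F kappa (lo r) /\ yN (size s).+1 = by_ F kappa (hi r).
  move=> hs; have hk : (size s < n.-1)%N by rewrite -hs size_cat /=; clear; lia.
  exists (Ordinal hk) => //; rewrite -psiNE -!yNE; do 2!split=> //.
have k0 : (0 < n)%N by apply: ltnW.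
split.
- by move=> s hs; rewrite /eeN be_idem eqxx.
- move=> s t hs ht st; rewrite /eeN be_idem; case: eqP => // h; case: st.
  by rewrite -(seqfK hs) h seqfK.
- exists [seq fseq i | i <- index_enum (iseq e n)].
    by apply/allP => _ /mapP [i _ ->]; rewrite size_fseq.
  rewrite big_map -(be_sum F n kappa); apply: eq_bigr => i _.
  by rewrite /eeN fseqK.
- move=> a s hs ha; apply: (relP (B_first F (kappa := kappa) (k := Ordinal k0) erefl _)).
  move=> m; rewrite ffunE /= -nres_row1; apply: ha.
  by rewrite leq_addr ltn_add2l ltn_ord.
- move=> m s hs hm.
  apply: (relP (B_second F (kappa := kappa) (k := Ordinal k0) (k' := Ordinal hn) erefl erefl _ _)).
    by rewrite ffunE /= row1_nres //; eexists.
  by rewrite !ffunE /=.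
- move=> m s hs hm; rewrite rmorph0 mul0r.
  have -> : yN 0 = by_ F kappa (Ordinal k0) := yNE (Ordinal k0).
  have := relP (B_y1 F (kappa := kappa) (i := seqf n (res m :: s)) (k := Ordinal k0) erefl _).
  rewrite clsM; apply.
  by rewrite ffunE /= row1_nres //; eexists.
- by move=> k s hk hs; rewrite -[k]/(val (Ordinal hk)) yNE; apply: by_e.
- move=> s a b t hs; have [r hr [-> _]] := split_r _ _ _ _ hs.
  by rewrite bpsi_e (seqf_swap hs hr).
- move=> k m hk hm h1 h2.
  have hk' : (k < n.-1)%N by move: hk; clear; lia.
  rewrite -[k]/(val (Ordinal hk')) -[m]/(val (Ordinal hm)) psiNE yNE.
  have := relP (B_psiy F kappa (r := Ordinal hk') (k := Ordinal hm) _ _).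
  rewrite !clsM; apply.
    by move=> /(congr1 val).
  by move=> /(congr1 val).
- move=> k m h1 h2; have hm : (m < n.-1)%N by move: h2; clear; lia.
  have hk : (k < n.-1)%N by move: h1 hm; clear; lia.
  rewrite -[k]/(val (Ordinal hk)) -[m]/(val (Ordinal hm)) !psiNE.
  have := relP (B_psipsi F kappa (r := Ordinal hk) (s := Ordinal hm) _).
  by rewrite !clsM; apply; rewrite /= h1.
- move=> s a b t hs; have [r hr [-> [-> ->]]] := split_r _ _ _ _ hs.
  rewrite bpsi_yhi seqf_lo // seqf_hi //.
  by rewrite /bdelta; case: eqP.
- move=> s a b t hs; have [r hr [-> [-> ->]]] := split_r _ _ _ _ hs.
  rewrite byhi_psi seqf_lo // seqf_hi //.
  by rewrite /bdelta; case: eqP.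
- move=> s a t hs; have [r hr [-> _]] := split_r _ _ _ _ hs.
  have := relP (B_sq_eq F kappa (r := r) (i := seqf n (s ++ [:: a, a & t])) _).
  by rewrite !clsM; apply; rewrite seqf_lo // seqf_hi.
- move=> s a b t hs /far_neq [f1 f2 f3]; have [r hr [-> _]] := split_r _ _ _ _ hs.
  have := relP (B_sq_far F kappa (r := r) (i := seqf n (s ++ [:: a, b & t])) _ _ _).
  rewrite !clsM; apply; rewrite seqf_lo // seqf_hi //.
  by move=> h; apply: f3; rewrite h subrK.
- move=> s a t hs; have [r hr [-> [-> ->]]] := split_r _ _ _ _ hs.
  have := relP (B_sq_up F kappa (r := r) (i := seqf n (s ++ [:: a, a + 1 & t])) _).
  by rewrite !(clsM, clsD, clsN); apply; rewrite seqf_lo // seqf_hi.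
- move=> s a t hs; have [r hr [-> [-> ->]]] := split_r _ _ _ _ hs.
  have := relP (B_sq_down F kappa (r := r) (i := seqf n (s ++ [:: a + 1, a & t])) _).
  by rewrite !(clsM, clsD, clsN); apply; rewrite seqf_lo // seqf_hi // addrK.
- move=> s a b c t hs.
  have [r hr [-> _]] := split_r _ _ _ _ hs.
  have hs' : size (rcons s a ++ [:: b, c & t]) = n by rewrite cat_rcons.
  have [r' hr' [+ _]] := split_r _ _ _ _ hs'; rewrite size_rcons => ->.
  have hrr : r' = r.+1 :> nat.
    by rewrite -[nat_of_ord r']/(val r') hr' size_rcons -hr.
  rewrite (bbraid _ _ _ hrr) seqf_lo // seqf_hi //.
  have -> : seqf n (s ++ [:: a, b, c & t]) (hi r') = c.
    by rewrite -cat_rcons seqf_hi.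
  by rewrite /balpha /braid_const; case: ifP => // _; case: ifP.
Qed.
End BlobLaws.

(** * The seminormal representation *)
Section WordCodes.
Local Open Scope nat_scope.
Variable l : nat.
Implicit Types (a b c : 'I_l) (w : seq 'I_l).

(** A word records the components to which nodes are added one at a time; this is
    the node added by the letter [a] after the letters of [w]. *)
Definition next_code w a := (count_mem a w).+1 * l + a.

Fixpoint wcodes (pre w : seq 'I_l) : seq nat :=
  if w is a :: w' then next_code pre a :: wcodes (a :: pre) w' else [::].

Lemma size_wcodes pre w : size (wcodes pre w) = size w.
Proof. by elim: w pre => //= a w IH pre; rewrite IH. Qed.

Lemma next_code_perm w w' a : perm_eq w w' -> next_code w a = next_code w' a.
Proof. by move=> p; rewrite /next_code (seq.permP p). Qed.

Lemma wcodes_perm w w' u : perm_eq w w' -> wcodes w u = wcodes w' u.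
Proof.
elim: u w w' => //= a u IH w w' p; rewrite (next_code_perm _ p).
by congr (_ :: _); apply: IH; rewrite perm_cons.
Qed.

Lemma wcodes_cat pre w w' : wcodes pre (w ++ w') = wcodes pre w ++ wcodes (pre ++ w) w'.
Proof.
elim: w pre => [|a w IH] pre /=; first by rewrite cats0.
rewrite IH; congr (_ :: _ ++ _); apply: wcodes_perm.
by rewrite -cat1s perm_sym -cat1s perm_catCA.
Qed.

Lemma wcodes_split w a b w' : wcodes [::] (w ++ [:: a, b & w']) =
  wcodes [::] w ++ [:: next_code w a, next_code (a :: w) b
    & wcodes ([:: a, b & w]) w'].
Proof.
rewrite wcodes_cat /=; congr (_ ++ _ :: _ :: _).
by apply: wcodes_perm; rewrite -[b :: a :: w]/([:: b] ++ [:: a] ++ w) perm_catCA.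
Qed.

Lemma next_code_other w a b : a != b -> next_code (a :: w) b = next_code w b.
Proof. by move=> ab; rewrite /next_code /= (negbTE ab). Qed.
Lemma next_code_same w a : next_code (a :: w) a = next_code w a + l.
Proof. by rewrite /next_code /= eqxx add1n [_.+2 * l]mulSn -addnA addnC. Qed.

End WordCodes.

Section Representation.
Variables (K : fieldType) (I : nzRingType) (l n : nat) (l_gt0 : (0 < l)%N).
Variables (res : nat -> I) (X : 'I_l -> K).
Hypothesis res_below : forall c, res (c + l) = res c - 1.
Hypothesis res_far : forall c d, (c < d < c + l)%N -> far (res c) (res d).
Hypothesis two_neq0 : 1 + 1 != 0 :> I.
Hypothesis X_inj : injective X.

Local Notation word := (n.-tuple 'I_l).
Local Notation N := #|{: n.-tuple 'I_l}|.
Local Notation M := 'M[K]_N.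
Local Notation V := 'cV[K]_N.
Implicit Types (a b c : 'I_l) (w : seq 'I_l).

Definition bv w : V := if insub w is Some t then delta_mx (enum_rank (t : word)) 0 else 0.
Definition op (f : seq 'I_l -> V) : M := \matrix_(i, j) f (enum_val j : word) i 0.

Lemma op_bv f w : size w = n -> op f *m bv w = f w.
Proof.
move=> hw; rewrite /bv; case: insubP => [t _ <-|]; last by rewrite hw eqxx.
apply/matrixP => i j; rewrite ord1 !mxE (bigD1 (enum_rank t)) //= big1 => [|k nk].
  by rewrite !mxE !eqxx mulr1 addr0 enum_rankK.
by rewrite !mxE (negbTE nk) mulr0.
Qed.

Lemma mx_ext (P Q : M) : (forall w, size w = n -> P *m bv w = Q *m bv w) -> P = Q.
Proof.
move=> h; apply/matrixP => i j.
have hw : size (enum_val j : word) = n by rewrite size_tuple.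
have := h _ hw; rewrite /bv valK enum_valK => /matrixP /(_ i 0).
have aux (R : M) : (R *m delta_mx j 0) i 0 = R i j :> K.
  rewrite mxE (bigD1 j) //= big1 => [|k nk]; first by rewrite !mxE !eqxx mulr1 addr0.
  by rewrite !mxE (negbTE nk) mulr0.
by rewrite !aux.
Qed.

Definition wres w := map res (wcodes [::] w).
Let a0 : 'I_l := Ordinal l_gt0.

(** Coefficients of [psi] on the basis vector of a word with adjacent letters
    [a] and [b], which add nodes of residues [x] and [z]: [Qc] for the exchanged word and
    [Dc] for the word itself.  For equal residues they make [psi] a divided
    difference in the dots [X a] and [X b]; the factor [X a - X b] for
    [x = z + 1] makes the square of [psi] the required difference of dots.  Equal
    letters are nodes of one column, with residues [x] and [x - 1], and both
    coefficients vanish. *)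
Definition Qc (x z : I) a b : K :=
  if x == z then (X a - X b)^-1 else if x == z + 1 then X a - X b else 1.
Definition Dc (x z : I) a b : K := if x == z then (X a - X b)^-1 else 0.

Definition yM k : M := op (fun w => X (nth a0 w k) *: bv w).
Definition eM (s : seq I) : M := op (fun w => if wres w == s then bv w else 0).
Definition psiM k : M := op (fun w =>
  let x := nth 0 (wres w) k in let z := nth 0 (wres w) k.+1 in
  let a := nth a0 w k in let b := nth a0 w k.+1 in
  Qc x z a b *: bv (swap_at k w) + Dc x z a b *: bv w).

Local Notation rho w a := (res (next_code w a)).

Lemma yM_bv w a w' : size (w ++ a :: w') = n ->
  yM (size w) *m bv (w ++ a :: w') = X a *: bv (w ++ a :: w').
Proof. by move=> h; rewrite op_bv // nth_cat ltnn subnn. Qed.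

Lemma yM_bv' w a b w' : size (w ++ [:: a, b & w']) = n ->
  yM (size w).+1 *m bv (w ++ [:: a, b & w']) = X b *: bv (w ++ [:: a, b & w']).
Proof.
by move=> h; rewrite op_bv // nth_cat ltnNge leqnSn /= subSnn.
Qed.

Lemma eM_bv s w : size w = n -> eM s *m bv w = if wres w == s then bv w else 0.
Proof. by move=> h; rewrite op_bv. Qed.

Lemma psiM_gen w a b w' : size (w ++ [:: a, b & w']) = n ->
  psiM (size w) *m bv (w ++ [:: a, b & w']) =
  Qc (rho w a) (rho (a :: w) b) a b *: bv (w ++ [:: b, a & w']) +
  Dc (rho w a) (rho (a :: w) b) a b *: bv (w ++ [:: a, b & w']).
Proof.
move=> h; rewrite op_bv // swap_atE /wres wcodes_split map_cat /=.
rewrite !nth_cat !size_map !size_wcodes ltnn subnn /= ltnNge leqnSn /= subSnn /=.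
by [].
Qed.

Lemma add1_neq (x : I) : x + 1 != x.
Proof. by rewrite -subr_eq0 addrAC subrr add0r oner_eq0. Qed.

Lemma psiM_same w a w' : size (w ++ [:: a, a & w']) = n ->
  psiM (size w) *m bv (w ++ [:: a, a & w']) = 0.
Proof.
move=> h; rewrite psiM_gen // next_code_same res_below /Qc /Dc subrK eqxx subrr.
have /negbTE -> : rho w a != rho w a - 1.
  by rewrite -subr_eq0 opprB addrCA subrr addr0 oner_eq0.
by rewrite !scale0r addr0.
Qed.

Lemma psiM_diff w a b w' : size (w ++ [:: a, b & w']) = n -> a != b ->
  psiM (size w) *m bv (w ++ [:: a, b & w']) =
  Qc (rho w a) (rho w b) a b *: bv (w ++ [:: b, a & w']) +
  Dc (rho w a) (rho w b) a b *: bv (w ++ [:: a, b & w']).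
Proof. by move=> h ab; rewrite psiM_gen // next_code_other. Qed.

Lemma wres_split w a b w' : wres (w ++ [:: a, b & w']) =
  wres w ++ [:: rho w a, rho (a :: w) b & map res (wcodes [:: a, b & w] w')].
Proof. by rewrite /wres wcodes_split map_cat. Qed.

Lemma size_wres w : size (wres w) = size w.
Proof. by rewrite size_map size_wcodes. Qed.

Lemma wres_swap w a b w' : a != b ->
  wres (w ++ [:: b, a & w']) = swap_at (size w) (wres (w ++ [:: a, b & w'])).
Proof.
move=> ab; rewrite !wres_split !next_code_other // 1?eq_sym //.
rewrite -(size_wres w) swap_atE; congr (_ ++ [:: _, _ & map _ _]).
by apply: wcodes_perm; rewrite -[b :: a :: w]/([:: b] ++ [:: a] ++ w) perm_catCA.
Qed.

Lemma mxM (P Q : M) (v : V) : (P * Q) *m v = P *m (Q *m v).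
Proof. by rewrite mulmxA. Qed.

Lemma word_split w k : size w = n -> (k.+1 < n)%N ->
  exists w1 a b w2, w = w1 ++ [:: a, b & w2] /\ size w1 = k.
Proof. by move=> hw hk; apply: split_at; rewrite hw. Qed.

Lemma size_sw w a b w' : size (w ++ [:: a, b & w']) = n -> size (w ++ [:: b, a & w']) = n.
Proof. by rewrite !size_cat. Qed.

Lemma ee_case (s1 : seq I) (a b : I) s2 w : size w = n -> size (s1 ++ [:: a, b & s2]) = n ->
  eM (s1 ++ [:: a, b & s2]) *m bv w = 0 \/
  exists w1 c d w2, [/\ w = w1 ++ [:: c, d & w2], size w1 = size s1,
    a = rho w1 c, b = rho (c :: w1) d & eM (s1 ++ [:: a, b & s2]) *m bv w = bv w].
Proof.
move=> hw hs; rewrite eM_bv //; case: eqP => e; last by left.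
right; have [|w1 [c [d [w2 [ew e1]]]]] := @word_split w (size s1) hw.
  by rewrite -hs; size_lia.
exists w1, c, d, w2; rewrite ew wres_split in e.
case/cat_inj_size: e; first by rewrite size_wres.
by move=> _ [-> -> _].
Qed.

Lemma Xsub a b : a != b -> X a - X b != 0.
Proof. by move=> ab; rewrite subr_eq0 (inj_eq X_inj). Qed.
Lemma Qc_same x a b : Qc x x a b = (X a - X b)^-1.
Proof. by rewrite /Qc eqxx. Qed.
Lemma Dc_same x a b : Dc x x a b = (X a - X b)^-1.
Proof. by rewrite /Dc eqxx. Qed.
Lemma Dc_diff x z a b : x != z -> Dc x z a b = 0.
Proof. by rewrite /Dc => /negbTE ->. Qed.

Lemma eM_swap s (a b : I) t w c d w' : size (s ++ [:: a, b & t]) = n ->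
  size (w ++ [:: c, d & w']) = n -> size w = size s -> c != d ->
  (wres (w ++ [:: d, c & w']) == s ++ [:: b, a & t]) =
  (wres (w ++ [:: c, d & w']) == s ++ [:: a, b & t]).
Proof.
move=> hs hw e cd; rewrite (wres_swap _ _ cd) e -(swap_atE s a b t).
by rewrite (inj_eq (inv_inj (@swap_atK _ _))).
Qed.

Lemma rep_psie s (a b : I) t : size (s ++ [:: a, b & t]) = n ->
  psiM (size s) * eM (s ++ [:: a, b & t]) = eM (s ++ [:: b, a & t]) * psiM (size s).
Proof.
move=> hs; apply: mx_ext => w hw; rewrite !mxM.
have [|w1 [c [d [w2 [ew e1]]]]] := @word_split w (size s) hw.
  by rewrite -hs; size_lia.
subst w; rewrite eM_bv // -e1; case: (c =P d) => [ecd|/eqP cd].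
  by subst d; rewrite psiM_same // mulmx0; case: ifP => _; rewrite ?psiM_same ?mulmx0.
rewrite psiM_diff // mulmxDr -!scalemxAr !eM_bv // ?(size_sw hw) //.
rewrite (eM_swap hs hw e1 cd); case: (_ =P s ++ [:: a, b & t]) => e2.
  rewrite psiM_diff //; congr (_ + _).
  case: (eqVneq (rho w1 c) (rho w1 d)) => [ecd|ne]; last by rewrite Dc_diff // !scale0r.
  suff -> : wres (w1 ++ [:: c, d & w2]) == s ++ [:: b, a & t] by [].
  move: e2; rewrite wres_split next_code_other // -ecd => e2.
  have := e2; case/cat_inj_size; first by rewrite size_wres.
  by move=> _ [ea eb _]; rewrite e2 -ea -eb.
rewrite mulmx0 scaler0 add0r.
case: (eqVneq (rho w1 c) (rho w1 d)) => [ecd|ne]; last by rewrite Dc_diff // !scale0r.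
case: (_ =P s ++ [:: b, a & t]) => e3; last by rewrite scaler0.
case: e2; move: e3; rewrite wres_split next_code_other // -ecd => e2.
have := e2; case/cat_inj_size; first by rewrite size_wres.
by move=> _ [ea eb _]; rewrite e2 -ea -eb.
Qed.

Lemma rep_psiyhi s (a b : I) t : size (s ++ [:: a, b & t]) = n ->
  psiM (size s) * yM (size s).+1 * eM (s ++ [:: a, b & t]) =
  (yM (size s) * psiM (size s) - (a == b)%:R) * eM (s ++ [:: a, b & t]).
Proof.
move=> hs; apply: mx_ext => w hw; rewrite !mxM.
have [->|[w1 [c [d [w2 [ew e1 ea eb ->]]]]]] := ee_case hw hs; first by rewrite !mulmx0.
subst w a b; rewrite -e1 yM_bv' // -scalemxAr mulmxBl !mxM.
case: (eqVneq c d) => [ecd|cd].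
  subst d; rewrite psiM_same // scaler0 mulmx0 next_code_same res_below.
  have /negbTE -> : rho w1 c != rho w1 c - 1.
    by rewrite -subr_eq0 opprB addrCA subrr addr0 oner_eq0.
  by rewrite mul0mx subr0.
rewrite psiM_diff // mulmxDr -!scalemxAr !yM_bv ?(size_sw hw) // next_code_other //.
rewrite scalerDr !scalerA -addrA; congr (_ + _); first by rewrite mulrC.
case: (eqVneq (rho w1 c) (rho w1 d)) => [ecd|ne]; last first.
  by rewrite Dc_diff // mul0mx subr0 mulr0 mul0r.
rewrite ecd Dc_same mul1mx -[X in _ = _ - X]scale1r -scalerBl.
by congr (_ *: _); have := Xsub cd; move=> h; field.
Qed.

Lemma rep_yhipsi s (a b : I) t : size (s ++ [:: a, b & t]) = n ->
  yM (size s).+1 * psiM (size s) * eM (s ++ [:: a, b & t]) =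
  (psiM (size s) * yM (size s) - (a == b)%:R) * eM (s ++ [:: a, b & t]).
Proof.
move=> hs; apply: mx_ext => w hw; rewrite !mxM.
have [->|[w1 [c [d [w2 [ew e1 ea eb ->]]]]]] := ee_case hw hs; first by rewrite !mulmx0.
subst w a b; rewrite -e1 mulmxBl !mxM yM_bv // -scalemxAr.
case: (eqVneq c d) => [ecd|cd].
  subst d; rewrite psiM_same // scaler0 mulmx0 next_code_same res_below.
  have /negbTE -> : rho w1 c != rho w1 c - 1.
    by rewrite -subr_eq0 opprB addrCA subrr addr0 oner_eq0.
  by rewrite mul0mx subr0.
rewrite psiM_diff // mulmxDr -!scalemxAr !yM_bv' ?(size_sw hw) // next_code_other //.
rewrite scalerDr !scalerA -addrA; congr (_ + _); first by rewrite mulrC.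
case: (eqVneq (rho w1 c) (rho w1 d)) => [ecd|ne]; last first.
  by rewrite Dc_diff // mul0mx subr0 mulr0 mul0r.
rewrite ecd Dc_same mul1mx -[X in _ = _ - X]scale1r -scalerBl.
by congr (_ *: _); have := Xsub cd; move=> h; field.
Qed.

Lemma Dc_anti x z a b : Dc x z a b = - Dc z x b a.
Proof.
by rewrite /Dc [z == x]eq_sym; case: eqP; rewrite ?oppr0 // -invrN opprB.
Qed.

(** The scalar by which the square of [psi] acts on a word with distinct letters. *)
Definition Sc (x z : I) a b : K :=
  Qc x z a b * Qc z x b a + Dc x z a b * Dc x z a b.

Lemma psiM_sq w a b w' : size (w ++ [:: a, b & w']) = n -> a != b ->
  psiM (size w) *m (psiM (size w) *m bv (w ++ [:: a, b & w'])) =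
  Sc (rho w a) (rho w b) a b *: bv (w ++ [:: a, b & w']).
Proof.
move=> h ab; have ba : b != a by rewrite eq_sym.
rewrite psiM_diff // mulmxDr -!scalemxAr (psiM_diff (size_sw h) ba) psiM_diff //.
rewrite (Dc_anti (rho w b)) !scalerDr !scalerA [X in _ + X = _]addrC addrACA.
rewrite -!scalerDl [X in _ + X *: _ = _](_ : _ = 0); last by ring.
by rewrite scale0r addr0.
Qed.

Lemma Sc_far x z a b : far x z -> Sc x z a b = 1.
Proof.
case/and3P=> h1 h2 h3; rewrite /Sc /Qc /Dc [z == x]eq_sym.
by rewrite (negbTE h1) (negbTE h2) (negbTE h3) mulr1 mulr0 addr0.
Qed.
Lemma Sc_eq x a b : a != b -> Sc x x a b = 0.
Proof.
by move=> ab; rewrite /Sc !Qc_same Dc_same -[X b - X a]opprB invrN mulrN addNr.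
Qed.
Lemma x_neq_add1 (x : I) : (x == x + 1) = false.
Proof. by rewrite eq_sym; apply/negbTE/add1_neq. Qed.
Lemma x_neq_add2 (x : I) : (x == x + 1 + 1) = false.
Proof.
by apply/negbTE; rewrite eq_sym -subr_eq0 -[x + 1 + 1]addrA [x + _]addrC addrK.
Qed.
Lemma Sc_up x a b : Sc x (x + 1) a b = X b - X a.
Proof.
rewrite /Sc /Qc /Dc x_neq_add1 x_neq_add2 [x + 1 == x]eq_sym x_neq_add1 eqxx.
by rewrite mul1r mulr0 addr0.
Qed.
Lemma Sc_down x a b : Sc (x + 1) x a b = X a - X b.
Proof.
rewrite /Sc /Qc /Dc [x + 1 == x]eq_sym x_neq_add1 eqxx x_neq_add2.
by rewrite mulr1 mulr0 addr0.
Qed.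

(** All quadratic relations at once: [P] is the right-hand side, compared with
    the scalar [Sc] on each basis vector. *)
Lemma rep_sq s (a b : I) t (P : M) : size (s ++ [:: a, b & t]) = n ->
  (forall w1 c w2, size (w1 ++ [:: c, c & w2]) = n -> size w1 = size s ->
     a = b + 1 -> P *m bv (w1 ++ [:: c, c & w2]) = 0) ->
  (forall w1 c d w2, size (w1 ++ [:: c, d & w2]) = n -> size w1 = size s -> c != d ->
     P *m bv (w1 ++ [:: c, d & w2]) = Sc a b c d *: bv (w1 ++ [:: c, d & w2])) ->
  psiM (size s) * psiM (size s) * eM (s ++ [:: a, b & t]) = P * eM (s ++ [:: a, b & t]).
Proof.
move=> hs h1 h2; apply: mx_ext => w hw; rewrite !mxM.
have [->|[w1 [c [d [w2 [ew e1 ea eb ->]]]]]] := ee_case hw hs; first by rewrite !mulmx0.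
subst w; rewrite -e1; case: (eqVneq c d) => [ecd|cd].
  subst d; rewrite psiM_same // mulmx0 h1 //.
  by rewrite ea eb next_code_same res_below subrK.
by rewrite psiM_sq // h2 // ea eb next_code_other.
Qed.

Lemma rep_sq_eq s (a : I) t : size (s ++ [:: a, a & t]) = n ->
  psiM (size s) * psiM (size s) * eM (s ++ [:: a, a & t]) = 0.
Proof.
move=> hs; rewrite (rep_sq (P := 0) hs) ?mul0r //.
  by move=> w1 c w2 _ _ _; rewrite mul0mx.
by move=> w1 c d w2 _ _ cd; rewrite mul0mx Sc_eq // scale0r.
Qed.
Lemma rep_sq_far s (a b : I) t : size (s ++ [:: a, b & t]) = n -> far a b ->
  psiM (size s) * psiM (size s) * eM (s ++ [:: a, b & t]) = eM (s ++ [:: a, b & t]).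
Proof.
move=> hs hf; rewrite (rep_sq (P := 1) hs) ?mul1r //.
  by move=> w1 c w2 _ _ e; case/and3P: hf; rewrite e eqxx.
by move=> w1 c d w2 _ _ cd; rewrite mul1mx Sc_far // scale1r.
Qed.
Lemma rep_sq_up s (a : I) t : size (s ++ [:: a, a + 1 & t]) = n ->
  psiM (size s) * psiM (size s) * eM (s ++ [:: a, a + 1 & t]) =
  (yM (size s).+1 - yM (size s)) * eM (s ++ [:: a, a + 1 & t]).
Proof.
move=> hs; apply: rep_sq => // [w1 c w2 hw <- /eqP|w1 c d w2 hw <- cd].
  by rewrite x_neq_add2.
by rewrite mulmxBl yM_bv // yM_bv' // Sc_up scalerBl.
Qed.
Lemma rep_sq_down s (a : I) t : size (s ++ [:: a + 1, a & t]) = n ->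
  psiM (size s) * psiM (size s) * eM (s ++ [:: a + 1, a & t]) =
  (yM (size s) - yM (size s).+1) * eM (s ++ [:: a + 1, a & t]).
Proof.
move=> hs; apply: rep_sq => // [w1 c w2 hw <- _|w1 c d w2 hw <- cd].
  by rewrite mulmxBl yM_bv // yM_bv' // subrr.
by rewrite mulmxBl yM_bv // yM_bv' // Sc_down scalerBl.
Qed.

Lemma rep_psiy k m : (k.+1 < n)%N -> (m < n)%N -> m <> k -> m <> k.+1 ->
  psiM k * yM m = yM m * psiM k.
Proof.
move=> hk hm h1 h2; apply: mx_ext => w hw; rewrite !mxM.
have [w1 [a [b [w2 [ew e1]]]]] := word_split hw hk; subst w k.
rewrite op_bv // psiM_gen // -scalemxAr psiM_gen // mulmxDr -!scalemxAr.
rewrite !op_bv ?(size_sw hw) //.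
suff -> : nth a0 (w1 ++ [:: b, a & w2]) m = nth a0 (w1 ++ [:: a, b & w2]) m.
  by rewrite scalerDr !scalerA [X _ * Qc _ _ _ _]mulrC [X _ * Dc _ _ _ _]mulrC.
rewrite !nth_cat; case: ltnP => // hm1.
by case e2: (m - size w1)%N => [|[|j]] //=; move: hm1 e2 h1 h2; clear; lia.
Qed.

Lemma rep_psipsi k m : (k.+1 < m)%N -> (m.+1 < n)%N ->
  psiM k * psiM m = psiM m * psiM k.
Proof.
move=> km hm; apply: mx_ext => w hw; rewrite !mxM.
have [u [c [d [w3 [ew e1]]]]] := word_split hw hm; subst w m.
have [w1 [a [b [w2 [eu e2]]]]] := split_at km; subst u k.
have h1 c' d' : (w1 ++ [:: a, b & w2]) ++ [:: c', d' & w3] =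
   w1 ++ [:: a, b & w2 ++ [:: c', d' & w3]] by rewrite -catA.
have h2 c' d' : (w1 ++ [:: b, a & w2]) ++ [:: c', d' & w3] =
   w1 ++ [:: b, a & w2 ++ [:: c', d' & w3]] by rewrite -catA.
have hw1 a' b' c' d' : size (w1 ++ [:: a', b' & w2 ++ [:: c', d' & w3]]) = n.
  by rewrite -hw; size_lia.
have hw2 a' b' c' d' : size ((w1 ++ [:: a', b' & w2]) ++ [:: c', d' & w3]) = n.
  by rewrite -hw; size_lia.
have sz : size (w1 ++ [:: a, b & w2]) = size (w1 ++ [:: b, a & w2]) by rewrite !size_cat.
case: (eqVneq a b) => [ab|ab].
  subst b; rewrite psiM_gen // !h1 [in RHS]psiM_same // mulmx0 mulmxDr -!scalemxAr.
  by rewrite !psiM_same // !scaler0 addr0.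
case: (eqVneq c d) => [cd|cd].
  subst d; rewrite psiM_same // mulmx0 h1 psiM_diff // -h1 -h2.
  rewrite mulmxDr -!scalemxAr psiM_same // {1}sz psiM_same //.
  by rewrite !scaler0 addr0.
set u := w1 ++ [:: a, b & w2] in h1 sz hw *; set u' := w1 ++ [:: b, a & w2] in h2 sz.
have pu : perm_eq u u'.
  by rewrite perm_cat2l -[[:: a, b & w2]]/([:: a] ++ [:: b] ++ w2) perm_catCA.
have E1 c' d' : psiM (size w1) *m bv (u ++ [:: c', d' & w3]) =
    Qc (rho w1 a) (rho w1 b) a b *: bv (u' ++ [:: c', d' & w3]) +
    Dc (rho w1 a) (rho w1 b) a b *: bv (u ++ [:: c', d' & w3]).
  by rewrite h1 h2 psiM_diff.
have E2 := psiM_diff hw cd.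
have E3 : psiM (size u) *m bv (u' ++ [:: c, d & w3]) =
    Qc (rho u c) (rho u d) c d *: bv (u' ++ [:: d, c & w3]) +
    Dc (rho u c) (rho u d) c d *: bv (u' ++ [:: c, d & w3]).
  by rewrite sz (psiM_diff (hw2 b a c d)) // !(next_code_perm _ pu).
rewrite E2 (E1 c d) !mulmxDr -!scalemxAr !E1 E2 E3 !scalerDr !scalerA addrACA.
by congr (_ + _ + (_ + _)); congr (_ *: _); exact: mulrC.
Qed.
Section Braid.
Variables (w1 w2 : seq 'I_l).
Hypothesis hw : (size w1 + (size w2).+3 = n)%N.
Let T a b c := bv (w1 ++ [:: a, b, c & w2]).
Let P1 := psiM (size w1).
Let P2 := psiM (size w1).+1.
Let p a := rho w1 a.
Let p' a b := rho (a :: w1) b.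

Let size_triple a b c : size (w1 ++ [:: a, b, c & w2]) = n.
Proof. by rewrite size_cat -hw. Qed.
Let hT a b c : size (rcons w1 a ++ [:: b, c & w2]) = n.
Proof. by rewrite cat_rcons. Qed.

Lemma p'_same a : p' a a = p a - 1.
Proof. by rewrite /p' next_code_same res_below. Qed.
Lemma p'_diff a b : a != b -> p' a b = p b.
Proof. by move=> ab; rewrite /p' next_code_other. Qed.

Lemma P1_same a c : P1 *m T a a c = 0.
Proof. exact: psiM_same. Qed.
Lemma P1_diff a b c : a != b -> P1 *m T a b c =
  Qc (p a) (p b) a b *: T b a c + Dc (p a) (p b) a b *: T a b c.
Proof. exact: psiM_diff. Qed.
Lemma P2_same a b : P2 *m T a b b = 0.
Proof.
by rewrite /T -cat_rcons /P2 -(size_rcons w1 a); apply: psiM_same.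
Qed.
Lemma P2_diff a b c : b != c -> P2 *m T a b c =
  Qc (p' a b) (p' a c) b c *: T a c b + Dc (p' a b) (p' a c) b c *: T a b c.
Proof.
move=> bc; have pr : perm_eq (rcons w1 a) (a :: w1) by rewrite perm_rcons.
have := psiM_diff (hT a b c) bc; rewrite !(next_code_perm _ pr) !cat_rcons size_rcons.
exact.
Qed.

Lemma x_sub1_neq (x : I) : (x == x - 1) = false.
Proof. by rewrite -(inj_eq (addIr 1)) subrK eq_sym x_neq_add1. Qed.
Lemma x_sub2_neq (x : I) : (x - 1 == x + 1) = false.
Proof. by rewrite -(inj_eq (addIr 1)) subrK x_neq_add2. Qed.

Lemma braid_aac a c : a != c ->
  0 = P2 *m (P1 *m (P2 *m T a a c)) + braid_const K (p a) (p' a a) (p c) *: T a a c.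
Proof.
move=> ac; have ca : c != a by rewrite eq_sym.
rewrite P2_diff // mulmxDr -!scalemxAr P1_same scaler0 addr0 P1_diff //.
rewrite scalerDr mulmxDr -!scalemxAr P2_same !scaler0 add0r P2_diff //.
rewrite p'_same p'_diff // /braid_const.
case: (eqVneq (p c) (p a)) => [e|ne]; last first.
  by rewrite [Dc (p a) _ _ _]Dc_diff 1?eq_sym // scale0r scaler0 add0r /= scale0r.
rewrite e Dc_same /Dc /Qc x_sub1_neq [p a - 1 == p a]eq_sym x_sub1_neq x_sub2_neq.
rewrite subrK eqxx scale0r addr0 scale1r scalerA /=.
have -> : (p a == p a - 1 - 1) = false.
  by rewrite -(inj_eq (addIr 1)) subrK eq_sym x_sub2_neq.
rewrite -scalerDl; have h := Xsub ac.
by rewrite -[X c - X a]opprB mulrN mulVf // addNr scale0r.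
Qed.

Lemma braid_abb a b : a != b ->
  P1 *m (P2 *m (P1 *m T a b b)) = braid_const K (p a) (p b) (p b - 1) *: T a b b.
Proof.
move=> ab; have ba : b != a by rewrite eq_sym.
rewrite P1_diff // mulmxDr -!scalemxAr P2_same scaler0 addr0 P2_diff //.
rewrite scalerDr mulmxDr -!scalemxAr P1_same !scaler0 add0r P1_diff //.
rewrite p'_same p'_diff // /braid_const.
case: (eqVneq (p a) (p b - 1)) => [e|ne]; last first.
  by rewrite [Dc (p a) (_ - 1) _ _]Dc_diff // !(scale0r, scaler0).
rewrite e Dc_same /Dc /Qc [p b - 1 == p b]eq_sym x_sub1_neq x_sub2_neq subrK eqxx.
rewrite scale0r addr0 scale1r scalerA /=.
have h := Xsub ab.
by rewrite -[X b - X a]opprB mulrN mulVf.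
Qed.

Lemma braid_aba a b : a != b ->
  P1 *m (P2 *m (P1 *m T a b a)) = 0 /\ P2 *m (P1 *m (P2 *m T a b a)) = 0.
Proof.
move=> ab; have ba : b != a by rewrite eq_sym.
have D0 : Dc (p a) (p b) a b * Dc (p b) (p a - 1) b a = 0.
  case: (eqVneq (p a) (p b)) => [e|ne]; last by rewrite Dc_diff // mul0r.
  by rewrite -e [X in _ * X]Dc_diff ?mulr0 // x_sub1_neq.
split.
  rewrite P1_diff // mulmxDr -!scalemxAr P2_same scaler0 add0r P2_diff //.
  rewrite scalerDr mulmxDr -!scalemxAr P1_same !scaler0 add0r scalerA p'_same p'_diff //.
  by rewrite D0 scale0r.
rewrite P2_diff // mulmxDr -!scalemxAr P1_same scaler0 add0r P1_diff //.
rewrite scalerDr mulmxDr -!scalemxAr P2_same !scaler0 add0r scalerA p'_same p'_diff //.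
by rewrite [_ * Dc (p a) _ _ _]mulrC D0 scale0r.
Qed.

(** For distinct letters all six permuted words occur, and the relation is an
    identity between rational functions in the dots, for each coincidence of the
    three residues. *)
Lemma braid_abc a b c : a != b -> b != c -> a != c ->
  P1 *m (P2 *m (P1 *m T a b c)) =
  P2 *m (P1 *m (P2 *m T a b c)) + braid_const K (p a) (p b) (p c) *: T a b c.
Proof.
move=> ab bc ac.
have ba : b != a by rewrite eq_sym.
have cb : c != b by rewrite eq_sym.
have ca : c != a by rewrite eq_sym.
do 3! rewrite ?(P1_diff _ ab) ?(P1_diff _ ba) ?(P1_diff _ ac) ?(P1_diff _ ca)
  ?(P1_diff _ bc) ?(P1_diff _ cb) ?P2_diff ?p'_diff // ?mulmxDr -?scalemxAr.
have hab := Xsub ab; have hbc := Xsub bc; have hac := Xsub ac.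
have hba := Xsub ba; have hcb := Xsub cb; have hca := Xsub ca.
move: (T a b c) (T b a c) (T a c b) (T b c a) (T c a b) (T c b a).
move=> t1 t2 t3 t4 t5 t6; apply/matrixP => i j; rewrite !mxE.
move: (t1 i j) (t2 i j) (t3 i j) (t4 i j) (t5 i j) (t6 i j).
clear t1 t2 t3 t4 t5 t6 => t1 t2 t3 t4 t5 t6.
move: (p a) (p b) (p c) => x z u.
case: (eqVneq x u) => [<-{u}|xu]; last first.
  rewrite /braid_const [u == x]eq_sym (negbTE xu) /= (Dc_diff _ _ xu).
  case: (eqVneq x z) => [<-{z}|xz].
    by rewrite !(Dc_diff _ _ xu) Dc_same !Qc_same; field; rewrite hab hba.
  rewrite (Dc_diff _ _ xz); case: (eqVneq z u) => [<-{u xu}|zu].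
    by rewrite !Dc_same !Qc_same; field; rewrite hbc hcb.
  by rewrite (Dc_diff _ _ zu); ring.
case: (eqVneq x z) => [<-{z}|xz].
  rewrite /braid_const eqxx x_sub1_neq x_neq_add1 /= !Dc_same !Qc_same mul0r addr0.
  by field; rewrite hab hbc hac hba hcb.
have zx : z != x by rewrite eq_sym.
rewrite !(Dc_diff _ _ xz) !(Dc_diff _ _ zx) Dc_same Qc_same /braid_const eqxx /=.
case: (eqVneq x (z - 1)) => [e|ne1].
  have -> : z = x + 1 by rewrite e subrK.
  rewrite /Qc x_neq_add1 x_neq_add2 [x + 1 == x]eq_sym x_neq_add1 eqxx.
  by field.
case: (eqVneq x (z + 1)) => [->|ne2].
  rewrite /Qc x_neq_add1 x_neq_add2 [z + 1 == z]eq_sym x_neq_add1 eqxx.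
  by field.
have ne3 : (z == x + 1) = false.
  by apply: contraNF ne1 => /eqP ->; rewrite addrK.
by rewrite /Qc (negbTE xz) (negbTE zx) (negbTE ne2) ne3; field.
Qed.
End Braid.
Lemma braid_const_mx (x z u : I) (v : V) :
  braid_const M x z u *m v = braid_const K x z u *: v.
Proof.
rewrite /braid_const; case: ifP => _; first by rewrite mulNmx mul1mx scaleN1r.
by case: ifP => _; rewrite ?mul1mx ?scale1r // mul0mx scale0r.
Qed.

Lemma rep_braid s (a b c : I) t : size (s ++ [:: a, b, c & t]) = n ->
  psiM (size s) * psiM (size s).+1 * psiM (size s) * eM (s ++ [:: a, b, c & t]) =
  (psiM (size s).+1 * psiM (size s) * psiM (size s).+1 + braid_const M a b c)
    * eM (s ++ [:: a, b, c & t]).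
Proof.
move=> hs; apply: mx_ext => w hw; rewrite !mxM eM_bv //.
case: eqP => e; last by rewrite !mulmx0.
have [w1 [x [z [u [w2 [ew e1]]]]]] : exists w1 x z u w2,
    w = w1 ++ [:: x, z, u & w2] /\ size w1 = size s.
  have [|w1 [x [z [w2 [ew e1]]]]] := @word_split w (size s) hw.
    by rewrite -hs; size_lia.
  case: w2 ew => [|u w2] ew; last by exists w1, x, z, u, w2.
  by have := hs; rewrite -hw ew !size_cat e1 /=; clear; lia.
subst w; rewrite /wres wcodes_split map_cat /= in e.
case/cat_inj_size: e; first by rewrite size_map size_wcodes.
move=> _ [ea eb ec _]; rewrite -e1.
have hw' : (size w1 + (size w2).+3 = n)%N by rewrite -hw size_cat.
rewrite mulmxDl !mxM braid_const_mx -ea -eb -ec.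
case: (eqVneq x z) => [exz|xz].
  subst z; rewrite P1_same // !mulmx0; case: (eqVneq x u) => [exu|xu].
    subst u; rewrite P2_same // !mulmx0 add0r /braid_const !next_code_same !res_below.
    by rewrite [_ - 1 - 1 == _]eq_sym -[_ == _ - 1 - 1](inj_eq (addIr 1)) subrK
      [_ + 1 == _ - 1]eq_sym x_sub2_neq /= scale0r.
  have -> : next_code [:: x, x & w1] u = next_code w1 u by rewrite !next_code_other.
  exact: braid_aac.
have zx : z != x by rewrite eq_sym.
rewrite (next_code_other _ xz); case: (eqVneq z u) => [ezu|zu].
  subst u; rewrite P2_same // !mulmx0 add0r next_code_other // next_code_same res_below.
  exact: braid_abb.
case: (eqVneq x u) => [exu|xu].
  subst u; rewrite next_code_same next_code_other // res_below.
  have [-> ->] := braid_aba hw' xz.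
  by rewrite /braid_const eq_sym x_sub1_neq scale0r addr0.
rewrite !next_code_other //; exact: braid_abc.
Qed.

Lemma wres_head c w : wres (c :: w) = res (l + c)%N :: map res (wcodes [:: c] w).
Proof. by rewrite /wres /= /next_code /= mul1n. Qed.

Lemma res_row1 m (c : 'I_l) : (l <= m < l + l)%N -> res (l + c)%N = res m -> m = (l + c)%N.
Proof.
move=> hm e; have hc := ltn_ord c; case: (ltngtP m (l + c)%N) => // h.
  have hh : (m < l + c < m + l)%N by move: hm hc h; clear; lia.
  by have := res_far hh; rewrite e far_refl.
have hh : (l + c < m < l + c + l)%N by move: hm hc h; clear; lia.
by have := res_far hh; rewrite e far_refl.
Qed.

Lemma rep_first (a : I) s : size (a :: s) = n ->
  (forall m, (l <= m < l + l)%N -> a <> res m) -> eM (a :: s) = 0.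
Proof.
move=> hs ha; apply: mx_ext => w hw; rewrite eM_bv // mul0mx.
case: eqP => // e; case: w hw e => [|c w] hw; first by rewrite -hw in hs.
rewrite wres_head => -[e _]; case: (ha (l + c)%N) => //.
by rewrite leq_addr ltn_add2l ltn_ord.
Qed.

Lemma rep_second m s : size s = n.-2 -> (l <= m < l + l)%N ->
  eM [:: res m, res m + 1 & s] = 0.
Proof.
move=> hs hm; apply: mx_ext => w hw; rewrite eM_bv // mul0mx.
case: eqP => // e; case: w hw e => [|c [|d w]] hw //.
rewrite /wres /= => -[+ e2 _]; rewrite {1}/next_code /= mul1n => e1.
have em := res_row1 hm e1; subst m.
case: (eqVneq c d) => [ecd|cd].
  subst d; move: e2; rewrite next_code_same res_below => /eqP.
  by rewrite /next_code /= mul1n x_sub2_neq.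
move: e2; rewrite next_code_other // /next_code /= mul1n => e2.
have hc := ltn_ord c; have hd := ltn_ord d.
case: (ltngtP c d) => h; last by rewrite (ord_inj h) eqxx in cd.
  have /far_neq[_ _] := @res_far (l + c)%N (l + d)%N ltac:(move: h hd; clear; lia).
  by [].
have /far_neq[_ + _] := @res_far (l + d)%N (l + c)%N ltac:(move: h hc; clear; lia).
by [].
Qed.

Lemma rep_y0 m s : size (res m :: s) = n -> (l <= m < l + l)%N ->
  yM 0 * eM (res m :: s) = (X (comp_of l_gt0 m))%:M * eM (res m :: s).
Proof.
move=> hs hm; apply: mx_ext => w hw; rewrite !mxM eM_bv //.
case: eqP => e; last by rewrite !mulmx0.
case: w hw e => [|c w] hw; first by rewrite -hw in hs.
rewrite wres_head => -[e _]; have -> : comp_of l_gt0 m = c.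
  by rewrite (res_row1 hm e); apply: val_inj; rewrite /= modnDl modn_small.
by rewrite mul_scalar_mx (yM_bv (w := [::])).
Qed.

Lemma rep_ye k s : (k < n)%N -> size s = n -> yM k * eM s = eM s * yM k.
Proof.
move=> hk hs; apply: mx_ext => w hw; rewrite !mxM eM_bv // op_bv // -scalemxAr eM_bv //.
by case: eqP => _; rewrite ?op_bv // mulmx0 scaler0.
Qed.

Lemma rep_idem s : eM s * eM s = eM s.
Proof.
apply: mx_ext => w hw; rewrite mxM eM_bv //; case: eqP => e; last by rewrite mulmx0.
by rewrite eM_bv // e eqxx.
Qed.
Lemma rep_orth s t : s <> t -> eM s * eM t = 0.
Proof.
move=> st; apply: mx_ext => w hw; rewrite mxM eM_bv // mul0mx.
case: eqP => e; last by rewrite mulmx0.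
by rewrite eM_bv // e; case: eqP => // h; case: st.
Qed.
Lemma rep_one : exists2 ss : seq (seq I),
  all (fun s => size s == n) ss & 1 = \sum_(s <- ss) eM s.
Proof.
exists (undup [seq wres (val v) | v : word <- enum {: word}]).
  apply/allP => s; rewrite mem_undup => /mapP [v _ ->].
  by rewrite size_wres size_tuple.
apply: mx_ext => w hw; rewrite mul1mx mulmx_suml.
have hw' : size w == n by apply/eqP.
have hin : wres w \in undup [seq wres (val v) | v : word <- enum {: word}].
  rewrite mem_undup; apply/mapP; exists (Tuple hw') => //.
  by rewrite mem_enum.
rewrite (bigD1_seq (wres w)) ?undup_uniq //= eM_bv // eqxx big1 ?addr0 // => s.
by rewrite eM_bv // eq_sym => /negbTE ->.
Qed.

Lemma rep_laws (xs : nat -> M) : (forall m, xs m = (X (comp_of l_gt0 m))%:M) ->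
  klr_laws n l res psiM yM eM xs.
Proof.
move=> hxs; split.
- by move=> s _; apply: rep_idem.
- by move=> s t _ _; apply: rep_orth.
- exact: rep_one.
- exact: rep_first.
- exact: rep_second.
- by move=> m s hs hm; rewrite hxs; apply: rep_y0.
- exact: rep_ye.
- exact: rep_psie.
- exact: rep_psiy.
- exact: rep_psipsi.
- exact: rep_psiyhi.
- exact: rep_yhipsi.
- exact: rep_sq_eq.
- exact: rep_sq_far.
- exact: rep_sq_up.
- exact: rep_sq_down.
- exact: rep_braid.
Qed.
End Representation.

(** * Matrix units and independence over a field *)
Section TableauWords.
Local Open Scope nat_scope.
Variables (l n : nat) (l_gt0 : 0 < l).
Implicit Types (t s : seq nat).

Definition cword t : seq 'I_l := map (comp_of l_gt0) t.

Lemma std_prefix t p y q : ~ nonstd l t -> t = p ++ (y + l) :: q -> y \in t -> y \in p.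
Proof.
move=> nst e; rewrite e mem_cat inE => /or3P[//|/eqP|yq]; first by move: l_gt0; clear; lia.
by case: nst; exists y, p, q.
Qed.

Lemma std_prefix_col t p y q k : ~ nonstd l t -> t = p ++ (y + k.+1 * l) :: q ->
  (forall j, j <= k -> y + j * l \in t) -> y \in p.
Proof.
elim: k p q => [|k IH] p q nst e hy.
  rewrite mul1n in e; apply: (std_prefix nst e).
  by have := hy 0 (leqnn _); rewrite addn0.
have e' : y + k.+2 * l = y + k.+1 * l + l by rewrite mulSn [l + _]addnC addnA.
rewrite e' in e; have hp := std_prefix nst e (hy k.+1 (leqnn _)).
have [p1 [p2 ep]] : exists p1 p2, p = p1 ++ (y + k.+1 * l) :: p2.
  by case/splitPr: hp => p1 p2; exists p1, p2.
rewrite ep mem_cat (IH p1 (p2 ++ (y + k.+1 * l + l) :: q)) //.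
  by rewrite e ep -catA.
by move=> j jk; apply: hy; apply: leqW.
Qed.

(** The components alone determine a standard list: if two lists of nodes first
    differ in [c] and [c'] of the same component, then the smaller of these is
    above the other in the column, and standardness places it in the common part,
    which contradicts that the entries are distinct. *)
Lemma cword_inj_lt s t t' p c c' q q' : diag l s -> perm_eq t' s -> uniq t ->
  ~ nonstd l t' -> t = p ++ c :: q -> t' = p ++ c' :: q' -> l <= c ->
  comp_of l_gt0 c = comp_of l_gt0 c' -> c < c' -> False.
Proof.
move=> ds pt ut nst e e' lc ecc cc.
have [k ek] : exists k, c' = c + k.+1 * l.
  have h := congr1 val ecc; rewrite /= in h.
  have h1 := divn_eq c l; have h2 := divn_eq c' l.
  have hq : c %/ l < c' %/ l.
    rewrite ltnNge; apply/negP => hle; move: cc; rewrite h1 h2 h ltn_add2r ltnNge.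
    by rewrite leq_mul2r hle orbT.
  exists (c' %/ l - c %/ l).-1; rewrite prednK ?subn_gt0 // mulnBl.
  have : c %/ l * l <= c' %/ l * l by rewrite leq_mul2r (ltnW hq) orbT.
  move: h1 h2 h; clear; move: (_ * l) (_ * l) (_ %% _) (_ %% _); lia.
have hcol j : j <= k.+1 -> c + j * l \in t'.
  move=> jk; have -> : j = k.+1 - (k.+1 - j) by move: jk; clear; lia.
  elim: (k.+1 - j) (leq_subr j k.+1) => [|i IH] hi.
    by rewrite subn0 -ek e' mem_cat inE eqxx orbT.
  have h := IH (ltnW hi); move: h; rewrite (perm_mem pt) => h.
  have [_ hd] := ds; have [_ hd'] := hd _ h.
  have e1 : k.+1 - i = (k.+1 - i.+1).+1 by move: hi; clear; lia.
  have e2 : c + (k.+1 - i) * l = c + (k.+1 - i.+1) * l + l.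
    by rewrite e1 mulSn [l + _]addnC addnA.
  rewrite (perm_mem pt); have : c + (k.+1 - i) * l - l \in s.
    by apply: hd'; rewrite e2 leq_add2r (leq_trans lc) // leq_addr.
  by rewrite e2 addnK.
rewrite ek in e'; have hcp : c \in p.
  by apply: std_prefix_col nst e' _ => j jk; apply: hcol; apply: leqW.
by move: ut; rewrite e cat_uniq /= hcp /= andbF.
Qed.

Lemma cword_inj s s' t t' : diag l s -> diag l s' -> perm_eq t s -> perm_eq t' s' ->
  ~ nonstd l t -> ~ nonstd l t' -> cword t = cword t' -> t = t'.
Proof.
move=> ds ds' pt pt' nst nst' ew.
have us u : diag l u -> uniq u.
  by case=> h _; apply: sorted_uniq h; [apply: ltn_trans | apply: ltnn].
have ut : uniq t by rewrite (perm_uniq pt) us.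
have ut' : uniq t' by rewrite (perm_uniq pt') us.
suff h p q q' : t = p ++ q -> t' = p ++ q' -> q = q'.
  by apply: (h [::]).
elim: q p q' => [|c q IH] p q' e e'.
  have := congr1 size ew; rewrite !size_map e e' !size_cat addn0.
  by case: q' {e'} => //= a q'; clear; lia.
case: q' e' => [|c' q'] e'.
  by have := congr1 size ew; rewrite !size_map e e' !size_cat /=; clear; lia.
have ecc : comp_of l_gt0 c = comp_of l_gt0 c'.
  have := ew; rewrite /cword e e' !map_cat /=.
  by case/cat_inj_size => // _ /(congr1 (head (comp_of l_gt0 c))).
have lc : l <= c by apply: (ds.2 c _).1; rewrite -(perm_mem pt) e mem_cat inE eqxx orbT.
have lc' : l <= c' by apply: (ds'.2 c' _).1; rewrite -(perm_mem pt') e' mem_cat inE eqxx orbT.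
case: (ltngtP c c') => cc.
- by case: (cword_inj_lt ds' pt' ut nst' e e' lc ecc cc).
- by case: (cword_inj_lt ds pt ut' nst e' e lc' (esym ecc) cc).
- subst c'; congr (_ :: _); apply: (IH (rcons p c)); by rewrite cat_rcons.
Qed.

Lemma cword_std_inj (lam mu : par1 l n) (s : std lam) (t : std mu) :
  cword (tseq (sval s)) = cword (tseq (sval t)) ->
  Tagged (fun lam : par1 l n => std lam) s = Tagged (fun lam : par1 l n => std lam) t.
Proof.
move=> h.
have e := cword_inj (diag_dseq l_gt0 lam) (diag_dseq l_gt0 mu) (perm_tseq l_gt0 (sval s))
  (perm_tseq l_gt0 (sval t)) (std_tseq l_gt0 (t := s)) (std_tseq l_gt0 (t := t)) h.
have elm : lam = mu.
  apply: (dseq_inj l_gt0); apply: (irr_sorted_eq ltn_trans ltnn); try exact: sorted_dseq.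
  move=> c; rewrite -(perm_mem (perm_tseq l_gt0 (sval s))) e.
  by rewrite (perm_mem (perm_tseq l_gt0 (sval t))).
subst mu; congr Tagged; do 2 apply: val_inj; apply/ffunP => k.
by apply: (bcode_inj l_gt0); have := congr1 (nth 0 ^~ k) e; rewrite /= !nth_tseq.
Qed.
End TableauWords.

Section MatrixUnits.
Variables (K : fieldType) (I : nzRingType) (l n : nat) (l_gt0 : (0 < l)%N).
Variables (res : nat -> I) (X : 'I_l -> K).
Hypothesis res_below : forall c, res (c + l) = res c - 1.
Hypothesis res_far : forall c d, (c < d < c + l)%N -> far (res c) (res d).
Hypothesis two_neq0 : 1 + 1 != 0 :> I.
Hypothesis X_inj : injective X.

Local Notation word := (n.-tuple 'I_l).
Local Notation N := #|{: n.-tuple 'I_l}|.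
Local Notation M := 'M[K]_N.
Local Notation bv := (@bv K l n).
Local Notation psiM := (psiM n l_gt0 res X).
Local Notation yM := (yM n l_gt0 X).
Local Notation eM := (@eM K I l n res).
Implicit Types (a b : 'I_l) (w u : seq 'I_l).

Definition scK : {rmorphism K -> M} := @scalar_mx K N.

Local Notation gen := (gen_alg n scK psiM yM eM).

Definition word_unit w u : M := op (fun v => if v == u then bv w else 0).

Lemma word_unit_bv w u v : size v = n -> word_unit w u *m bv v = if v == u then bv w else 0.
Proof. by move=> hv; rewrite op_bv. Qed.

Lemma scK_mx c (P : M) v : (scK c * P) *m v = c *: (P *m v) :> 'cV[K]_N.
Proof. by rewrite mxM /scK /= mul_scalar_mx. Qed.

Let a0 : 'I_l := Ordinal l_gt0.

(** Lagrange interpolation in the dot [y_k], whose eigenvalues are the [X a]. *)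
Lemma gen_letter k a : (k < n)%N -> exists2 P : M, gen P &
  forall w, size w = n -> P *m bv w = if nth a0 w k == a then bv w else 0.
Proof.
move=> hk.
have aux (bs : seq 'I_l) : a \notin bs -> exists (P : M) (g : 'I_l -> K),
    [/\ gen P, forall w, size w = n -> P *m bv w = g (nth a0 w k) *: bv w,
        g a = 1 & forall b, b \in bs -> g b = 0].
  elim: bs => [|b bs IH]; first by exists 1, (fun=> 1); split=> // [|w _];
    [exact: B_one | rewrite mul1mx scale1r].
  rewrite inE negb_or => /andP[ab /IH [P [g [gP hP ga hg]]]].
  exists (scK (X a - X b)^-1 * ((yM k - scK (X b)) * P)).
  exists (fun c => (X a - X b)^-1 * ((X c - X b) * g c)); split.
  - apply: B_mul; first exact: B_sc.
    by apply: B_mul => //; apply: B_sub; [apply: B_y | apply: B_sc].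
  - move=> w hw; rewrite scK_mx mxM hP // -scalemxAr mulmxBl op_bv //.
    rewrite /scK /= mul_scalar_mx -scalerBl !scalerA; congr (_ *: _); ring.
  - by rewrite ga mulr1 mulVf // Xsub.
  - move=> c; rewrite inE => /orP[/eqP ->|/hg ->]; last by rewrite !mulr0.
    by rewrite subrr mul0r mulr0.
have [|P [g [gP hP ga hg]]] := aux [seq b <- enum 'I_l | b != a].
  by rewrite mem_filter eqxx.
exists P => // w hw; rewrite hP //; case: eqP => [->|/eqP ne]; first by rewrite ga scale1r.
by rewrite hg ?scale0r // mem_filter ne mem_enum.
Qed.

Lemma gen_unit_diag w : size w = n -> gen (word_unit w w).
Proof.
move=> hw; have aux (ks : seq nat) : all (fun k => k < n)%N ks -> exists2 P : M, gen P &
    forall u, size u = n -> P *m bv u =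
      if all (fun k => nth a0 u k == nth a0 w k) ks then bv u else 0.
  elim: ks => [|k ks IH] /=; first by exists 1 => [|u _]; [exact: B_one | rewrite mul1mx].
  case/andP=> hk /IH [P gP hP]; have [Q gQ hQ] := gen_letter (nth a0 w k) hk.
  exists (Q * P); first exact: B_mul.
  move=> u hu; rewrite mxM hP //; case: ifP => _; last by rewrite mulmx0 andbF.
  by rewrite hQ // andbT.
have [|P gP hP] := aux (iota 0 n); first by apply/allP => k; rewrite mem_iota.
suff -> : word_unit w w = P by [].
apply: mx_ext => u hu; rewrite word_unit_bv // hP //; case: eqP => [->|ne].
  by rewrite (_ : all _ _ = true) //; apply/allP.
case: ifP => // /allP h; case: ne; apply: (@eq_from_nth _ a0); first by rewrite hu hw.
by move=> k hk; apply/eqP; apply: h; rewrite mem_iota -hu.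
Qed.

Lemma word_unit_mul w u v : size u = n -> word_unit w u * word_unit u v = word_unit w v.
Proof.
move=> hu; apply: mx_ext => x hx; rewrite mxM !word_unit_bv //.
by case: ifP => _; rewrite ?mulmx0 // word_unit_bv // eqxx.
Qed.

(** Between two diagonal units only the exchange part of [psi] survives, and its
    coefficient is invertible. *)
Lemma gen_unit_swap w k : size w = n -> (k.+1 < n)%N ->
  gen (word_unit (swap_at k w) w).
Proof.
move=> hw hk; have [w1 [a [b [w2 [ew e1]]]]] := word_split hw hk.
subst w k; rewrite swap_atE; case: (eqVneq a b) => [->|ab].
  by apply: gen_unit_diag; rewrite -hw !size_cat.
set w := _ ++ _ in hw *; set w' := w1 ++ [:: b, a & w2].
have hw' : size w' = n by rewrite -hw !size_cat.
have ne : w <> w'.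
  by move=> e; case/cat_inj_size: e => // _ [e _]; rewrite e eqxx in ab.
pose q := Qc X (res (next_code w1 a)) (res (next_code w1 b)) a b.
have q0 : q != 0.
  rewrite /q /Qc; case: ifP => _; first by rewrite invr_neq0 // Xsub.
  by case: ifP => _; rewrite ?oner_neq0 // Xsub.
have -> : word_unit w' w = scK q^-1 * (word_unit w' w' * (psiM (size w1) * word_unit w w)).
  apply: mx_ext => u hu; rewrite scK_mx !mxM !word_unit_bv //.
  case: eqP => _; last by rewrite !mulmx0 scaler0.
  rewrite psiM_diff // mulmxDr -!scalemxAr !word_unit_bv // eqxx.
  by case: eqP => // _; rewrite scaler0 addr0 scalerA mulVf // scale1r.
apply: B_mul; first exact: B_sc.
apply: B_mul; first exact: gen_unit_diag.
by apply: B_mul; [apply: B_psi | apply: gen_unit_diag].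
Qed.

Lemma gen_unit_state (s0 u : seq nat) : diag l s0 -> size s0 = n -> valid n u ->
  gen (word_unit (cword l_gt0 (state s0 u)) (cword l_gt0 s0)) /\
  gen (word_unit (cword l_gt0 s0) (cword l_gt0 (state s0 u))).
Proof.
move=> ds hs; have szc v : size (cword l_gt0 (state s0 v)) = n.
  by rewrite size_map (size_state hs).
elim/last_ind: u => [|u k IH].
  by move=> _; split; apply: gen_unit_diag; rewrite size_map.
rewrite valid_rcons => /andP[hk /IH [h1 h2]].
have e : cword l_gt0 (state s0 (rcons u k)) = swap_at k (cword l_gt0 (state s0 u)).
  by rewrite state_rcons /cword map_swap_at.
split.
  rewrite -(word_unit_mul _ _ (szc u)); apply: B_mul => //.
  by rewrite e; apply: gen_unit_swap.
rewrite -(word_unit_mul _ _ (szc u)); apply: B_mul => //.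
have -> : cword l_gt0 (state s0 u) = swap_at k (cword l_gt0 (state s0 (rcons u k))).
  by rewrite e swap_atK.
exact: gen_unit_swap.
Qed.

Section Independence.
Variable red : 'S_n -> seq 'I_n.-1.
Hypothesis hred : forall w : 'S_n, reduced_expression w (red w).

Definition tunit (lam : par1 l n) (s t : std lam) : M :=
  word_unit (cword l_gt0 (tseq (sval s))) (cword l_gt0 (tseq (sval t))).

Lemma gen_tunit lam (s t : std lam) : gen (tunit s t).
Proof.
have ds := diag_dseq l_gt0 lam; have sz := size_dseq lam.
have [h1 _] := gen_unit_state ds sz (valid_word (red (dperm (sval s)))).
have [_ h2] := gen_unit_state ds sz (valid_word (red (dperm (sval t)))).
rewrite -!/(tword red _) !state_tword // in h1 h2.
have h := B_mul h1 h2; rewrite word_unit_mul // in h.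
by rewrite size_map.
Qed.

Local Notation idx := {lam : par1 l n & (std lam * std lam)%type}.
Local Notation cellM := (cell red res psiM eM).

Definition cidx (i : idx) : M := cellM (tagged i).1 (tagged i).2.
Definition uidx (i : idx) : M := tunit (tagged i).1 (tagged i).2.

Lemma sum_idx (P : forall lam : par1 l n, std lam -> std lam -> M) :
  \sum_lam \sum_s \sum_t P lam s t = \sum_(j : idx) P (tag j) (tagged j).1 (tagged j).2.
Proof.
under eq_bigr do rewrite pair_bigA /=.
by rewrite sig_big_dep.
Qed.

Lemma uidx_span i : exists r : idx -> K, uidx i = \sum_j r j *: cidx j.
Proof.
have L := rep_laws res_below res_far two_neq0 X_inj (xs := fun m => scK (X (comp_of l_gt0 m)))
  (fun=> erefl) (n := n).
have scc c (x : M) : scK c * x = x * scK c by apply/esym/scalar_mxC.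
have Xb c : X (comp_of l_gt0 (c + l)) = X (comp_of l_gt0 c).
  by congr X; apply: val_inj; rewrite /= modnDr.
have := gen_cells scc L l_gt0 res_below res_far two_neq0 Xb
  (@chosen_ok l n l_gt0 red hred) (@chosen_valid l n red) (gen_tunit (tagged i).1 (tagged i).2).
case/(cells_sum l_gt0 (P := predT)) => // r e.
exists (fun j => r (tag j) (tagged j).1 (tagged j).2).
rewrite /uidx e (sum_idx (fun lam s t => scK (r lam s t) * cellM s t)).
apply: eq_bigr => j _.
by rewrite /scK /= -[_ * _]/(_ *m _) mul_scalar_mx.
Qed.

Lemma uidx_bv i (s t : std (tag i)) : (tagged i) = (s, t) ->
  uidx i *m bv (cword l_gt0 (tseq (sval t))) = bv (cword l_gt0 (tseq (sval s))).
Proof.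
by move=> e; rewrite /uidx e word_unit_bv ?eqxx // size_map size_tseq.
Qed.

Lemma bv_free (w : seq 'I_l) : size w = n -> exists2 f : 'rV[K]_N,
  (f *m bv w) 0 0 = 1 & forall u, size u = n -> u != w -> (f *m bv u) 0 0 = 0.
Proof.
move/eqP=> hw; pose W : word := Tuple hw; exists (delta_mx 0 (enum_rank W)).
  rewrite /bv (insubT (fun s => size s == n) hw) /= mul_delta_mx mxE !eqxx.
  by [].
move=> u /eqP hu ne; rewrite /bv (insubT (fun s => size s == n) hu) mul_delta_mx_0 ?mxE //.
by rewrite (inj_eq enum_rank_inj); apply: contra ne => /eqP/(congr1 val) /= ->.
Qed.

Lemma uidx_free (c : idx -> K) : \sum_j c j *: uidx j = 0 -> forall i, c i = 0.
Proof.
move=> h [lam [s t]]; pose i : idx := Tagged (fun lam : par1 l n => (std lam * std lam)%type) (s, t); rewrite -/i.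
have szt (mu : par1 l n) (x : std mu) : size (cword l_gt0 (tseq (sval x))) = n by rewrite size_map size_tseq.
have [f f1 f0] := bv_free (szt _ s).
have := congr1 (fun P : M => (f *m (P *m bv (cword l_gt0 (tseq (sval t))))) 0 0) h.
rewrite mul0mx mulmx0 mulmx_suml mulmx_sumr summxE [RHS]mxE (bigD1 i) //=.
rewrite -scalemxAl -scalemxAr mxE (uidx_bv (i := i) (s := s) erefl) f1 mulr1.
rewrite big1 ?addr0 // => -[mu [s' t']] ne.
rewrite -scalemxAl -scalemxAr mxE /uidx /= word_unit_bv //.
case: eqP => [e1|_]; last by rewrite mulmx0 mxE mulr0.
rewrite f0 ?mulr0 //; apply: contra ne => /eqP e2.
have e3 := cword_std_inj e1; have e4 := cword_std_inj e2.
have emu : mu = lam := esym (congr1 tag e3).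
subst mu; have -> : s' = s by move/eqP: e4; rewrite eq_Tagged => /eqP.
by have -> : t' = t by move/eqP: e3; rewrite eq_Tagged => /eqP.
Qed.

(** The cells span the matrix units [uidx], which are equally many and linearly
    independent, so that they are independent themselves. *)
Lemma cidx_free (c : idx -> K) : \sum_j c j *: cidx j = 0 -> forall i, c i = 0.
Proof.
pose Xs : #|{: idx}|.-tuple M := [tuple cidx (enum_val i) | i < #|{: idx}|].
pose Ys : #|{: idx}|.-tuple M := [tuple uidx (enum_val i) | i < #|{: idx}|].
have fY : free Ys.
  apply/freeP => k hk i; rewrite -(enum_valK i).
  apply: (uidx_free (c := fun j => k (enum_rank j))).
  rewrite (big_enum_val (A := {: idx})) /= -[RHS]hk; apply: eq_bigr => j _.
  by rewrite enum_valK -tnth_nth tnth_mktuple.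
have sub : (<<Ys>> <= <<Xs>>)%VS.
  apply/span_subvP => _ /tnthP [i ->]; rewrite tnth_mktuple.
  have [r ->] := uidx_span (enum_val i); apply: memv_suml => j _.
  apply/memvZ/memv_span; apply/tnthP; exists (enum_rank j).
  by rewrite tnth_mktuple enum_rankK.
have fX : free Xs.
  rewrite /free eqn_leq dim_span andTb.
  by rewrite [size Xs]size_tuple -[X in (X <= _)%N](size_tuple Ys) -(eqP fY) dimvS.
move=> h i; rewrite -(enum_rankK i).
move/freeP: fX => /(_ (fun k => c (enum_val k))); apply.
rewrite -[RHS]h (big_enum_val (A := {: idx})); apply: eq_bigr => j _.
by rewrite -tnth_nth tnth_mktuple.
Qed.

Lemma cells_free (r : forall lam : par1 l n, std lam -> std lam -> K) :
  \sum_lam \sum_s \sum_t scK (r lam s t) * cellM s t = 0 ->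
  forall lam s t, r lam s t = 0.
Proof.
rewrite (sum_idx (fun lam s t => scK (r lam s t) * cellM s t)) => h lam s t.
apply: (@cidx_free (fun j => r (tag j) (tagged j).1 (tagged j).2) _
  (Tagged (fun lam : par1 l n => (std lam * std lam)%type) (s, t))).
rewrite -[RHS]h; apply: eq_bigr => j _.
by rewrite /scK /= -[RHS]/(_ *m _) mul_scalar_mx.
Qed.
End Independence.
End MatrixUnits.

(** * Independence in the blob algebra by deformation *)
Lemma fseq_split e n (i : iseq e n) (r : 'I_n.-1) : exists s t,
  [/\ size s = r, fseq i = s ++ [:: i (lo r), i (hi r) & t] &
      fseq (sact r i) = s ++ [:: i (hi r), i (lo r) & t]].
Proof.
have [|s [a [b [t [ei es]]]]] := @split_at _ r (fseq i).
  by rewrite size_fseq; have := ltn_ord r; clear; lia.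
have hs : size (s ++ [:: a, b & t]) = n by rewrite -ei size_fseq.
have ii : i = seqf n (s ++ [:: a, b & t]) by rewrite -ei fseqK.
exists s, t; rewrite ii (seqf_swap hs (esym es)) seqf_lo // seqf_hi // !seqfK //.
by rewrite -hs !size_cat.
Qed.

Lemma fseq_split3 e n (i : iseq e n) (r r' : 'I_n.-1) : r' = r.+1 :> nat -> exists s t,
  size s = r /\ fseq i = s ++ [:: i (lo r), i (hi r), i (hi r') & t].
Proof.
move=> hr; have [s [t [es ei _]]] := fseq_split i r.
have [s' [t' [es' ei' _]]] := fseq_split i r'.
exists s, t'; split=> //; rewrite ei; congr (_ ++ [:: _, _ & _]).
have e1 : drop (size s).+2 (fseq i) = t 
    by rewrite ei -(addn2 (size s)) addnC -drop_drop drop_size_cat //= drop0.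
by rewrite -e1 ei' es -hr -es' -(addn1 (size s')) addnC -drop_drop drop_size_cat.
Qed.

Lemma fseq_head e n (i : iseq e n) (k : 'I_n) : k = 0%N :> nat ->
  fseq i = i k :: behead (fseq i).
Proof.
case: n i k => [|n] i k hk; first by case: k hk.
by rewrite /fseq enum_ordSl /=; congr (i _ :: _); apply/val_inj/esym.
Qed.

Lemma fseq_head2 e n (i : iseq e n) (k k' : 'I_n) : k = 0%N :> nat -> k' = 1%N :> nat ->
  fseq i = [:: i k, i k' & behead (behead (fseq i))].
Proof.
case: n i k k' => [|[|n]] i k k' hk hk'; first by case: k hk.
  by have := ltn_ord k'; rewrite hk'.
rewrite /fseq !enum_ordSl /=; congr [:: i _, i _ & _]; exact/val_inj/esym.
Qed.

Section Deformation.
Variables (F : fieldType) (e l n : nat) (khat : 'I_l -> int).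
Hypothesis he : (1 < e)%N.
Hypothesis hl : (1 < l)%N.
Hypothesis hk : strongly_adjacency_free e n khat.
Let kappa := khat_res e khat.
Let l_gt0 : (0 < l)%N := ltnW hl.
Local Notation B := (blob F n kappa).
Local Notation res := (nres e khat hl).

Local Notation O := {poly F}.
Local Notation K := {fraction {poly F}}.
Local Notation N := #|{: n.-tuple 'I_l}|.
Local Notation M := 'M[K]_N.

(** Pairwise distinct for generic ['X] and all zero at ['X = 0]. *)
Definition generic_dot (m : 'I_l) : K := tofrac ('X^(m.+1) : O).

Lemma generic_dot_inj : injective generic_dot.
Proof.
move=> a b /eqP; rewrite tofrac_eq => /eqP /(congr1 (fun p : O => size p)).
by rewrite !size_polyXn => -[/val_inj].
Qed.

Local Notation X := generic_dot.
Local Notation psiX := (psiM n l_gt0 res X).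
Local Notation yX := (yM n l_gt0 X).
Local Notation eX := (eM K l n res).

Definition scO : {rmorphism O -> M} := scK K l n \o @tofrac O.

Local Notation genO := (gen_alg n scO psiX yX eX).

Let res_below := @nres_below e l khat hl.
Let res_far := nres_far he hl hk.
Let two := two_neq0 he hl hk.

Definition dotO (m : nat) : O := 'X^((comp_of l_gt0 m).+1).

Lemma generic_laws : klr_laws n l res psiX yX eX (fun m => scO (dotO m)).
Proof. exact: (rep_laws res_below res_far two generic_dot_inj). Qed.
Let L := generic_laws.

Lemma scO_central p (x : M) : scO p * x = x * scO p.
Proof. by apply/esym/scalar_mxC. Qed.

(** Equality at the special point ['X = 0], within the lattice of all matrices
    generated over polynomials. *)
Definition cong (x z : M) := exists2 b, genO b & x - z = scO 'X * b.

Lemma cong_refl x : cong x x.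
Proof. by exists 0; [apply: B_zero | rewrite subrr mulr0]. Qed.
Lemma cong_sym x z : cong x z -> cong z x.
Proof. by case=> b gb h; exists (- b); [apply: B_opp | rewrite mulrN -h opprB]. Qed.
Lemma cong_add x x' z z' : cong x x' -> cong z z' -> cong (x + z) (x' + z').
Proof.
move=> [b gb h] [c gc h']; exists (b + c); first exact: B_add.
by rewrite mulrDr -h -h' opprD addrACA.
Qed.
Lemma cong_trans x z w : cong x z -> cong z w -> cong x w.
Proof.
move=> [b gb h] [c gc h']; exists (b + c); first exact: B_add.
by rewrite mulrDr -h -h' addrA subrK.
Qed.
Lemma cong_mull x z a : genO a -> cong x z -> cong (a * x) (a * z).
Proof.
move=> ga [b gb h]; exists (a * b); first exact: B_mul.
by rewrite -mulrBr h !mulrA scO_central.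
Qed.
Lemma cong_mulr x z a : genO a -> cong x z -> cong (x * a) (z * a).
Proof.
move=> ga [b gb h]; exists (b * a); first exact: B_mul.
by rewrite -mulrBl h !mulrA.
Qed.
Lemma cong_opp x z : cong x z -> cong (- x) (- z).
Proof. by move=> h; rewrite -(mulN1r x) -(mulN1r z); apply: cong_mull => //; apply/B_opp/B_one. Qed.

Definition scF (a : F) : M := scO a%:P.
Arguments scF : simpl never.
Lemma scF1 : scF 1 = 1.
Proof. by rewrite /scF polyC1 rmorph1. Qed.
Lemma scFM a b : scF (a * b) = scF a * scF b.
Proof. by rewrite /scF polyCM (rmorphM scO). Qed.
Lemma scFD a b : scF (a + b) = scF a + scF b.
Proof. by rewrite /scF polyCD (rmorphD scO). Qed.
Lemma scF_central a (x : M) : scF a * x = x * scF a.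
Proof. exact: scO_central. Qed.

Fixpoint ev (x : expr F (blob_gen e n)) : M :=
  match x with
  | Var (GPsi r) => psiX r
  | Var (GY k) => yX k
  | Var (GE i) => eX (fseq i)
  | Zero => 0
  | One => 1
  | Opp x => - ev x
  | Add x y => ev x + ev y
  | Mul x y => ev x * ev y
  | Scale a x => scF a * ev x
  end.

Lemma ev_gen x : genO (ev x).
Proof.
elim: x => [[r|k|i]||||||] /=.
- by apply: B_psi; have := ltn_ord r; clear; lia.
- exact: B_y.
- by apply: B_ee; rewrite size_fseq.
- exact: B_zero.
- exact: B_one.
- by move=> x; apply: B_opp.
- by move=> x hx y hy; apply: B_add.
- by move=> x hx y hy; apply: B_mul.
- by move=> a x hx; apply: B_mul => //; apply: B_sc.
Qed.

Lemma ev_delta (a b : 'Z_e) : ev (delta_expr F n a b) = (a == b)%:R.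
Proof. by rewrite /delta_expr; case: eqP. Qed.
Lemma ev_alpha (a b c : 'Z_e) : ev (alpha_expr F n a b c) = braid_const M a b c.
Proof. by rewrite /alpha_expr /braid_const; do 2?case: ifP. Qed.

Lemma ev_sum_e : ev (\big[@Add F _/Zero]_(i : iseq e n) Var (GE i)) = 1.
Proof.
rewrite (big_morph ev (id1 := 0) (op1 := +%R)) //=; apply: mx_ext => w hw.
rewrite mul1mx mulmx_suml (bigD1 (seqf n (wres res w))) //=.
have hr : size (wres res w) = n by rewrite size_wres.
rewrite eM_bv // seqfK // eqxx big1 ?addr0 // => i ne; rewrite eM_bv //.
by case: eqP => // h; rewrite h fseqK eqxx in ne.
Qed.

Lemma yX_comm k k' : yX k * yX k' = yX k' * yX k.
Proof.
have yb i w : size w = n -> yX i *m bv K n w = X (nth (Ordinal l_gt0) w i) *: bv K n w.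
  exact: op_bv.
apply: mx_ext => w hw; rewrite !mxM !(yb _ _ hw) -!scalemxAr !(yb _ _ hw).
by rewrite !scalerA mulrC.
Qed.

(** The only relation of the blob algebra that fails for the matrices is the one
    for [y_1], whose sides differ by a power of
    ['X] times an idempotent. *)
Lemma ev_rel x y : blob_rel kappa x y -> cong (ev x) (ev y).
Proof.
have eqc u v : u = v -> cong u v by move=> ->; apply: cong_refl.
have sz (i : iseq e n) : size (fseq i) = n by apply: size_fseq.
have row1 (m : 'I_l) : res (l + m) = kappa m by exact: nres_row1.
have row1P (m : 'I_l) : (l <= l + m < l + l)%N by rewrite leq_addr ltn_add2l ltn_ord.
case=> {x y}.
- move=> i j; apply: eqc => /=; case: eqP => [->|ne] /=; first exact: (law_idem L).
  by apply: (law_orth L) => // h; apply: ne; rewrite -(fseqK i) h fseqK.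
- by apply: eqc; rewrite ev_sum_e.
- move=> i k hk0 hi; apply: eqc => /=; rewrite (fseq_head i hk0) (law_first L) //.
    by rewrite -(fseq_head i hk0).
  by move=> m hm; rewrite (row1_nres e khat hl hm); apply: hi.
- move=> i k k' h0 h1 [m hm] hi; apply: eqc => /=.
  have hs := sz i; rewrite (fseq_head2 i h0 h1) in hs *.
  rewrite hi hm -row1 (law_second L) ?row1P //.
  exact: (congr1 (fun k => k.-2) hs).
- move=> i k hk0 [m hm] /=; have hs := sz i.
  rewrite (fseq_head i hk0) hm -row1 in hs *; rewrite hk0 (law_y0 L hs (row1P m)).
  rewrite /dotO exprS rmorphM -mulrA.
  eexists; last by rewrite subr0.
  by apply: B_mul; [apply: B_sc | apply: B_ee].
- by move=> k i; apply: eqc; apply: (law_ye L).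
- move=> r i; apply: eqc => /=; have [s [t [es e1 e2]]] := fseq_split i r.
  by rewrite e1 e2 -es (law_psie L) // -e1.
- by move=> k k'; apply/eqc/yX_comm.
- move=> r k h1 h2; apply: eqc => /=; apply: (law_psiy L) => //.
  + by have := ltn_ord r; clear; lia.
  + by move=> h; apply/h1/val_inj.
  + by move=> h; apply/h2/val_inj.
- move=> r s /orP[h|h]; apply: eqc => /=; last apply/esym.
    by apply: (law_psipsi L) => //; have := ltn_ord s; clear; lia.
  by apply: (law_psipsi L) => //; have := ltn_ord r; clear; lia.
- move=> r i; apply: eqc; rewrite /= ev_delta; have [s [t [es e1 _]]] := fseq_split i r.
  by have hs := sz i; rewrite e1 in hs *; rewrite -es (law_psiyhi L hs).
- move=> r i; apply: eqc; rewrite /= ev_delta; have [s [t [es e1 _]]] := fseq_split i r.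
  by have hs := sz i; rewrite e1 in hs *; rewrite -es (law_yhipsi L hs).
- move=> r i h; apply: eqc => /=; have [s [t [es e1 _]]] := fseq_split i r.
  by have hs := sz i; rewrite e1 h in hs *; rewrite -es (law_sq_eq L hs).
- move=> r i h1 h2 h3; apply: eqc => /=; have [s [t [es e1 _]]] := fseq_split i r.
  have hs := sz i; rewrite e1 in hs *; rewrite -es (law_sq_far L hs) //.
  apply/and3P; split; apply/eqP => // h; apply: h3; by rewrite h addrK.
- move=> r i h; apply: eqc => /=; have [s [t [es e1 _]]] := fseq_split i r.
  by have hs := sz i; rewrite e1 h in hs *; rewrite -es (law_sq_up L hs).
- move=> r i h; apply: eqc => /=; have [s [t [es e1 _]]] := fseq_split i r.
  have {}h : i (lo r) = i (hi r) + 1 by rewrite h subrK.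
  by have hs := sz i; rewrite e1 h in hs *; rewrite -es (law_sq_down L hs).
- move=> r r' i hr; apply: eqc; rewrite /= ev_alpha.
  have [s [t [es e1]]] := fseq_split3 i hr.
  by have hs := sz i; rewrite e1 in hs *; rewrite hr -es (law_braid L hs).
Qed.

Lemma ev_alg_eq x y : alg_eq (blob_rel kappa) x y -> cong (ev x) (ev y).
Proof.
have eqc u v : u = v -> cong u v by move=> ->; apply: cong_refl.
elim=> {x y} /=.
- exact: ev_rel.
- by move=> x; apply: cong_refl.
- by move=> x y _; apply: cong_sym.
- by move=> x y z _ h1 _; apply: cong_trans.
- by move=> x y _; apply: cong_opp.
- by move=> x x' y y' _ h1 _; apply: cong_add.
- move=> x x' y y' _ h1 _ h2; apply: (cong_trans (z := ev x' * ev y)).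
    by apply: cong_mulr => //; apply: ev_gen.
  by apply: cong_mull => //; apply: ev_gen.
- by move=> a x x' _; apply: cong_mull; apply: B_sc.
all: move=> *; apply: eqc.
- by rewrite addrA.
- by rewrite addrC.
- by rewrite add0r.
- by rewrite addNr.
- by rewrite mulrA.
- by rewrite mul1r.
- by rewrite mulr1.
- by rewrite mulrDl.
- by rewrite mulrDr.
- by rewrite mulrA scFM.
- by rewrite scF1 mul1r.
- by rewrite mulrDr.
- by rewrite scFD mulrDl.
- by rewrite mulrA.
- by rewrite !mulrA scF_central.
Qed.

(** The relation that takes the place of a specialization map from the lattice of
    matrices to the blob algebra: [m] equals, at the special point, the value of
    an expression for [z]. *)
Definition lifts (z : B) (m : M) := genO m /\ cong (ev (repr z)) m.

Lemma lifts_cls x : lifts (cls (blob_rel kappa) x) (ev x).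
Proof. by split; [apply: ev_gen | apply/ev_alg_eq/clsK]. Qed.

Lemma lifts_add z z' m m' : lifts z m -> lifts z' m' -> lifts (z + z') (m + m').
Proof.
move=> [g h] [g' h']; split; first exact: B_add.
apply: cong_trans (cong_add h h').
exact: (lifts_cls (Add (repr z) (repr z'))).2.
Qed.
Lemma lifts_mul z z' m m' : lifts z m -> lifts z' m' -> lifts (z * z') (m * m').
Proof.
move=> [g h] [g' h']; split; first exact: B_mul.
apply: cong_trans (lifts_cls (Mul (repr z) (repr z'))).2 _ => /=.
apply: cong_trans (cong_mulr (ev_gen _) h) _.
exact: cong_mull.
Qed.
Lemma lifts_scale c z m : lifts z m -> lifts (c *: z) (scF c * m).
Proof.
move=> [g h]; have gc := B_sc n scO psiX yX eX c%:P; split; first exact: B_mul.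
apply: cong_trans (lifts_cls (Scale c (repr z))).2 _ => /=.
exact: cong_mull.
Qed.
Lemma lifts_sum (T : finType) (f : T -> B) (g : T -> M) :
  (forall t, lifts (f t) (g t)) -> lifts (\sum_t f t) (\sum_t g t).
Proof.
move=> h; apply: (big_ind2 lifts); first exact: (lifts_cls Zero).
  by move=> *; apply: lifts_add.
by move=> t _; apply: h.
Qed.

Local Notation psiB := (psiN F e n khat).
Local Notation eB := (eeN F n khat).

Lemma lifts_psi k : (k.+1 < n)%N -> lifts (psiB k) (psiX k).
Proof.
move=> hk'; have h : (k < n.-1)%N by move: hk'; clear; lia.
rewrite -[k]/(val (Ordinal h)) psiNE.
exact: (lifts_cls (Var (GPsi e (Ordinal h)))).
Qed.
Lemma lifts_ee (s : seq 'Z_e) : size s = n -> lifts (eB s) (eX s).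
Proof.
by move=> hs; have := lifts_cls (Var (GE (seqf n s))); rewrite /= seqfK.
Qed.
Lemma lifts_word (u : seq nat) : valid n u ->
  lifts (\prod_(k <- u) psiB k) (\prod_(k <- u) psiX k).
Proof.
elim: u => [_|k u IH]; first by rewrite !big_nil; apply: (lifts_cls One).
case/andP=> hk' /IH h; rewrite !big_cons; apply: lifts_mul => //.
exact: lifts_psi.
Qed.

Variable red : 'S_n -> seq 'I_n.-1.
Hypothesis hred : forall w : 'S_n, reduced_expression w (red w).

Local Notation cellB := (cell red res psiB eB).
Local Notation cellX := (cell red res psiX eX).

Lemma lifts_cell (lam : par1 l n) (s t : std lam) : lifts (cellB s t) (cellX s t).
Proof.
have hs : size (map res (dseq lam)) = n by rewrite size_map size_dseq.
rewrite /cell !left_wordE !right_wordE.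
apply: lifts_mul; apply: lifts_mul; try exact: lifts_ee.
  by apply: lifts_word; rewrite /valid all_rev; apply: valid_word.
by apply: lifts_word; apply: valid_word.
Qed.

(** A linear relation between the cells of the blob algebra lifts to a relation
    between matrices with error a multiple of ['X] in the lattice; the error is a
    polynomial combination of cells, and comparing coefficients modulo ['X]
    gives zero. *)
Theorem blob_cells_free (r : forall lam : par1 l n, std lam -> std lam -> F) :
  \sum_lam \sum_s \sum_t r lam s t *: cellB s t = 0 ->
  forall lam s t, r lam s t = 0.
Proof.
move=> h; have [_] : lifts (\sum_lam \sum_s \sum_t r lam s t *: cellB s t)
    (\sum_lam \sum_s \sum_t scF (r lam s t) * cellX s t).
  by do 3!apply: lifts_sum => ?; apply/lifts_scale/lifts_cell.
rewrite h => /(cong_trans (cong_sym (lifts_cls Zero).2)) /cong_sym [b gb].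
rewrite (_ : ev Zero = 0) // subr0 => e1.
have dot_below c : dotO (c + l) = dotO c.
  by rewrite /dotO /=; congr 'X^(_.+1); rewrite modnDr.
have := gen_cells scO_central L l_gt0 res_below res_far two dot_below
  (@chosen_ok l n l_gt0 red hred) (@chosen_valid l n red) gb.
case/(cells_sum l_gt0 (P := predT)) => // o e2.
have e3 : \sum_lam \sum_s \sum_t
    scK K l n (tofrac ((r lam s t)%:P - 'X * o lam s t)) * cellX s t = 0.
  apply/eqP; move/eqP: e1; rewrite -subr_eq0 e2 mulr_sumr -sumrB; congr (_ == 0).
  apply: eq_bigr => lam _; rewrite mulr_sumr -sumrB; apply: eq_bigr => s _.
  rewrite mulr_sumr -sumrB; apply: eq_bigr => t _.
  rewrite [scO 'X * _]mulrA -mulrBl.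
  congr (_ * _); rewrite -(rmorphM scO) /scF -(rmorphB scO).
 by [].
move=> lam s t; have /eqP := cells_free res_below res_far two generic_dot_inj hred e3 s t.
rewrite tofrac_eq0 subr_eq0 => /eqP /(congr1 (fun p : O => p`_0)).
by rewrite coefC eqxx coefXM.
Qed.
End Deformation.

(** * The graded cellular basis *)
Section Cellularity.
Variables (F : fieldType) (e l n : nat) (khat : 'I_l -> int).
Hypothesis he : (1 < e)%N.
Hypothesis hl : (1 < l)%N.
Hypothesis hn : (1 < n)%N.
Hypothesis hk : strongly_adjacency_free e n khat.
Variable red : 'S_n -> seq 'I_n.-1.
Hypothesis hred : forall w : 'S_n, reduced_expression w (red w).
Local Notation kappa := (khat_res e khat).
Let l_gt0 : (0 < l)%N := ltnW hl.
Local Notation B := (blob F n kappa).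
Local Notation res := (nres e khat hl).
Local Notation psiB := (psiN F e n khat).
Local Notation yB := (yN F e n khat).
Local Notation eB := (eeN F n khat).
Local Notation scB := (bsc (F := F) e n khat).
Local Notation cellB := (cell red res psiB eB).
Local Notation c := (blob_c F kappa red).

Let L := blob_laws F e khat hl hn.
Let res_below := @nres_below e l khat hl.
Let res_far := nres_far he hl hk.
Let two := two_neq0 he hl hk.
Let Ch_ok := @chosen_ok l n l_gt0 red hred.
Let Ch_valid := @chosen_valid l n red.
Let scC : forall a (x : B), scB a * x = x * scB a := @bsc_central F e l n khat.

Lemma blob_gen_alg (x : B) : gen_alg n scB psiB yB eB x.
Proof.
elim/pres_ind: x; elim.
- case=> [r|k|i].
  + rewrite -[cls _ _]/(bpsi F kappa r) -psiNE; apply: B_psi.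
    by have := ltn_ord r; clear; lia.
  + by rewrite -[cls _ _]/(by_ F kappa k) -yNE; apply: B_y.
  + by rewrite -(fseqK i); apply: B_ee; apply: size_fseq.
- exact: B_zero.
- exact: B_one.
- by move=> x hx; rewrite clsN; apply: B_opp.
- by move=> x hx y hy; rewrite clsD; apply: B_add.
- by move=> x hx y hy; rewrite clsM; apply: B_mul.
- by move=> a x hx; rewrite clsZ -bscE; apply: B_mul => //; apply: B_sc.
Qed.

Lemma star_prod (u : seq 'I_n.-1) :
  blob_star (\prod_(r <- u) bpsi F kappa r) = \prod_(r <- rev u) bpsi F kappa r.
Proof.
elim: u => [|r u IH]; first by rewrite !big_nil blob_star1.
rewrite big_cons blob_starM IH rev_cons -cats1 big_cat big_seq1.
by congr (_ * _); apply: blob_star_gen.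
Qed.

Lemma ee_dseq (lam : par1 l n) :
  eB (map res (dseq lam)) = be F kappa (res_seq kappa (tlam lam)).
Proof.
congr be; apply/ffunP => k; rewrite !ffunE.
rewrite (nth_map 0%N) ?size_dseq // dseqE nth_tseq nresE.
by [].
Qed.

(** The reversal in [left_word] is the anti-involution applied to the chosen word. *)
Lemma cell_blob (lam : par1 l n) (s t : std lam) : cellB s t = c s t.
Proof.
rewrite /cell left_wordE right_wordE ee_dseq /blob_c /blob_m /psi_perm star_prod.
rewrite /tword -map_rev !big_map -!mulrA [be _ _ _ * (_ * _)]mulrA be_idem eqxx !mulrA.
by congr (_ * _ * _); apply: eq_bigr => r _; rewrite psiNE.
Qed.

Lemma blob_span (D : seq nat -> Prop) (P : pred (par1 l n)) (x : B) :
  (forall lam, D (dseq lam) -> P lam) ->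
  cells scB n l res psiB eB (chosen l red) D x ->
  exists r : forall lam, std lam -> std lam -> F,
    x = \sum_(lam | P lam) \sum_s \sum_t r lam s t *: c s t.
Proof.
move=> DP /(cells_sum l_gt0 DP) [r ->]; exists r.
by do 3!apply: eq_bigr => ? _; rewrite bscE cell_blob.
Qed.

Lemma blob_cell_basis : is_basis (fun (lam : par1 l n) (s t : std lam) => c s t).
Proof.
split=> [x|r h]; last first.
  apply: (blob_cells_free he (hl := hl) hk hred); rewrite -[RHS]h.
  by do 3!apply: eq_bigr => ? _; rewrite cell_blob.
have := gen_cells scC L l_gt0 res_below res_far two (fun=> erefl) Ch_ok Ch_valid
  (blob_gen_alg x).
exact: (blob_span (P := predT)).
Qed.

Lemma blob_cell_mul (lam : par1 l n) (s : std lam) (a : B) : exists r : std lam -> F,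
  forall t : std lam, higher_span (fun (lam : par1 l n) (s t : std lam) => c s t) lam
    (a * c s t - \sum_u r u *: c u t).
Proof.
have ds := diag_dseq l_gt0 lam; have hs := size_dseq lam.
have := gen_left_span scC L l_gt0 res_below res_far two (fun=> erefl) Ch_ok
  ds hs (blob_gen_alg a) (valid_word (red (dperm (sval s)))).
case/(left_span_sum l_gt0) => r [j [hj e1]]; exists r => t.
have -> : a * c s t - \sum_u r u *: c u t =
    j * right_word res psiB eB (dseq lam) (tword red (sval t)).
  rewrite -/(tword red (sval s)) in e1.
  rewrite -cell_blob /cell mulrA e1 mulrDl mulr_suml -addrA -sumrB big1 ?addr0 // => u _.
  by rewrite -cell_blob /cell -mulrA bscE subrr.
have {}hj := ideal_mulr (right_word_gen scB res psiB yB eB hs (valid_word (red (dperm (sval t))))) hj.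
have := ideal_cells scC L l_gt0 res_below res_far two (fun=> erefl) Ch_ok Ch_valid ds hs hj.
by apply: blob_span => mu; apply: domlt_par1.
Qed.

(** The degree of [e(i) * psi_u]: each letter is a crossing of two strands whose
    residues are known. *)
Fixpoint word_deg (i : iseq e n) (u : seq 'I_n.-1) : int :=
  if u is r :: u' then psi_deg r i + word_deg (sact r i) u' else 0.

Lemma homog_word i (u : seq 'I_n.-1) :
  blob_homog (word_deg i u) (be F kappa i * \prod_(r <- u) bpsi F kappa r).
Proof.
elim: u i => [|r u IH] i; first by rewrite big_nil mulr1; apply: H_e.
rewrite big_cons; set j := sact r i; set P := \prod_(_ <- u) _.
have -> : be F kappa i * (bpsi F kappa r * P) = bpsi F kappa r * be F kappa j * (be F kappa j * P).
  by rewrite !mulrA be_psi -[_ * be F kappa j * be F kappa j]mulrA be_idem eqxx.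
apply: H_mul; last exact: IH.
have -> : psi_deg r i = psi_deg r j by rewrite !psi_degE sact_lo sact_hi gdeg_sym.
exact: H_psi.
Qed.

Lemma homog_star d (x : B) : blob_homog d x -> blob_homog d (blob_star x).
Proof.
elim=> {d x}.
- by move=> i; rewrite blob_star_gen; apply: H_e.
- by move=> k; rewrite blob_star_gen; apply: H_y.
- move=> r i; rewrite blob_starM !blob_star_gen.
  have -> : psi_deg r i = psi_deg r (sact r i) by rewrite !psi_degE sact_lo sact_hi gdeg_sym.
  by rewrite -/(be F kappa i) -/(bpsi F kappa r) be_psi; apply: H_psi.
- by move=> d; rewrite (blob_starE kappa Zero); apply: H_zero.
- by move=> d a x y _ hx _ hy; rewrite blob_starP; apply: H_lin.
- by move=> d d' x y _ hx _ hy; rewrite blob_starM addrC; apply: H_mul.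
Qed.

Lemma star_c (lam : par1 l n) (s t : std lam) : blob_star (c s t) = c t s.
Proof.
by rewrite /blob_c /blob_m !blob_starM blob_starK mulrA blob_star_gen.
Qed.

Lemma homog_c (lam : par1 l n) (s t : std lam) :
  let i := res_seq kappa (tlam lam) in
  blob_homog (word_deg i (red (dperm (sval s))) + word_deg i (red (dperm (sval t)))) (c s t).
Proof.
move=> i; have -> : c s t =
    blob_star (be F kappa i * psi_perm F kappa red (dperm (sval s))) *
    (be F kappa i * psi_perm F kappa red (dperm (sval t))).
  by rewrite blob_starM blob_star_gen -/(be F kappa i) mulrA -[_ * be _ _ _ * be _ _ _]mulrA
    be_idem eqxx.
by apply: H_mul; first apply: homog_star; apply: homog_word.
Qed.

Theorem blob_graded_cellular : graded_cellular_basis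
    (fun (lam : par1 l n) (s t : std lam) => c s t)
    (blob_grading F n kappa) (@blob_star F e n l kappa).
Proof.
split; first split.
- exact: blob_cell_basis.
- split; [exact: blob_starP | exact: blob_starM | exact: blob_star1 |].
  exact: (inv_bij (@blob_starK F e n l kappa)).
- exact: star_c.
- exact: blob_cell_mul.
exists (fun lam s => word_deg (res_seq kappa (tlam lam)) (red (dperm (sval s)))).
exact: homog_c.
Qed.
End Cellularity.

Theorem theorem38 (F : fieldType) (e l n : nat) (q : F) (khat : 'I_l -> int)
    (he : (1 < e)%N) (hl : (1 < l)%N) (hn : (1 < n)%N)
    (hq1 : q != 1) (hq : e.-primitive_root q)
    (hk : strongly_adjacency_free e n khat)
    (red : 'S_n -> seq 'I_n.-1)
    (hred : forall w : 'S_n, reduced_expression w (red w)) :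
  graded_cellular_basis
    (fun (lam : par1 l n) (s t : std lam) =>
       blob_c F (khat_res e khat) red s t)
    (blob_grading F n (khat_res e khat))
    (@blob_star F e n l (khat_res e khat)).
Proof. by apply: blob_graded_cellular. Qed.
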